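(* Let $E$ be a finite set, $P=(p(x,y))_{x,y\in E}$ a stochastic matrix on $E$, and $D\subset E$ a nonempty subset such that the restriction $P_D$ of $P$ to $D$ is irreducible. Let $\pi$ be the quasistationary distribution in $D$, let $1-\lambda$ be the spectral radius of $P_D$, and for $n\ge 2$ let $\eta^n_\infty$ be a random element of $\mathscr{P}(D)$ distributed according to the unique stationary distribution of the empirical distribution of the Fleming--Viot particle system with $n$ particles. Then, as $n\to+\infty$, the fluctuation field $\sqrt{n}(\eta^n_\infty-\pi)$ converges in distribution, in $\mathscr{M}(D)$, to a centered Gaussian random variable with covariance operator $K:\mathscr{C}(D)\to\mathscr{M}(D)$ defined by $$\langle Kf,f\rangle = \mathrm{Var}_\pi(f)+2\lambda\int_{0}^{+\infty} e^{2\lambda s}\,\mathrm{Var}_\pi(Q_s f)\,\mathrm{d}s,$$ for any $f\in\mathscr{C}(D)$ such that $\langle\pi,f\rangle=0$.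
   Context: $\mathscr{C}(D)$ is the space of functions $D\to\mathbb{R}$, $\mathscr{M}(D)$ the space of finite signed measures on $D$ (both can be identified with $\mathbb{R}^D$), $\langle\rho,f\rangle=\sum_{x\in D}\rho(x)f(x)$ for $\rho\in\mathscr{M}(D)$ and $f\in\mathscr{C}(D)$, and $\mathscr{P}(D)\subset\mathscr{M}(D)$ is the set of probability measures on $D$. Write $p_D(x,y)=p(x,y)$ for $x,y\in D$, $P_Df(x)=\sum_{y\in D}p_D(x,y)f(y)$, and $q(x)=\sum_{y\in E\setminus D}p(x,y)=1-\sum_{y\in D}p_D(x,y)$. Irreducibility of $P_D$ means: for all $x,y\in D$ there is $m\ge1$ with $(P_D)^m(x,y)>0$. By the Perron--Frobenius theorem, the spectral radius of $P_D$ is $1-\lambda$ for some $\lambda\in[0,1)$, and there is a unique $\pi\in\mathscr{P}(D)$ with $P_D^*\pi=(1-\lambda)\pi$, i.e. $\sum_{x\in D}\pi(x)p_D(x,y)=(1-\lambda)\pi(y)$ for all $y\in D$. Let $(x_t)_{t\ge0}$ be the continuous-time Markov chain on $E$ with infinitesimal generator $Lf(x)=\sum_{y\in E}p(x,y)[f(y)-f(x)]$, and let $\tau_D=\inf\{t\ge0:x_t\notin D\}$. Then $\pi$ is the unique quasistationary distribution of $(x_t)_{t\ge0}$ in $D$, that is, the unique probability measure on $D$ such that $\mathbb{P}_\pi(x_t\in\cdot\mid\tau_D>t)=\pi(\cdot)$ for all $t\ge0$. Here $\mathbb{P}_\pi$ indicates that $x_0$ is distributed according to $\pi$, and $\mathbb{E}_x$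 below indicates that $x_0=x$. For $f\in\mathscr{C}(D)$, $\mathrm{Var}_\pi(f)=\sum_{x\in D}\pi(x)(f(x)-\langle\pi,f\rangle)^2$. For $t\ge0$, $Q_tf(x)=\mathbb{E}_x[f(x_t)\mathbf{1}_{\{\tau_D>t\}}]=e^{t(P_D-I)}f(x)$ for $x\in D$, where $I$ is the identity of $\mathscr{C}(D)$. Fleming--Viot process: for $n\ge2$, $\mathscr{P}^n(D)$ is the set of $\eta\in\mathscr{P}(D)$ with $n\eta(x)\in\{0,\dots,n\}$ for all $x\in D$. For $x,y\in D$, $\theta^{x,y}\in\mathscr{M}(D)$ is given by $\theta^{x,y}(z)=\mathbf{1}_{\{y=z\}}-\mathbf{1}_{\{x=z\}}$. The empirical distribution of the Fleming--Viot particle system with $n$ particles is the continuous-time Markov chain on the finite set $\mathscr{P}^n(D)$ with infinitesimal generator $$\mathbf{L}^n\phi(\eta)=\sum_{x,y\in D}n\eta(x)\left(p_D(x,y)+q(x)\frac{n\eta(y)}{n-1}\right)\left[\phi\left(\eta+\frac{\theta^{x,y}}{n}\right)-\phi(\eta)\right],$$ for $\phi:\mathscr{P}^n(D)\to\mathbb{R}$. It is irreducible, so it has a unique stationary distribution. A centered Gaussian random variable $\xi$ in $\mathscr{M}(D)$ has covariance operator $K$ when $\mathbb{E}[\langle\xi,f\rangle^2]=\langle Kf,f\rangle$. *)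

(* Defs.v *)
From HB Require Import structures.
From mathcomp Require Import all_boot all_order all_algebra.
From mathcomp Require Import complex.
From mathcomp Require Import all_classical all_reals all_analysis.
Set Implicit Arguments.
Unset Strict Implicit.
Unset Printing Implicit Defensive.
Import Order.TTheory GRing.Theory Num.Theory.
Import numFieldNormedType.Exports.
Local Open Scope classical_set_scope.
Local Open Scope ring_scope.

(* The subset D of E seen as a finite type; both C(D) and M(D) are the type
   pts D -> R, a signed measure being identified with its point masses. *)
Definition pts (E : finType) (D : {set E}) : finType := {x : E | x \in D}.

Definition stochastic (R : realType) (E : finType) (p : E -> E -> R) : Prop :=
  (forall x y, 0 <= p x y) /\ (forall x, \sum_y p x y = 1).

(* exp (t A) f, for an endomorphism A of the functions on X, as the pointwise
   sum of the exponential series.  When A is the generator of a Markov chain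
   with finite state space this is its transition semigroup. *)
Definition op_exp (R : realType) (X : Type) (A : (X -> R) -> X -> R)
    (t : R) (f : X -> R) (x : X) : R :=
  limn (series (fun k : nat => t ^+ k / (k`!)%:R * iter k A f x)).

Definition spectral_radius (R : realType) (k : nat) (A : 'M[R]_k) : R :=
  sup [set Normc.normc z | z in
    [set z : R[i] | eigenvalue (map_mx (real_complex R) A) z]].

Section FiniteSpace.
Variables (R : realType) (T : finType).

Definition pairing (rho f : T -> R) : R := \sum_x rho x * f x.

Definition is_prob (rho : T -> R) : Prop :=
  (forall x, 0 <= rho x) /\ \sum_x rho x = 1.

Definition indicator (A : {set T}) (x : T) : R := (x \in A)%:R.

Definition variance_wrt (rho f : T -> R) : R :=
  \sum_x rho x * (f x - pairing rho f) ^+ 2.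

Definition theta (x y z : T) : R := (y == z)%:R - (x == z)%:R.

End FiniteSpace.

Section Killed.
Variables (R : realType) (E : finType) (p : E -> E -> R) (D : {set E}).

Definition restr (x y : pts D) : R := p (val x) (val y).

Definition restr_op (f : pts D -> R) (x : pts D) : R :=
  \sum_y restr x y * f y.

Definition restr_mx : 'M[R]_#|pts D| :=
  \matrix_(i, j) restr (enum_val i) (enum_val j).

(* The entry (P_D)^m(x,y) is (P_D)^m 1_{y} evaluated at x. *)
Definition irreducible_restr : Prop :=
  forall x y : pts D, exists m : nat,
    (1 <= m)%N /\ 0 < iter m restr_op (indicator R [set y]) x.

Definition exit_prob (x : pts D) : R := \sum_(y | y \notin D) p (val x) y.

(* Q_t = exp (t (P_D - I)):
   Q_t f (x) is the expectation under P_x of f(x_t) on the event tau_D > t. *)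
Definition killed_semigroup (t : R) (f : pts D -> R) : pts D -> R :=
  op_exp (fun g x => restr_op g x - g x) t f.

(* The law of x_t under P_pi conditioned on tau_D > t gives a set A the mass
   <pi, Q_t 1_A> / <pi, Q_t 1>. *)
Definition quasistationary (pi : pts D -> R) : Prop :=
  is_prob pi /\
  forall (t : R), 0 <= t -> forall A : {set pts D},
    pairing pi (killed_semigroup t (indicator R A)) /
      pairing pi (killed_semigroup t (fun=> 1)) = \sum_(x in A) pi x.

Definition empirical_measures (n : nat) : set (pts D -> R) :=
  [set eta | is_prob eta /\
     forall x, exists2 k : nat, (k <= n)%N & n%:R * eta x = k%:R].

(* The generator is written on functions on the whole of M(D).  At a point of
   P^n(D) = empirical_measures n, any term whose argument eta + theta/n is
   outside P^n(D) has rate 0, so L^n phi and exp (t L^n) phi on P^n(D) only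
   depend on phi on P^n(D). *)
Definition fv_generator (n : nat) (phi : (pts D -> R) -> R)
    (eta : pts D -> R) : R :=
  \sum_x \sum_y
    n%:R * eta x
    * (restr x y + exit_prob x * (n%:R * eta y / (n%:R - 1)))
    * (phi (fun z => eta z + theta R x y z / n%:R) - phi eta).

Definition fv_stationary (n : nat) (mu : (pts D -> R) -> R) : Prop :=
  [/\ forall eta, empirical_measures n eta -> 0 <= mu eta,
      \sum_(eta \in empirical_measures n) mu eta = 1 &
      forall (t : R) (phi : (pts D -> R) -> R), 0 <= t ->
        \sum_(eta \in empirical_measures n)
          mu eta * op_exp (fv_generator n) t phi eta =
        \sum_(eta \in empirical_measures n) mu eta * phi eta].

(* K is specified by its quadratic form on the functions f with <pi,f> = 0.
   Measures sqrt n (eta - pi), and hence their limit, have total mass 0; this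
   is K 1 = 0, which determines K on the remaining functions. *)
Definition fluctuation_covariance (lambda : R) (pi : pts D -> R)
    (K : (pts D -> R) -> pts D -> R) : Prop :=
  [/\ linear K,
      forall f g, pairing (K f) g = pairing (K g) f,
      K (fun=> 1) = (fun=> 0) &
      forall f, pairing pi f = 0 ->
        ((pairing (K f) f)%:E =
         (variance_wrt pi f)%:E + (2 * lambda)%:E *
           \int[lebesgue_measure]_(s in `[0%R, +oo[)
             (expR (2 * lambda * s)
              * variance_wrt pi (killed_semigroup s f))%:E)%E].

End Killed.

Section RandomMeasures.
Variables (R : realType) (T : finType).

(* Centered normal law with standard deviation s; the library's normal_prob
   is not the Dirac mass when s = 0. *)
Definition centered_normal (s : R) (B : set R) : \bar R :=
  if s == 0 then \d_(0 : R) B else normal_prob 0 s B.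

(* A random element of M(T) is given by its coordinates. *)
Definition centered_gaussian (d : measure_display) (Omega : measurableType d)
    (Pr : probability Omega R) (xi : T -> {RV Pr >-> R}) : Prop :=
  forall f : T -> R, exists2 s : R, 0 <= s &
    forall B : set R, measurable B ->
      Pr [set w | B (pairing (fun x => xi x w) f)] = centered_normal s B.

Definition has_covariance (d : measure_display) (Omega : measurableType d)
    (Pr : probability Omega R) (xi : T -> {RV Pr >-> R})
    (K : (T -> R) -> T -> R) : Prop :=
  forall f : T -> R,
    ('E_Pr[(fun w => pairing (fun x => xi x w) f ^+ 2)%R]
     = (pairing (K f) f)%:E)%E.

Definition cvg_in_distribution
    (d : nat -> measure_display) (Omega : forall n, measurableType (d n))
    (Pr : forall n, probability (Omega n) R)
    (X : forall n, Omega n -> T -> R)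
    (d' : measure_display) (Omega' : measurableType d')
    (Pr' : probability Omega' R) (xi : Omega' -> T -> R) : Prop :=
  forall h : {ptws T -> R} -> R, continuous h ->
    (exists B : R, forall v, `|h v| <= B) ->
    ('E_(Pr n)[fun w => h (X n w)] @[n --> \oo] --> 'E_Pr'[fun w => h (xi w)])%E.

End RandomMeasures.

(* Main.v *)
Require Import Defs.
From HB Require Import structures.
From mathcomp Require Import all_boot all_order all_algebra.
From mathcomp Require Import complex.
From mathcomp Require Import all_classical all_reals all_analysis.
From mathcomp Require Import measurable_realfun.
From mathcomp Require Import ring lra.
Set Implicit Arguments.
Unset Strict Implicit.
Unset Printing Implicit Defensive.
Import Order.TTheory GRing.Theory Num.Theory.
Import numFieldNormedType.Exports.
Local Open Scope classical_set_scope.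
Local Open Scope ring_scope.

(** Let G = P_D - (1 - lambda) and f_t = exp (lambda t) Q_t f, so that f_t has
    time derivative G f_t.

    Differentiating the quasistationarity of pi at time 0 makes pi a left
    eigenvector of P_D ([quasistationary_eigenmeasure]).  By irreducibility pi
    is positive, there is a positive right eigenfunction h for the same
    eigenvalue, and this eigenvalue is the spectral radius, 1 - lambda
    ([spectral_radius_eigen]).  The Poincare inequality for the weights
    pi (x) p (x, y) h (y) then gives the exponential decay of f_t when
    <pi, f> = 0 ([flow_decay]).

    The particle system only enters through one fact: stationary means of
    L^n phi vanish ([stationary_meanP]).  It is used for two kinds of phi.

    First, phi is the chi-square distance between eta / <eta, h> and pi.
    Dividing by <eta, h> cancels the quadratic term of the mean drift
    <eta, G f> + (<eta, q> - lambda) <eta, f>, and the Poincare inequality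
    yields L^n phi <= - c phi + C / n ([chi2_drift]).  Hence the mean of
    |eta - pi|^2 is of order 1 / n ([deviation_moment]).

    Second, phi is cos (sqrt n <eta, f> + c) with <pi, f> = 0.  Let sigma f be
    the mean square of the jumps of <n eta, f> per particle at eta = pi.  A
    Taylor expansion, with errors controlled by the previous step, shows that
    the stationary means satisfy
      E [sqrt n <eta, G f> sin (..)] + (sigma f / 2) E [cos (..)] = O (1 / sqrt n)
    ([mean_wave]).  With f_t for f, the first term is minus the derivative of
    Psi t = E [cos (sqrt n <eta, f_t> + c)].  Let W be the quadratic form of
    the announced covariance.  It satisfies d/dt W (f_t) = - sigma f_t, so that
    exp (W (f_t) / 2) Psi t is constant up to O (1 / sqrt n).  Since f_t tends
    to 0, Psi 0 tends to cos c exp (- W f / 2) ([characteristic_limit]).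

    The integral in W is obtained algebraically, from a solution S of the
    Lyapunov equation S (G f, g) + S (f, G g) = - <pi, f g>: the derivative of
    S (f_s, f_s) is - <pi, f_s^2> = - exp (2 lambda s) Var_pi (Q_s f)
    ([exists_lyapunov_form], [limit_form_integral]).

    Passing from cosines to bounded continuous functions rests on
    [trig_poly_approx]: such a function on R^D is approximated by a
    trigonometric polynomial up to e (1 + |v|^2) everywhere, so second moments
    control the error ([compare_expectations]).  In dimension one this also
    shows that a law with a second moment is determined by its characteristic
    function, which identifies the laws of a Gaussian random measure built
    from independent normal variables ([exists_gaussian]). *)

(** * Nonnegative kernels and their Perron-Frobenius eigenvectors *)

Section KernelOperator.
Variables (R : realType) (T : finType) (K : T -> T -> R).

Definition kop (f : T -> R) (x : T) : R := \sum_y K x y * f y.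

(** Convertible to [irreducible_restr p D] when K is the restriction of p
    to D. *)
Definition irreducible_kernel : Prop :=
  forall x y : T, exists m : nat,
    (1 <= m)%N /\ 0 < iter m kop (indicator R [set y]) x.

Lemma kopZ (a : R) f : kop (fun y => a * f y) = fun x => a * kop f x.
Proof.
by apply/funext => x; rewrite /kop mulr_sumr; apply: eq_bigr => y _; rewrite mulrCA.
Qed.

Lemma iter_kop_eigen (k : R) f : kop f = (fun x => k * f x) ->
  forall m, iter m kop f = fun x => k ^+ m * f x.
Proof.
move=> kf; elim=> [|m IH] /=; first by apply/funext => x; rewrite expr0 mul1r.
by rewrite IH kopZ kf; apply/funext => x; rewrite mulrA -exprSr.
Qed.

Lemma pairing_iter_kop (k : R) (rho : T -> R) :
  (forall f, pairing rho (kop f) = k * pairing rho f) ->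
  forall m f, pairing rho (iter m kop f) = k ^+ m * pairing rho f.
Proof.
move=> H; elim=> [|m IH] f /=; first by rewrite expr0 mul1r.
by rewrite H IH mulrA -exprS.
Qed.

Hypothesis K0 : forall x y, 0 <= K x y.

Lemma kop_ge f g : (forall x, f x <= g x) -> forall x, kop f x <= kop g x.
Proof. by move=> fg x; apply: ler_sum => y _; apply: ler_wpM2l. Qed.

Lemma iter_kop_ge m f g : (forall x, f x <= g x) ->
  forall x, iter m kop f x <= iter m kop g x.
Proof. by move=> fg; elim: m => //= m IH; apply: kop_ge. Qed.

Lemma pairing_indicator1 (rho : T -> R) y : pairing rho (indicator R [set y]) = rho y.
Proof.
rewrite /pairing (bigD1 y)//= /indicator inE eqxx mulr1 big1 ?addr0// => x xy.
by rewrite inE (negbTE xy) mulr0.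
Qed.

Lemma kop0 : kop (fun=> 0) = fun=> 0.
Proof. by apply/funext => x; rewrite /kop big1// => y _; rewrite mulr0. Qed.

Lemma iter_kop_ge0 m f : (forall x, 0 <= f x) -> forall x, 0 <= iter m kop f x.
Proof.
move=> f0 x; have := iter_kop_ge m f0 x.
by have -> : iter m kop (fun=> 0) = fun=> 0 by elim: m => //= m ->; rewrite kop0.
Qed.

Hypothesis Kirr : irreducible_kernel.

(** If f y > 0 then f dominates a multiple of the indicator of y, and
    iterating the kernel carries this mass to any x. *)
Lemma eigenfunction_gt0 (k : R) f : kop f = (fun x => k * f x) ->
  (forall x, 0 <= f x) -> (exists x, f x != 0) -> forall x, 0 < f x.
Proof.
move=> kf f0 [y fy] x; have {}fy : 0 < f y by rewrite lt_neqAle eq_sym fy f0.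
have [m [_ Km]] := Kirr x y.
have : f y * iter m kop (indicator R [set y]) x <= iter m kop f x.
  have -> : f y * iter m kop (indicator R [set y]) x =
            iter m kop (fun z => f y * indicator R [set y] z) x.
    have E : iter m kop (fun z => f y * indicator R [set y] z) =
      (fun z => f y * iter m kop (indicator R [set y]) z).
      by elim: m {Km} => //= m ->; rewrite kopZ.
    by rewrite E.
  apply: iter_kop_ge => z; rewrite /indicator inE; case: eqP => [->|_].
    by rewrite mulr1.
  by rewrite mulr0.
rewrite (iter_kop_eigen kf) => H.
have : 0 < k ^+ m * f x by apply: lt_le_trans H; rewrite mulr_gt0.
by rewrite [0 < f x]lt_neqAle f0 andbT; case: eqP => // <-; rewrite mulr0 ltxx.
Qed.

(** Dually, a positive mass at x is carried to any y by some power of the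
    kernel. *)
Lemma eigenmeasure_gt0 (k : R) (rho : T -> R) : 0 <= k ->
  (forall f, pairing rho (kop f) = k * pairing rho f) ->
  (forall x, 0 <= rho x) -> (exists x, rho x != 0) ->
  0 < k /\ forall x, 0 < rho x.
Proof.
move=> k0 krho rho0 [x rx].
have {}rx : 0 < rho x by rewrite lt_neqAle eq_sym rx rho0.
have pos y : exists2 m, (1 <= m)%N & 0 < k ^+ m * rho y.
  have [m [m1 Km]] := Kirr x y; exists m => //.
  rewrite -pairing_indicator1 -(pairing_iter_kop krho) /pairing (bigD1 x)//=.
  rewrite ltr_wpDr ?mulr_gt0// sumr_ge0// => z _.
  by rewrite mulr_ge0// iter_kop_ge0// => t; rewrite /indicator ler0n.
split.
  have [m m1] := pos x; rewrite [0 < k]lt_neqAle k0 andbT; case: eqP => // <-.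
  by rewrite expr0n -[m]prednK//= mul0r ltxx.
move=> y; have [m _] := pos y.
by rewrite [0 < rho y]lt_neqAle rho0 andbT; case: eqP => // <-; rewrite mulr0 ltxx.
Qed.

End KernelOperator.

Section PerronFrobenius.
Variables (R : realType) (T : finType) (K : T -> T -> R).

Definition kernel_mx : 'M[R]_#|T| := \matrix_(i, j) K (enum_val i) (enum_val j).

Lemma sum_enum_val (V : nmodType) (F : T -> V) :
  \sum_(i < #|T|) F (enum_val i) = \sum_x F x.
Proof.
rewrite [RHS](reindex (@enum_val T T)) //=; exists enum_rank => x _.
- exact: enum_valK.
- exact: enum_rankK.
Qed.

Lemma pairing_kop (k : R) (rho : T -> R) :
  (forall y, \sum_x rho x * K x y = k * rho y) ->
  forall f, pairing rho (kop K f) = k * pairing rho f.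
Proof.
move=> H f; rewrite /pairing /kop mulr_sumr.
under eq_bigr do rewrite mulr_sumr.
rewrite exchange_big; apply: eq_bigr => y _ /=.
by rewrite mulrA -H mulr_suml; apply: eq_bigr => x _; rewrite mulrA.
Qed.

(** The kernel minus k is singular, and so is its transpose. *)
Lemma exists_right_eigenfunction (k : R) (rho : T -> R) :
  (forall y, \sum_x rho x * K x y = k * rho y) -> (exists x, rho x != 0) ->
  exists2 w : T -> R, exists x, w x != 0 & kop K w = (fun x => k * w x).
Proof.
move=> Hk [x0 rx0]; set A := kernel_mx - k%:M.
have /eqP : \det A == 0.
  apply/det0P; exists (\row_i rho (enum_val i)).
    apply/eqP => /rowP/(_ (enum_rank x0)); rewrite !mxE enum_rankK.
    exact/eqP.
  apply/rowP => j; rewrite mulmxBr mul_mx_scalar !mxE.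
  under eq_bigr do rewrite !mxE.
  by rewrite (sum_enum_val (fun x => rho x * K x (enum_val j))) Hk subrr.
rewrite -det_tr => /eqP/det0P[u u0 uA].
exists (fun x => u 0 (enum_rank x)).
  by have /rV0Pn[j uj] := u0; exists (enum_val j); rewrite enum_valK.
apply/funext => x; apply/eqP; rewrite -subr_eq0; apply/eqP.
move/rowP: uA => /(_ (enum_rank x)); rewrite !mxE => <-.
transitivity (\sum_j u 0 j * (K x (enum_val j) - k *+ (x == enum_val j))).
  under [RHS]eq_bigr do rewrite mulrBr.
  rewrite sumrB; congr (_ - _).
    rewrite /kop -(sum_enum_val (fun y => K x y * u 0 (enum_rank y))).
    by apply: eq_bigr => j _; rewrite enum_valK mulrC.
  rewrite (bigD1 (enum_rank x))//= enum_rankK eqxx mulr1n big1 ?addr0 1?mulrC//.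
  move=> j jx; case: eqP => [xj|_]; last by rewrite mulr0n mulr0.
  by move: jx; rewrite xj enum_valK eqxx.
apply: eq_bigr => j _; rewrite !mxE enum_rankK; congr (_ * (_ - _ *+ _)).
by congr nat_of_bool; apply/eqP/eqP => [->|<-]; rewrite ?enum_valK ?enum_rankK.
Qed.

Hypothesis K0 : forall x y, 0 <= K x y.

(** The modulus of any real eigenfunction w works: the triangle inequality
    gives k |w| <= K |w|, and both sides have the same integral against the
    positive left eigenvector. *)
Lemma exists_nonneg_eigenfunction (k : R) (rho : T -> R) : 0 <= k ->
  (forall y, \sum_x rho x * K x y = k * rho y) -> (forall x, 0 < rho x) ->
  (exists x, rho x != 0) ->
  exists h : T -> R, [/\ kop K h = (fun x => k * h x), forall x, 0 <= h x &
                         exists x, h x != 0].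
Proof.
move=> k0 Hk rho0 ex; have [w [x wx] Kw] := exists_right_eigenfunction Hk ex.
exists (fun x => `|w x|); split => //; last by exists x; rewrite normr_eq0.
have le y : 0 <= kop K (fun x => `|w x|) y - k * `|w y|.
  rewrite subr_ge0 -{1}(ger0_norm k0) -normrM.
  have -> : k * w y = kop K w y by rewrite Kw.
  rewrite /kop; apply: le_trans (ler_norm_sum _ _ _) _.
  by apply: ler_sum => z _; rewrite normrM (ger0_norm (K0 _ _)).
have sum0 : \sum_y rho y * (kop K (fun x => `|w x|) y - k * `|w y|) = 0.
  under eq_bigr do rewrite mulrBr.
  rewrite sumrB; apply/eqP; rewrite subr_eq0; apply/eqP.
  rewrite -[LHS]/(pairing _ _) (pairing_kop Hk) /pairing mulr_sumr.
  by apply: eq_bigr => y _; rewrite mulrCA.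
apply/funext => y; apply/eqP; rewrite -subr_eq0.
have /psumr_eq0P := sum0 => /(_ (fun y _ => mulr_ge0 (ltW (rho0 y)) (le y))).
by move=> /(_ y isT)/eqP; rewrite mulf_eq0 gt_eqF//=.
Qed.

Lemma normc_sum (I : Type) (s : seq I) (F : I -> R[i]) :
  Normc.normc (\sum_(i <- s) F i) <= \sum_(i <- s) Normc.normc (F i).
Proof.
elim: s => [|i s IH]; first by rewrite !big_nil Normc.normc0.
by rewrite !big_cons; apply: le_trans (le_normcD _ _) _; rewrite lerD2l.
Qed.

Lemma normc_real (a : R) : 0 <= a -> Normc.normc (real_complex R a) = a.
Proof. by move=> a0; rewrite /= expr0n addr0 sqrtr_sqr ger0_norm. Qed.

Lemma normc_ge0 (z : R[i]) : 0 <= Normc.normc z.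
Proof. by case: z => a b; exact: sqrtr_ge0. Qed.

(** A complex left eigenvector v for z satisfies |z| |v| <= |v| K; pairing
    with h bounds |z| by k, and k itself is an eigenvalue. *)
Lemma spectral_radius_eigen (k : R) (rho h : T -> R) : 0 <= k ->
  (forall y, \sum_x rho x * K x y = k * rho y) -> (exists x, rho x != 0) ->
  kop K h = (fun x => k * h x) -> (forall x, 0 < h x) ->
  spectral_radius kernel_mx = k.
Proof.
move=> k0 Hk [x0 rx0] Kh h0; rewrite /spectral_radius.
set S := [set _ | _ in _].
have ub : ubound S k.
  move=> _ [z /eigenvalueP[v vA v0] <-].
  have vz (j : 'I_#|T|) : Normc.normc z * Normc.normc (v 0 j) <=
      \sum_i Normc.normc (v 0 i) * K (enum_val i) (enum_val j).
    rewrite -Normc.normcM.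
    have -> : z * v 0 j = \sum_i v 0 i * real_complex R (K (enum_val i) (enum_val j)).
      by move/rowP : vA => /(_ j); rewrite !mxE => <-; apply: eq_bigr => i _; rewrite !mxE.
    apply: le_trans (normc_sum _ _) _; apply: ler_sum => i _.
    by rewrite Normc.normcM normc_real.
  (* N is the pairing of |v| with h. *)
  pose N := \sum_j Normc.normc (v 0 j) * h (enum_val j).
  have N0 : 0 < N.
    have /rV0Pn[j vj] := v0.
    rewrite /N (bigD1 j)//=; apply: ltr_wpDr.
      by apply: sumr_ge0 => i _; rewrite mulr_ge0 ?normc_ge0// ltW.
    rewrite mulr_gt0// lt_neqAle normc_ge0 andbT eq_sym.
    by apply/negP => /eqP/Normc.eq0_normc/eqP; rewrite (negbTE vj).
  rewrite -(ler_pM2r N0) {1}/N mulr_sumr.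
  apply: le_trans (_ : \sum_j (\sum_i Normc.normc (v 0 i) * K (enum_val i) (enum_val j)) * h (enum_val j) <= _).
    by apply: ler_sum => j _; rewrite mulrA ler_wpM2r// ltW.
  under eq_bigr do rewrite mulr_suml.
  rewrite exchange_big /N mulr_sumr /=; apply: ler_sum => i _.
  have := congr1 (fun f => f (enum_val i)) Kh.
  rewrite /kop -(sum_enum_val (fun y => K (enum_val i) y * h y)) mulrCA => <-.
  by rewrite mulr_sumr; apply: ler_sum => j _; rewrite mulrA.
have Sk : S k.
  exists (real_complex R k); last exact: normc_real.
  apply/eigenvalueP; exists (\row_i real_complex R (rho (enum_val i))).
    apply/rowP => j; rewrite !mxE -rmorphM -Hk.
    rewrite -(sum_enum_val (fun x => rho x * K x (enum_val j))) rmorph_sum /=.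
    by apply: eq_bigr => i _; rewrite !mxE -rmorphM.
  apply/eqP => /rowP/(_ (enum_rank x0)); rewrite !mxE enum_rankK => /eqP.
  by rewrite fmorph_eq0; apply/negP.
apply/eqP; rewrite eq_le; apply/andP; split; first by apply: ge_sup => //; exists k.
by apply: ub_le_sup => //; exists k.
Qed.

End PerronFrobenius.

(** * A Poincare inequality *)

Section Poincare.
Variables (R : realType) (T : finType) (K : T -> T -> R) (rho h : T -> R).
Hypothesis K0 : forall x y, 0 <= K x y.
Hypothesis Kirr : irreducible_kernel K.
Hypothesis rho0 : forall x, 0 < rho x.
Hypothesis h0 : forall x, 0 < h x.

(** Up to the eigenvalue, the energy of the Doob transform of K by h, whose
    invariant measure is rho h. *)
Definition dirichlet (u : T -> R) : R :=
  \sum_x \sum_y rho x * K x y * h y * (u x - u y) ^+ 2.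

Lemma dirichlet_term_ge0 u x y : 0 <= rho x * K x y * h y * (u x - u y) ^+ 2.
Proof. by apply: mulr_ge0; rewrite ?sqr_ge0// !mulr_ge0// ltW. Qed.

Lemma dirichlet_ge0 u : 0 <= dirichlet u.
Proof.
apply: sumr_ge0 => x _; apply: sumr_ge0 => y _.
exact: dirichlet_term_ge0.
Qed.

Lemma dirichlet_edge u x y : rho x * K x y * h y * (u x - u y) ^+ 2 <= dirichlet u.
Proof.
rewrite /dirichlet (bigD1 x)//= (bigD1 y)//= -addrA lerDl addr_ge0//.
  by apply: sumr_ge0 => z _; exact: dirichlet_term_ge0.
apply: sumr_ge0 => z _; apply: sumr_ge0 => t _.
exact: dirichlet_term_ge0.
Qed.

(** A relation that holds along the edges of K and is transitive; by
    irreducibility it then holds for all pairs. *)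
Definition dominated (x y : T) :=
  exists2 C : R, 0 <= C & forall u : T -> R, (u x - u y) ^+ 2 <= C * dirichlet u.

Lemma dominated_refl x : dominated x x.
Proof. by exists 0 => // u; rewrite subrr expr0n mul0r. Qed.

Lemma dominated_trans y x z : dominated x y -> dominated y z -> dominated x z.
Proof.
move=> [C C0 HC] [D D0 HD]; exists (2 * C + 2 * D).
  by rewrite addr_ge0// mulr_ge0.
move=> u; have := HC u; have := HD u; have := sqr_ge0 ((u x - u y) - (u y - u z)).
nra.
Qed.

Lemma dominated_edge x y : 0 < K x y -> dominated x y.
Proof.
move=> Kxy; have c0 : 0 < rho x * K x y * h y by rewrite !mulr_gt0.
exists (rho x * K x y * h y)^-1; first by rewrite invr_ge0 ltW.
move=> u; rewrite ler_pdivlMl//.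
exact: dirichlet_edge.
Qed.

(** A positive entry of the m-th power of K produces a path of length m. *)
Lemma dominated_path m x y :
  0 < iter m (kop K) (indicator R [set y]) x -> dominated x y.
Proof.
elim: m x => [|m IH] x /=.
  by rewrite /indicator inE; case: eqP => [->|]; rewrite ?ltxx// => _; apply: dominated_refl.
rewrite {1}/kop => H.
have [z Kz iz] : exists2 z, 0 < K x z & 0 < iter m (kop K) (indicator R [set y]) z.
  apply: contrapT => N; move: H; rewrite big1 ?ltxx// => z _.
  have i0 : 0 <= iter m (kop K) (indicator R [set y]) z.
    by apply: iter_kop_ge0 => // t; rewrite ler0n.
  have := K0 x z; rewrite le_eqVlt => /orP[/eqP<-|Kz]; first by rewrite mul0r.
  move: i0; rewrite le_eqVlt => /orP[/eqP<-|iz]; first by rewrite mulr0.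
  by exfalso; apply: N; exists z.
exact: dominated_trans (dominated_edge Kz) (IH _ iz).
Qed.

(** The variance under rho h is half of the double sum of (u x - u y)^2,
    and each of these squares is dominated by the energy. *)
Lemma poincare : \sum_x rho x * h x = 1 ->
  exists2 c : R, 0 < c & forall u : T -> R,
    c * (\sum_x rho x * h x * u x ^+ 2 - (\sum_x rho x * h x * u x) ^+ 2)
      <= dirichlet u.
Proof.
move=> m1.
have dom x y : {C : R | 0 <= C & forall u : T -> R, (u x - u y) ^+ 2 <= C * dirichlet u}.
  apply/cid2; have [m [_ H]] := Kirr x y; exact: dominated_path H.
pose C := \sum_x \sum_y s2val (dom x y).
have C0 : 0 <= C.
  by apply: sumr_ge0 => x _; apply: sumr_ge0 => y _; case: (dom x y).
have Cxy u x y : (u x - u y) ^+ 2 <= C * dirichlet u.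
  apply: le_trans (s2valP' (dom x y) u) _; apply: ler_wpM2r; first exact: dirichlet_ge0.
  rewrite /C (bigD1 x)//= (bigD1 y)//= -addrA lerDl addr_ge0//.
    by apply: sumr_ge0 => z _; case: (dom _ _).
  by apply: sumr_ge0 => z _; apply: sumr_ge0 => t _; case: (dom _ _).
exists (1 + C)^-1; first by rewrite invr_gt0 ltr_pwDl.
move=> u; rewrite ler_pdivrMl ?ltr_pwDl//.
set m := fun x => rho x * h x.
have mge x : 0 <= m x by rewrite mulr_ge0// ltW.
have E : \sum_x m x * u x ^+ 2 - (\sum_x m x * u x) ^+ 2 =
   2^-1 * \sum_x \sum_y m x * m y * (u x - u y) ^+ 2.
  have S1 : \sum_x \sum_y m x * m y * (u x - u y) ^+ 2 =
    \sum_x \sum_y m x * m y * u x ^+ 2 + \sum_x \sum_y m x * m y * u y ^+ 2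
      - 2 * \sum_x \sum_y (m x * u x) * (m y * u y).
    rewrite mulr_sumr -big_split -sumrB; apply: eq_bigr => x _ /=.
    rewrite mulr_sumr -big_split -sumrB; apply: eq_bigr => y _ /=.
    by ring.
  rewrite S1.
  have -> : \sum_x \sum_y m x * m y * u x ^+ 2 = \sum_x m x * u x ^+ 2.
    apply: eq_bigr => x _; transitivity (\sum_y (m x * u x ^+ 2) * m y).
      by apply: eq_bigr => y _; ring.
    by rewrite -mulr_sumr m1 mulr1.
  have -> : \sum_x \sum_y m x * m y * u y ^+ 2 = \sum_x m x * u x ^+ 2.
    rewrite exchange_big; apply: eq_bigr => x _ /=.
    transitivity (\sum_y (m x * u x ^+ 2) * m y).
      by apply: eq_bigr => y _; ring.
    by rewrite -mulr_sumr m1 mulr1.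
  have -> : \sum_x \sum_y (m x * u x) * (m y * u y) = (\sum_x m x * u x) ^+ 2.
    rewrite expr2 mulr_suml; apply: eq_bigr => x _.
    by rewrite mulr_sumr.
  by field.
rewrite -/(m _) E.
have : \sum_x \sum_y m x * m y * (u x - u y) ^+ 2 <= C * dirichlet u.
  have -> : C * dirichlet u = \sum_x \sum_y m x * m y * (C * dirichlet u).
    transitivity (\sum_x m x * (C * dirichlet u)).
      by rewrite -mulr_suml m1 mul1r.
    apply: eq_bigr => x _; transitivity (\sum_y (m x * (C * dirichlet u)) * m y).
      by rewrite -mulr_sumr m1 mulr1.
    by apply: eq_bigr => y _; ring.
  apply: ler_sum => x _; apply: ler_sum => y _.
  by apply: ler_wpM2l; [exact: mulr_ge0|exact: Cxy].
have := dirichlet_ge0 u; nra.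
Qed.

(** Expanding the square, both diagonal parts reduce to k times the second
    moment of u under rho h, by the two eigenvector equations. *)
Lemma dirichletE (k : R) : (forall y, \sum_x rho x * K x y = k * rho y) ->
  kop K h = (fun x => k * h x) -> forall u : T -> R,
  dirichlet u = - 2 * \sum_x rho x * u x *
     (kop K (fun y => h y * u y) x - k * (h x * u x)).
Proof.
move=> Hk Kh u.
have -> : dirichlet u = \sum_x \sum_y rho x * K x y * h y * u x ^+ 2
   + \sum_x \sum_y rho x * K x y * h y * u y ^+ 2
   - 2 * \sum_x \sum_y rho x * u x * (K x y * (h y * u y)).
  rewrite mulr_sumr -big_split -sumrB; apply: eq_bigr => x _ /=.
  rewrite mulr_sumr -big_split -sumrB; apply: eq_bigr => y _ /=.
  by ring.
have -> : \sum_x \sum_y rho x * K x y * h y * u x ^+ 2 = k * \sum_x rho x * h x * u x ^+ 2.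
  rewrite mulr_sumr; apply: eq_bigr => x _.
  transitivity (rho x * u x ^+ 2 * kop K h x); last by rewrite Kh; ring.
  by rewrite /kop mulr_sumr; apply: eq_bigr => y _; ring.
have -> : \sum_x \sum_y rho x * K x y * h y * u y ^+ 2 = k * \sum_x rho x * h x * u x ^+ 2.
  rewrite exchange_big mulr_sumr; apply: eq_bigr => y _ /=.
  transitivity (h y * u y ^+ 2 * \sum_x rho x * K x y); last by rewrite Hk; ring.
  by rewrite mulr_sumr; apply: eq_bigr => x _; ring.
have -> : \sum_x rho x * u x * (kop K (fun y => h y * u y) x - k * (h x * u x)) =
   \sum_x \sum_y rho x * u x * (K x y * (h y * u y)) - k * \sum_x rho x * h x * u x ^+ 2.
  rewrite mulr_sumr -sumrB; apply: eq_bigr => x _.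
  by rewrite mulrBr /kop mulr_sumr; congr (_ - _); ring.
by ring.
Qed.

End Poincare.

(** * Exponentials of operators and derivatives in time *)

Section OperatorExponential.
Variables (R : realType) (X : Type) (A : (X -> R) -> X -> R) (S : set X) (C : R).
Hypothesis C0 : 0 <= C.
Hypothesis A_bounded : forall (f : X -> R) (N : R), (forall x, S x -> `|f x| <= N) ->
  forall x, S x -> `|A f x| <= C * N.

(** S is a set on which A is a bounded operator while functions live on the
    whole of X: the Fleming-Viot generator acts on functions of arbitrary
    measures, but is only bounded on the configurations. *)
Definition bounded_on (f : X -> R) := exists N : R, forall x, S x -> `|f x| <= N.

Lemma bounded_on_op f : bounded_on f -> bounded_on (A f).
Proof. by move=> [N fN]; exists (C * N); exact: A_bounded. Qed.

Lemma iter_op_bound (f : X -> R) (N : R) : (forall x, S x -> `|f x| <= N) ->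
  forall k x, S x -> `|iter k A f x| <= N * C ^+ k.
Proof.
move=> fN; elim=> [|k IH] x Sx /=; first by rewrite expr0 mulr1; exact: fN.
by rewrite exprS mulrCA; exact: A_bounded.
Qed.

Lemma op_exp_cvg f x t : bounded_on f -> S x ->
  cvgn (series (fun k : nat => t ^+ k / (k`!)%:R * iter k A f x)).
Proof.
move=> [N fN] Sx; apply: normed_cvg.
apply: (@series_le_cvg _ _ (fun k => N * exp_coeff (`|t| * C) k)).
- by move=> k; rewrite normr_ge0.
- move=> k; rewrite mulr_ge0//; first by apply: le_trans (fN _ Sx).
  by rewrite /exp_coeff /= mulr_ge0// ?invr_ge0 ?exprn_ge0// mulr_ge0.
- move=> k /=; rewrite !normrM normfV normrX (ger0_norm (ler0n _ _)).
  apply: le_trans (_ : `|t| ^+ k / k`!%:R * (N * C ^+ k) <= _).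
    by apply: ler_wpM2l; [rewrite mulr_ge0 ?invr_ge0 ?exprn_ge0|exact: iter_op_bound].
  rewrite /exp_coeff /= exprMn [leLHS](_ : _ = N * (`|t| ^+ k * C ^+ k / k`!%:R))//.
  by ring.
- rewrite (_ : (fun k => _) = (N \*o exp_coeff (`|t| * C))) //.
  exact/is_cvg_seriesZ/is_cvg_series_exp_coeff.
Qed.

Lemma op_exp0 f x : op_exp A 0 f x = f x.
Proof.
rewrite /op_exp; apply/cvg_lim => //; apply: cvg_near_cst; near=> n.
have n0 : (0 < n)%N by near: n; exists 1%N.
rewrite /series /= -[n]prednK// big_nat_recl//= expr0 fact0 divr1 mul1r.
by rewrite big1 ?addr0// => i _; rewrite expr0n mul0r mul0r.
Unshelve. all: by end_near. Qed.

(** For a fixed x the exponential series is a power series in t, and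
    differentiating it term by term replaces f by A f. *)
Lemma is_derive_op_exp f x (t : R) : bounded_on f -> S x ->
  is_derive t (1 : R) (fun s => op_exp A s f x) (op_exp A t (A f) x).
Proof.
move=> fb Sx; pose c (g : X -> R) k := iter k A g x / k`!%:R.
have cE g : (fun s => op_exp A s g x) = (fun s => limn (pseries (c g) s)).
  apply/funext => s; rewrite /op_exp /pseries /c; congr (limn (series _)).
  by apply/funext => k /=; ring.
have cd g : pseries_diffs (c g) = c (A g).
  apply/funext => k; rewrite /pseries_diffs /c -iterSr factS natrM invfM mulrCA.
  by rewrite mulVKf ?pnatr_eq0.
have cc g s : bounded_on g -> cvgn (pseries (c g) s).
  move=> gb; have := @op_exp_cvg g x s gb Sx; rewrite /pseries /c.
  by congr (cvgn (series _)); apply/funext => k /=; ring.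
rewrite cE; have -> : op_exp A t (A f) x = limn (pseries (pseries_diffs (c f)) t).
  by rewrite cd -[LHS]/((fun s => op_exp A s (A f) x) t) cE.
apply: (@pseries_snd_diffs _ _ (`|t| + 1)).
- exact: cc.
- by rewrite cd; apply: cc; exact: bounded_on_op.
- by rewrite cd cd; apply: cc; do 2 apply: bounded_on_op.
- by rewrite [ltRHS]ger0_norm ?addr_ge0// ltrDl.
Qed.

End OperatorExponential.

Section RealDerivatives.
Variable R : realType.
Implicit Types (f g : R -> R) (x a b : R).

Definition has_derivative f x a := is_derive (x : R) (1 : R) f a.

Lemma has_derivative_eq f x a b : has_derivative f x a -> a = b -> has_derivative f x b.
Proof. by move=> ? <-. Qed.

Lemma has_derivative_cst a x : has_derivative (fun=> a) x 0.
Proof. exact: is_derive_cst. Qed.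

Lemma has_derivative_id x : has_derivative id x 1.
Proof. exact: is_derive_id. Qed.

Lemma has_derivativeD f g x a b : has_derivative f x a -> has_derivative g x b ->
  has_derivative (fun t => f t + g t) x (a + b).
Proof. exact: is_deriveD. Qed.

Lemma has_derivativeM f g x a b : has_derivative f x a -> has_derivative g x b ->
  has_derivative (fun t => f t * g t) x (a * g x + f x * b).
Proof.
move=> fa gb; apply: has_derivative_eq (is_deriveM fa gb) _.
by rewrite /GRing.scale /= addrC mulrC.
Qed.

Lemma has_derivativeZ c f x a : has_derivative f x a ->
  has_derivative (fun t => c * f t) x (c * a).
Proof.
move=> fa; apply: has_derivative_eq (has_derivativeM (has_derivative_cst c x) fa) _.
by rewrite mul0r add0r.
Qed.

Lemma has_derivativeN f x a : has_derivative f x a ->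
  has_derivative (fun t => - f t) x (- a).
Proof. exact: is_deriveN. Qed.

Lemma has_derivative_comp f g x a b : has_derivative f (g x) a ->
  has_derivative g x b -> has_derivative (fun t => f (g t)) x (a * b).
Proof. exact: is_derive1_comp. Qed.

Lemma has_derivative_sum (I : Type) (s : seq I) (F : I -> R -> R) (dF : I -> R) x :
  (forall i, has_derivative (F i) x (dF i)) ->
  has_derivative (fun t => \sum_(i <- s) F i t) x (\sum_(i <- s) dF i).
Proof.
move=> FdF; elim: s => [|i s IH].
  rewrite big_nil; have -> : (fun t => \sum_(i <- [::]) F i t) = fun=> 0.
    by apply/funext => t; rewrite big_nil.
  exact: has_derivative_cst.
rewrite big_cons; have -> : (fun t => \sum_(j <- i :: s) F j t) =
   fun t => F i t + \sum_(j <- s) F j t by apply/funext => t; rewrite big_cons.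
exact: has_derivativeD.
Qed.

Lemma has_derivative_continuous f x a : has_derivative f x a -> {for x, continuous f}.
Proof.
move=> fa; apply: differentiable_continuous; apply/derivable1_diffP.
by case: fa.
Qed.

Lemma has_derivative_mvt f df : (forall x, has_derivative f x (df x)) ->
  forall t, 0 <= t -> exists2 c, 0 <= c <= t & f t - f 0 = df c * t.
Proof.
move=> fdf t; rewrite le_eqVlt => /orP[/eqP<-|t0].
  by exists 0; rewrite ?lexx// subrr mulr0.
have [||c] := @MVT R f df 0 t t0.
- by move=> x _; exact: fdf.
- by apply: continuous_subspaceT => x; exact: has_derivative_continuous (fdf x).
rewrite in_itv /= => /andP[c0 ct] E; exists c; first by rewrite !ltW.
by rewrite E subr0.
Qed.

Lemma has_derivative0_constant f : (forall x, has_derivative f x 0) -> forall t, f t = f 0.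
Proof.
have pos g : (forall x, has_derivative g x 0) -> forall t, 0 <= t -> g t = g 0.
  move=> g' t t0; have [c _] := has_derivative_mvt g' t0.
  by rewrite mul0r => /eqP; rewrite subr_eq0 => /eqP.
move=> f' t; have [/(pos _ f')//|t0] := leP 0 t.
rewrite -[t]opprK (pos (fun s => f (- s))) ?oppr0// ?oppr_ge0 ?ltW// => x.
rewrite -(mul0r (- 1)); apply: has_derivative_comp; first exact: f'.
exact: has_derivativeN (has_derivative_id x).
Qed.

(** The product of f with exp (c t) is nonincreasing. *)
Lemma gronwall_decay f df c : (forall x, has_derivative f x (df x)) ->
  (forall x, 0 <= x -> df x <= - c * f x) -> forall t, 0 <= t -> f t <= expR (- c * t) * f 0.
Proof.
move=> fdf H t t0; pose g s := expR (c * s) * f s.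
have gd s : has_derivative g s (expR (c * s) * (c * 1) * f s + expR (c * s) * df s).
  apply: has_derivativeM => //; apply: has_derivative_comp; last first.
    exact: has_derivativeZ (has_derivative_id s).
  exact: is_derive_expR.
have [s /andP[s0 _] E] := has_derivative_mvt gd t0.
have : g t <= g 0.
  rewrite -subr_le0 E mulr_le0_ge0// mulr1.
  have -> : expR (c * s) * c * f s + expR (c * s) * df s =
            expR (c * s) * (c * f s + df s) by ring.
  rewrite mulr_ge0_le0 ?expR_ge0//; have := H s s0; lra.
rewrite /g mulr0 expR0 mul1r => le.
by rewrite mulNr expRN ler_pdivlMl ?expR_gt0.
Qed.

End RealDerivatives.

Section MatrixFlow.
Variables (R : realType) (T : finType) (B : T -> T -> R).

Let C : R := \sum_x \sum_y `|B x y|.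

Lemma kop_bounded (f : T -> R) (N : R) : (forall x, [set: T] x -> `|f x| <= N) ->
  forall x, [set: T] x -> `|kop B f x| <= C * N.
Proof.
move=> fN x _; apply: le_trans (ler_norm_sum _ _ _) _.
have N0 : 0 <= N by apply: le_trans (fN x I).
rewrite [C](bigD1 x)//= mulrDl; apply: ler_wpDr.
  by rewrite mulr_ge0// sumr_ge0// => y _; apply: sumr_ge0.
rewrite mulr_suml; apply: ler_sum => y _; rewrite normrM.
by apply: ler_wpM2l => //; apply: fN.
Qed.

Let C0 : 0 <= C.
Proof. by apply: sumr_ge0 => x _; apply: sumr_ge0. Qed.

Lemma fin_bounded_on (f : T -> R) : bounded_on [set: T] f.
Proof.
exists (\sum_x `|f x|) => x _; rewrite (bigD1 x)//= lerDl.
exact: sumr_ge0.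
Qed.

Lemma kop_exp_cvg (f : T -> R) x t :
  cvgn (series (fun k : nat => t ^+ k / (k`!)%:R * iter k (kop B) f x)).
Proof. exact: (op_exp_cvg C0 kop_bounded (fin_bounded_on f) I). Qed.

Lemma kopD (f g : T -> R) : kop B (fun x => f x + g x) = fun x => kop B f x + kop B g x.
Proof.
by apply/funext => x; rewrite /kop -big_split; apply: eq_bigr => y _; rewrite mulrDr.
Qed.

Lemma kop_exp_comm t (f : T -> R) : op_exp (kop B) t (kop B f) = kop B (op_exp (kop B) t f).
Proof.
apply/funext => x; rewrite {1}/op_exp; apply/cvg_lim => //.
rewrite [X in X @ _ --> _](_ : _ = fun n => \sum_y B x y * series
    (fun k : nat => t ^+ k / (k`!)%:R * iter k (kop B) f y) n).
  apply: cvg_big => [|y _]; first exact: add_continuous.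
  by apply: cvgMr; exact: kop_exp_cvg.
apply/funext => n; rewrite /series /=.
under [RHS]eq_bigr do rewrite mulr_sumr.
rewrite exchange_big; apply: eq_bigr => k _ /=.
rewrite -iterSr /= {1}/kop mulr_sumr; apply: eq_bigr => y _; ring.
Qed.

Lemma has_derivative_kop_exp (f : T -> R) x (t : R) :
  has_derivative (fun s => op_exp (kop B) s f x) t (kop B (op_exp (kop B) t f) x).
Proof. by rewrite -kop_exp_comm; exact: (is_derive_op_exp C0 kop_bounded _ (fin_bounded_on f)). Qed.

End MatrixFlow.

(** * The renormalized killed semigroup *)

Section RenormalizedFlow.
Variables (R : realType) (T : finType) (K : T -> T -> R) (lambda : R).

Definition killed_generator (x y : T) : R := K x y - (x == y)%:R.

Lemma kop_killed_generator f : kop killed_generator f = fun x => kop K f x - f x.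
Proof.
apply/funext => x; rewrite /kop /killed_generator.
under eq_bigr do rewrite mulrBl.
rewrite sumrB; congr (_ - _); rewrite (bigD1 x)//= eqxx mul1r big1 ?addr0// => y yx.
by rewrite eq_sym (negbTE yx) mul0r.
Qed.

(** The factor exp (lambda t) compensates the killing: the integral against
    rho is constant along the flow. *)
Definition flow (t : R) (f : T -> R) (x : T) : R :=
  expR (lambda * t) * op_exp (kop killed_generator) t f x.

(** The generator of [flow]. *)
Definition shifted_op (f : T -> R) (x : T) : R := kop K f x - (1 - lambda) * f x.

Lemma flow0 f x : flow 0 f x = f x.
Proof. by rewrite /flow mulr0 expR0 mul1r op_exp0. Qed.

Lemma has_derivative_flow f x t :
  has_derivative (fun s => flow s f x) t (shifted_op (flow t f) x).
Proof.
have d1 : has_derivative (fun s => expR (lambda * s)) t (expR (lambda * t) * (lambda * 1)).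
  apply: has_derivative_comp; last exact: has_derivativeZ (has_derivative_id t).
  exact: is_derive_expR.
apply: has_derivative_eq (has_derivativeM d1 (has_derivative_kop_exp _ f x t)) _.
rewrite kop_killed_generator /shifted_op /flow kopZ; ring.
Qed.

Lemma shifted_op_linear a f g : shifted_op (fun x => a * f x + g x) =
  fun x => a * shifted_op f x + shifted_op g x.
Proof. by apply/funext => x; rewrite /shifted_op kopD kopZ; ring. Qed.

Variables (rho h : T -> R).
Hypothesis K0 : forall x y, 0 <= K x y.
Hypothesis Kirr : irreducible_kernel K.
Hypothesis rho0 : forall x, 0 < rho x.
Hypothesis h0 : forall x, 0 < h x.
Hypothesis rho_h : \sum_x rho x * h x = 1.
Hypothesis Krho : forall y, \sum_x rho x * K x y = (1 - lambda) * rho y.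
Hypothesis Kh : kop K h = (fun x => (1 - lambda) * h x).

Lemma pairing_shifted_op f : pairing rho (shifted_op f) = 0.
Proof.
apply/eqP; rewrite /pairing /shifted_op; under eq_bigr do rewrite mulrBr.
rewrite sumrB subr_eq0; apply/eqP; rewrite -[LHS]/(pairing _ _) (pairing_kop Krho).
by rewrite mulr_sumr; apply: eq_bigr => x _; rewrite mulrCA.
Qed.

Lemma pairing_flow t f : pairing rho (flow t f) = pairing rho f.
Proof.
have d s : has_derivative (fun s => pairing rho (flow s f)) s 0.
  have := has_derivative_sum (index_enum T) (fun x => has_derivativeZ (rho x) (has_derivative_flow f x s)).
  by rewrite -[X in has_derivative _ _ X]/(pairing rho (shifted_op (flow s f))) pairing_shifted_op.
rewrite (has_derivative0_constant d).
by congr pairing; apply/funext => x; rewrite flow0.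
Qed.

(** The identity of [dirichletE] read as a spectral gap. *)
Lemma shifted_op_coercive : exists2 c : R, 0 < c & forall u : T -> R,
  c * (\sum_x rho x * h x * u x ^+ 2 - (\sum_x rho x * h x * u x) ^+ 2)
  <= - \sum_x rho x * u x * shifted_op (fun y => h y * u y) x.
Proof.
have [c c0 H] := poincare K0 Kirr rho0 h0 rho_h; exists (c / 2); first by rewrite divr_gt0.
move=> u; have := H u; rewrite (dirichletE Krho Kh) -/(shifted_op _).
rewrite -[X in _ <= - 2 * X -> _]/(\sum_x rho x * u x * shifted_op (fun y => h y * u y) x).
move: (\sum_x rho x * u x * _) (_ - _) => a b; lra.
Qed.

(** By the spectral gap applied to u = f_t / h, the weighted norm N of f_t
    satisfies a Gronwall inequality. *)
Lemma flow_decay : exists2 c : R, 0 < c & forall f, pairing rho f = 0 ->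
  exists2 M : R, 0 <= M & forall t x, 0 <= t -> flow t f x ^+ 2 <= M * expR (- c * t).
Proof.
have [c c0 coer] := shifted_op_coercive; exists (2 * c); first by rewrite mulr_gt0.
move=> f f0; pose N t := \sum_x rho x / h x * flow t f x ^+ 2.
pose Nd t := \sum_x rho x / h x * (2 * flow t f x * shifted_op (flow t f) x).
have w0 x : 0 < rho x / h x by rewrite divr_gt0.
have dN t : has_derivative N t (Nd t).
  apply: has_derivative_sum => x; apply: has_derivativeZ.
  apply: has_derivative_eq (has_derivativeM (has_derivative_flow f x t) (has_derivative_flow f x t)) _.
  by ring.
have dec t : 0 <= t -> Nd t <= - (2 * c) * N t.
  move=> t0; pose u x := flow t f x / h x.
  have uE : (fun y => h y * u y) = flow t f.
    by apply/funext => y; rewrite /u mulrC divfK ?gt_eqF.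
  have := coer u; rewrite uE.
  have -> : \sum_x rho x * h x * u x = 0.
    rewrite -[RHS]f0 -(pairing_flow t f); apply: eq_bigr => x _.
    by rewrite -mulrA -[h x * u x]/((fun y => h y * u y) x) uE.
  have -> : \sum_x rho x * h x * u x ^+ 2 = N t.
    apply: eq_bigr => x _; rewrite /u; field; exact: lt0r_neq0.
  have -> : Nd t = 2 * \sum_x rho x * u x * shifted_op (flow t f) x.
    rewrite mulr_sumr; apply: eq_bigr => x _; rewrite /u; ring.
  by rewrite expr0n subr0; move: (\sum_x _) (N t) => a b; lra.
have {}dec := gronwall_decay dN dec.
have N0 s : 0 <= N s.
  by apply: sumr_ge0 => y _; rewrite mulr_ge0 ?sqr_ge0// ltW.
exists (N 0 * \sum_x (rho x / h x)^-1).
  by rewrite mulr_ge0// sumr_ge0// => y _; rewrite invr_ge0 ltW.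
move=> t x t0; rewrite mulrAC; apply: le_trans (_ : N t * (rho x / h x)^-1 <= _).
  rewrite ler_pdivlMr// /N (bigD1 x)//= mulrC lerDl; apply: sumr_ge0 => y _.
  by rewrite mulr_ge0 ?sqr_ge0// ltW.
rewrite [N 0 * _]mulrC; apply: ler_pM => //.
- by rewrite invr_ge0 ltW.
- exact: dec.
- rewrite (bigD1 x)//= lerDl sumr_ge0// => y _; by rewrite invr_ge0 ltW.
Qed.

End RenormalizedFlow.

(** * The Fleming-Viot generator and its stationary means *)

Section FlemingViotGenerator.
Variables (R : realType) (T : finType) (K : T -> T -> R) (q : T -> R).

Definition fv_rate (n : nat) (eta : T -> R) (x y : T) : R :=
  K x y + q x * (n%:R * eta y / (n%:R - 1)).

Definition jump (n : nat) (eta : T -> R) (x y : T) : T -> R :=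
  fun z => eta z + theta R x y z / n%:R.

(** [configurations] and [fv_gen] are convertible to the sets and the
    generator of the particle system when K is the restricted kernel and q
    the exit probability. *)
Definition fv_gen (n : nat) (phi : (T -> R) -> R) (eta : T -> R) : R :=
  \sum_x \sum_y n%:R * eta x * fv_rate n eta x y * (phi (jump n eta x y) - phi eta).

Definition configurations (n : nat) : set (T -> R) :=
  [set eta | is_prob eta /\
     forall x, exists2 k : nat, (k <= n)%N & n%:R * eta x = k%:R].

Lemma prob_le1 (eta : T -> R) x : is_prob eta -> eta x <= 1.
Proof. by move=> [e0 <-]; rewrite (bigD1 x)//= lerDl sumr_ge0. Qed.

Lemma sum_theta x y (f : T -> R) : \sum_z theta R x y z * f z = f y - f x.
Proof.
rewrite /theta; under eq_bigr do rewrite mulrBl; rewrite sumrB; congr (_ - _).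
  by rewrite (bigD1 y)//= eqxx mul1r big1 ?addr0// => z; rewrite eq_sym => /negbTE ->; rewrite mul0r.
by rewrite (bigD1 x)//= eqxx mul1r big1 ?addr0// => z; rewrite eq_sym => /negbTE ->; rewrite mul0r.
Qed.

Lemma pairing_jump n eta x y f :
  pairing (jump n eta x y) f = pairing eta f + (f y - f x) / n%:R.
Proof.
rewrite /pairing -sum_theta mulr_suml -big_split /=; apply: eq_bigr => z _.
by rewrite /jump; ring.
Qed.

Lemma pairing1 (eta : T -> R) : pairing eta (fun=> 1) = \sum_x eta x.
Proof. by apply: eq_bigr => x _; rewrite mulr1. Qed.

(** Where eta x = 0 the rate of the jump vanishes; elsewhere the jump stays
    in the configurations, so that values of a function outside of them
    never matter. *)
Lemma jump_configurations n eta x y : (0 < n)%N -> configurations n eta ->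
  eta x != 0 -> configurations n (jump n eta x y).
Proof.
move=> n0 [[e0 e1] ek] ex0.
have nR : 0 < n%:R :> R by rewrite ltr0n.
have [<-|xy] := eqVneq x y.
  have -> : jump n eta x x = eta.
    by apply/funext => z; rewrite /jump /theta subrr mul0r addr0.
  by [].
have key z : exists2 k : nat, (k <= n)%N & n%:R * jump n eta x y z = k%:R.
  have [k kn nk] := ek z.
  have E : n%:R * jump n eta x y z = k%:R + theta R x y z.
    by rewrite /jump mulrDr nk mulrCA divff ?mulr1// gt_eqF.
  rewrite E /theta.
  have [yz|yz] := eqVneq y z; have [xz|xz] := eqVneq x z.
  - by move: xy; rewrite yz xz eqxx.
  - exists k.+1; last by rewrite subr0 -natr1.
    have [kx kxn nkx] := ek x.
    have kx1 : (1 <= kx)%N.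
      rewrite lt0n; apply: contra ex0 => /eqP kx0.
      by move/eqP: nkx; rewrite kx0 mulf_eq0 gt_eqF.
    (* The mass available at x leaves room for one more particle at z. *)
    have : eta x + eta z <= 1.
      rewrite -e1 (bigD1 x)//= lerD2l (bigD1 z) 1?eq_sym//= lerDl.
      exact: sumr_ge0.
    rewrite -(ler_pM2l nR) mulrDr nk nkx mulr1 -natrD ler_nat => H.
    by apply: leq_trans H; rewrite -add1n leq_add2r.
  - exists k.-1; first by apply: leq_trans kn; exact: leq_pred.
    have k0 : (0 < k)%N.
      rewrite lt0n; apply: contra ex0 => /eqP k0.
      by move/eqP: nk; rewrite -xz k0 mulf_eq0 gt_eqF.
    by rewrite sub0r -{1}[k]prednK// -natr1 addrK.
  - by exists k => //; rewrite subrr addr0.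
split => //; split.
- move=> z; have [k _ E] := key z.
  by rewrite -(pmulr_rge0 _ nR) E ler0n.
- by rewrite -pairing1 pairing_jump subrr mul0r addr0 pairing1.
Qed.

Lemma finite_configurations n : (0 < n)%N -> finite_set (configurations n).
Proof.
move=> n0; apply: (@sub_finite_set _ _
  [set (fun x => (k x)%:R / n%:R : R) | k in [set: {ffun T -> 'I_n.+1}]]).
  move=> eta [_ ek]; have /choice[k kE] : forall x, exists k : 'I_n.+1, n%:R * eta x = k%:R.
    by move=> x; have [k kn E] := ek x; exists (inord k); rewrite inordK.
  exists [ffun x => k x] => //; apply/funext => x; rewrite ffunE -kE mulrAC divff ?mul1r//.
  by rewrite pnatr_eq0 -lt0n.
exact/finite_image/finite_finset.
Qed.

Hypothesis K0 : forall x y, 0 <= K x y.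
Hypothesis q0 : forall x, 0 <= q x.
Hypothesis Kq : forall x, \sum_y K x y + q x = 1.

Lemma K_le1 x y : K x y <= 1.
Proof.
rewrite -(Kq x) (bigD1 y)//= -addrA lerDl addr_ge0//.
exact: sumr_ge0.
Qed.

Lemma q_le1 x : q x <= 1.
Proof. by rewrite -(Kq x) lerDr sumr_ge0. Qed.

Lemma natr_pred n : (2 <= n)%N -> 1 <= n%:R - 1 :> R /\ n%:R <= 2 * (n%:R - 1) :> R.
Proof.
move=> n2; have : 2 <= n%:R :> R by rewrite (ler_nat _ 2).
by move=> ?; split; lra.
Qed.

Lemma fv_rate_bounds n eta x y : (2 <= n)%N -> is_prob eta ->
  0 <= fv_rate n eta x y <= 3.
Proof.
move=> n2 ep; have [e1 e2] := natr_pred n2.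
have n10 : 0 < n%:R - 1 :> R by apply: lt_le_trans e1.
have ey0 := ep.1 y; have ey1 := prob_le1 y ep.
have r0 : 0 <= n%:R * eta y / (n%:R - 1).
  by apply: divr_ge0; [exact: mulr_ge0|exact: ltW].
have r2 : n%:R * eta y / (n%:R - 1) <= 2.
  rewrite ler_pdivrMr//; apply: le_trans e2; rewrite ger_pMr//; lra.
rewrite /fv_rate; apply/andP; split; first by apply: addr_ge0 => //; exact: mulr_ge0.
have : q x * (n%:R * eta y / (n%:R - 1)) <= 1 * 2.
  by apply: ler_pM => //; exact: q_le1.
by move: (K_le1 x y) (q x * _) => ? ? ?; lra.
Qed.

Lemma fv_gen_bounded n (phi : (T -> R) -> R) (N : R) : (2 <= n)%N ->
  (forall eta, configurations n eta -> `|phi eta| <= N) ->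
  forall eta, configurations n eta ->
    `|fv_gen n phi eta| <= (\sum_(x : T) \sum_(y : T) n%:R * 3 * 2) * N.
Proof.
move=> n2 phiN eta ce; apply: le_trans (ler_norm_sum _ _ _) _.
rewrite mulr_suml; apply: ler_sum => x _; apply: le_trans (ler_norm_sum _ _ _) _.
rewrite mulr_suml; apply: ler_sum => y _.
have N0 : 0 <= N by apply: le_trans (phiN _ ce).
have [->|ex0] := eqVneq (eta x) 0; first by rewrite mulr0 !mul0r normr0 !mulr_ge0.
have /andP[r0 r3] := fv_rate_bounds x y n2 ce.1.
have ex1 := prob_le1 x ce.1.
rewrite !normrM normr_nat (ger0_norm (ce.1.1 x)) (ger0_norm r0).
rewrite -[leRHS]mulrA; apply: ler_pM => //; rewrite ?mulr_ge0//; first exact: ce.1.1.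
  by apply: ler_pM; rewrite ?mulr_ge0 ?ce.1.1// ger_pMr// ltr0n; apply: leq_trans n2.
apply: le_trans (ler_normB _ _) _; rewrite mulr_natl mulr2n lerD ?phiN//.
by apply: jump_configurations => //; apply: leq_trans n2.
Qed.

End FlemingViotGenerator.

Section StationaryMeans.
Variables (R : realType).

(** Semigroup identities are only known for nonnegative times. *)
Lemma right_constant_derivative (f : R -> R) a : has_derivative f 0 a ->
  (forall t, 0 <= t -> f t = f 0) -> a = 0.
Proof.
move=> [df fa] f0.
have := df; rewrite /derivable => /cvg_ex[l fl].
have -> : a = l by rewrite -fa /derive; apply/cvg_lim => //; exact: fl.
have : (fun h : R => h^-1 *: ((f \o shift 0) (h *: (1 : R)) - f 0)) @ 0^'+ --> l.
  exact: cvg_dnbhs_at_right fl.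
move/cvg_lim => <- //; apply/cvg_lim => //; apply: cvg_near_cst.
near=> t; have t0 : 0 < t by near: t; exact: nbhs_right_gt.
rewrite /= addr0 /GRing.scale /= mulr1 f0 ?subrr ?mulr0//; exact: ltW.
Unshelve. all: by end_near. Qed.

Variable T : finType.
Implicit Types (s : seq (T -> R)) (mu : (T -> R) -> R) (phi psi : (T -> R) -> R).

Definition mean s mu phi : R := \sum_(e <- s) mu e * phi e.

Lemma mean_linear s mu a phi psi :
  mean s mu (fun e => a * phi e + psi e) = a * mean s mu phi + mean s mu psi.
Proof.
by rewrite /mean mulr_sumr -big_split; apply: eq_bigr => e _ /=; ring.
Qed.

Lemma meanZ s mu a phi : mean s mu (fun e => a * phi e) = a * mean s mu phi.
Proof. by rewrite /mean mulr_sumr; apply: eq_bigr => e _ /=; ring. Qed.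

Lemma meanD s mu phi psi :
  mean s mu (fun e => phi e + psi e) = mean s mu phi + mean s mu psi.
Proof. by rewrite /mean -big_split; apply: eq_bigr => e _ /=; ring. Qed.

Variables (K : T -> T -> R) (q : T -> R).

(** Invariance in its infinitesimal form. *)
Definition stationary_mean n s mu : Prop :=
  [/\ forall e, e \in s -> configurations n e /\ 0 <= mu e,
      mean s mu (fun=> 1) = 1 &
      forall phi, mean s mu (fv_gen K q n phi) = 0].

Lemma mean_le n s mu phi psi : stationary_mean n s mu ->
  (forall e, configurations n e -> phi e <= psi e) -> mean s mu phi <= mean s mu psi.
Proof.
move=> [ce _ _] le; rewrite /mean !big_seq; apply: ler_sum => e es.
by have [c m0] := ce e es; apply: ler_wpM2l => //; exact: le.
Qed.

Lemma mean_eq n s mu phi psi : stationary_mean n s mu ->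
  (forall e, configurations n e -> phi e = psi e) -> mean s mu phi = mean s mu psi.
Proof.
move=> [ce _ _] le; rewrite /mean !big_seq; apply: eq_bigr => e es.
by rewrite le//; have [] := ce e es.
Qed.

Lemma mean_norm n s mu phi : stationary_mean n s mu ->
  `|mean s mu phi| <= mean s mu (fun e => `|phi e|).
Proof.
move=> [ce _ _]; rewrite /mean; apply: le_trans (ler_norm_sum _ _ _) _.
rewrite !big_seq; apply: ler_sum => e es.
by rewrite normrM ger0_norm//; have [] := ce e es.
Qed.

Lemma mean_cst n s mu a : stationary_mean n s mu -> mean s mu (fun=> a) = a.
Proof. by move=> [_ m1 _]; rewrite -[RHS]mulr1 -m1 -meanZ; congr mean; apply/funext => ?; rewrite mulr1. Qed.

Hypothesis K0 : forall x y, 0 <= K x y.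
Hypothesis q0 : forall x, 0 <= q x.
Hypothesis Kq : forall x, \sum_y K x y + q x = 1.

(** The configurations form a finite set on which the generator is bounded,
    so that invariance under the semigroup can be differentiated at time 0. *)
Lemma stationary_meanP n mu : (2 <= n)%N ->
  (forall eta, configurations n eta -> 0 <= mu eta) ->
  \sum_(eta \in configurations n) mu eta = 1 ->
  (forall (t : R) phi, 0 <= t ->
    \sum_(eta \in configurations n) mu eta * op_exp (fv_gen K q n) t phi eta =
    \sum_(eta \in configurations n) mu eta * phi eta) ->
  exists s, [/\ stationary_mean n s mu, uniq s &
    forall phi, \sum_(eta \in configurations n) phi eta = \sum_(eta <- s) phi eta].
Proof.
move=> n2 mu0 mu1 muL; have n0 : (0 < n)%N by apply: leq_trans n2.
have fin := finite_configurations R T n0.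
pose s : seq (T -> R) := finmap.enum_fset (fset_set (configurations (R := R) (T := T) n)).
have fsE phi : \sum_(eta \in configurations n) phi eta =
    \sum_(eta <- s) phi eta.
  exact: fsbig_finite.
have inE e : e \in s -> configurations n e.
  by rewrite (in_fset_set fin e : (e \in s) = _) => /set_mem.
exists s; split => //; last exact: finmap.fset_uniq.
split.
- by move=> e /inE ce; split => //; exact: mu0.
- by rewrite /mean -[RHS]mu1 fsE; apply: eq_bigr => e _; rewrite mulr1.
move=> phi.
have bd : bounded_on (configurations n) phi.
  exists (\sum_(e <- s) `|phi e|) => e ce.
  have es : e \in s by rewrite (in_fset_set fin e : (e \in s) = _) mem_set.
  by rewrite (big_rem e)//= lerDl sumr_ge0.
have d : has_derivative (fun t => \sum_(e <- s) mu e * op_exp (fv_gen K q n) t phi e) 0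
    (\sum_(e <- s) mu e * fv_gen K q n phi e).
  rewrite big_seq; under eq_fun do rewrite big_seq.
  (* Membership in s is kept along the induction on the list. *)
  rewrite -big_filter; under eq_fun do rewrite -big_filter.
  have ss e : e \in [seq i <- s | i \in s] -> configurations n e.
    by rewrite mem_filter => /andP[/inE].
  move: [seq _ <- _ | _] ss => s'; elim: s' => [|e s' IH] ss.
    rewrite big_nil; under eq_fun do rewrite big_nil.
    exact: has_derivative_cst.
  rewrite big_cons; under eq_fun do rewrite big_cons.
  apply: has_derivativeD; last by apply: IH => e' es'; apply: ss; rewrite in_cons es' orbT.
  apply: has_derivativeZ; rewrite -[X in has_derivative _ _ X](op_exp0 (fv_gen K q n)).
  apply: (is_derive_op_exp _ _ _ bd); last by apply: ss; rewrite mem_head.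
    2: by move=> f N; exact: fv_gen_bounded.
  by apply: sumr_ge0 => x _; apply: sumr_ge0 => y _; rewrite !mulr_ge0.
apply: (right_constant_derivative d) => t t0.
rewrite -!fsE !muL//.
Qed.

End StationaryMeans.

(** * Concentration of the stationary empirical measure *)

Section Drift.
Variables (R : realType) (T : finType) (K : T -> T -> R) (q : T -> R) (lambda : R).
Hypothesis K0 : forall x y, 0 <= K x y.
Hypothesis q0 : forall x, 0 <= q x.
Hypothesis Kq : forall x, \sum_y K x y + q x = 1.

(** The mean velocity of <eta, f>. *)
Definition drift (n : nat) (eta f : T -> R) : R :=
  \sum_x \sum_y eta x * fv_rate K q n eta x y * (f y - f x).

(** The branching part of the rates contributes q x (<eta, f> - f x) up to
    the factor n / (n - 1); the sum of the row of K and of q x being 1, the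
    linear terms recombine into the shifted operator. *)
Lemma driftE n eta f : (2 <= n)%N -> is_prob eta ->
  drift n eta f = pairing eta (shifted_op K lambda f)
    + (pairing eta q - lambda) * pairing eta f
    + (n%:R - 1)^-1 * (pairing eta q * pairing eta f - pairing eta (fun x => q x * f x)).
Proof.
move=> n2 [e0 e1]; have [m1 _] := natr_pred R n2.
have m0 : n%:R - 1 != 0 :> R by apply: lt0r_neq0; apply: lt_le_trans m1.
set Q := pairing eta q; set F := pairing eta f; set QF := pairing eta _.
have row x : \sum_y fv_rate K q n eta x y * (f y - f x) =
    kop K f x - (1 - q x) * f x + q x * (n%:R / (n%:R - 1)) * (F - f x).
  under eq_bigr do rewrite /fv_rate mulrDl mulrBr.
  rewrite big_split /= sumrB -mulr_suml; congr (_ - _ * _ + _).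
    by rewrite -(Kq x) addrK.
  transitivity (\sum_y (q x * (n%:R / (n%:R - 1)) * (eta y * f y) - q x * (n%:R / (n%:R - 1)) * f x * eta y)).
    by apply: eq_bigr => y _; ring.
  by rewrite sumrB -!mulr_sumr e1 -/(pairing eta f) -/F; ring.
transitivity (\sum_x (eta x * shifted_op K lambda f x - lambda * (eta x * f x) +
    (n%:R / (n%:R - 1)) * F * (eta x * q x) - (n%:R - 1)^-1 * (eta x * (q x * f x)))).
  apply: eq_bigr => x _.
  under eq_bigr do rewrite -mulrA.
  by rewrite -mulr_sumr row /shifted_op; field.
rewrite sumrB !big_split /= sumrN -!mulr_sumr.
rewrite -!/(pairing eta _) -/F -/Q -/QF; field => //.
Qed.

Lemma pairing_bound (eta f : T -> R) M : is_prob eta -> (forall x, `|f x| <= M) ->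
  `|pairing eta f| <= M.
Proof.
move=> [e0 e1] fM; apply: le_trans (ler_norm_sum _ _ _) _.
rewrite -[leRHS]mul1r -e1 mulr_suml; apply: ler_sum => x _.
by rewrite normrM ger0_norm//; apply: ler_wpM2l.
Qed.

Lemma drift_error n eta f M : (2 <= n)%N -> is_prob eta -> (forall x, `|f x| <= M) ->
  `|drift n eta f - (pairing eta (shifted_op K lambda f)
      + (pairing eta q - lambda) * pairing eta f)| <= 4 * M / n%:R.
Proof.
move=> n2 ep fM; rewrite driftE// addrC addKr normrM.
have [m1 m2] := natr_pred R n2.
have m0 : 0 < n%:R - 1 :> R by apply: lt_le_trans m1.
have n0 : 0 < n%:R :> R by rewrite ltr0n; apply: leq_trans n2.
rewrite (ger0_norm (_ : 0 <= _^-1)); last by rewrite invr_ge0 ltW.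
rewrite ler_pdivrMl// mulrA ler_pdivlMr// [leRHS]mulrC -mulrA.
have q1 x : `|q x| <= 1 by rewrite ger0_norm// (q_le1 K0 Kq).
have M0 : 0 <= M.
  have [x _] : exists x : T, True.
    apply: contrapT => N; have := ep.2; rewrite big1 => [/eqP|x]; last by exfalso; apply: N; exists x.
    by rewrite eq_sym oner_eq0.
  by apply: le_trans (fM x).
have b1 : `|pairing eta q * pairing eta f| <= M.
  rewrite normrM -[leRHS]mul1r; apply: ler_pM => //; exact: pairing_bound.
have b2 : `|pairing eta (fun x => q x * f x)| <= M.
  apply: pairing_bound => // x; rewrite normrM -[leRHS]mul1r; apply: ler_pM => //; exact: q1.
have b3 := ler_normB (pairing eta q * pairing eta f) (pairing eta (fun x => q x * f x)).
move: (`|_ - _|) b3 => a b3.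
have aM : a <= 2 * M by apply: le_trans b3 _; lra.
apply: le_trans (_ : 2 * M * n%:R <= _); first by rewrite ler_pM2r.
by have := ler_wpM2l M0 m2; lra.
Qed.

End Drift.

Section Lyapunov.
Variables (R : realType) (T : finType).

Lemma finite_pos_lower_bound (f : T -> R) : (forall x, 0 < f x) ->
  exists2 m : R, 0 < m & forall x, m <= f x.
Proof.
move=> f0; have S0 : 0 < 1 + \sum_x (f x)^-1.
  by rewrite ltr_pwDl// sumr_ge0// => x _; rewrite invr_ge0 ltW.
exists (1 + \sum_x (f x)^-1)^-1; first by rewrite invr_gt0.
move=> x; rewrite -[leRHS]invrK lef_pV2 ?posrE ?invr_gt0//.
rewrite (bigD1 x)//= addrCA lerDl addr_ge0// sumr_ge0// => y _.
by rewrite invr_ge0 ltW.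
Qed.

Lemma finite_upper_bound (f : T -> R) :
  exists2 M : R, 0 <= M & forall x, `|f x| <= M.
Proof.
exists (\sum_x `|f x|); first exact: sumr_ge0.
by move=> x; rewrite (bigD1 x)//= lerDl sumr_ge0.
Qed.

(** Second-order expansion of the ratio (e + delta) / (a + b) at e / a: the
    increments delta and b are of order 1 / N, so is the linear term g =
    delta - (e / a) b, and the remainder is of order 1 / N^2. *)
Lemma square_increment_bound (m M M1 r1 a b e delta r w N : R) :
  0 < m -> m <= a -> m <= a + b -> 0 < N -> 0 <= w -> `|r| <= r1 ->
  `|b| <= M / N -> `|delta - e / a * b| <= M1 / N ->
  w * ((r + ((e + delta) / (a + b) - e / a)) ^+ 2 - r ^+ 2)
  <= 2 * (w * r) * ((delta - e / a * b) / a)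
     + w * (2 * r1 * (M1 * M / m ^+ 2) + (M1 / m) ^+ 2) / N ^+ 2.
Proof.
move=> m0 ma mab N0 w0 rr1 bM dM.
have a0 : 0 < a by apply: lt_le_trans ma.
have ab0 : 0 < a + b by apply: lt_le_trans mab.
set g := delta - e / a * b in dM *.
have DE : (e + delta) / (a + b) - e / a = g / (a + b).
  by rewrite /g; field; rewrite !lt0r_neq0.
have DD : g / (a + b) - g / a = - (g * b / (a * (a + b))).
  by field; rewrite !lt0r_neq0.
have aab : m ^+ 2 <= a * (a + b) by rewrite expr2; apply: ler_pM => //; exact: ltW.
have r10 : 0 <= r1 by apply: le_trans rr1.
have M10 : 0 <= M1 / N by apply: le_trans dM.
have M0 : 0 <= M / N by apply: le_trans bM.
have e1 : `|g / (a + b) - g / a| <= (M1 * M / m ^+ 2) / N ^+ 2.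
  rewrite DD normrN normrM normrM normfV (ger0_norm (_ : 0 <= a * (a + b))); last first.
    by rewrite mulr_ge0// ltW.
  have -> : M1 * M / m ^+ 2 / N ^+ 2 = (M1 / N) * (M / N) * (m ^+ 2)^-1.
    by field; rewrite !lt0r_neq0.
  apply: ler_pM; rewrite ?mulr_ge0 ?invr_ge0//.
  - by rewrite mulr_ge0// ltW.
  - exact: ler_pM.
  - by rewrite lef_pV2// posrE ?mulr_gt0// exprn_gt0.
have e2 : (g / (a + b)) ^+ 2 <= (M1 / m) ^+ 2 / N ^+ 2.
  rewrite -[leLHS](real_normK (num_real _)) -exprVn -exprMn ler_sqr ?nnegrE//; last first.
    by rewrite mulrAC mulr_ge0// invr_ge0 ltW.
  rewrite normrM normfV (gtr0_norm ab0) [leRHS]mulrAC; apply: ler_pM => //.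
    by rewrite invr_ge0 ltW.
  by rewrite lef_pV2.
rewrite DE.
have -> : w * ((r + g / (a + b)) ^+ 2 - r ^+ 2) =
  2 * (w * r) * (g / a) + w * (2 * r * (g / (a + b) - g / a) + (g / (a + b)) ^+ 2).
  by ring.
rewrite lerD2l -[leRHS]mulrA; apply: ler_wpM2l => //; rewrite [leRHS]mulrDl; apply: lerD; last exact: e2.
rewrite -!mulrA [leRHS](_ : _ = 2 * (r1 * (M1 * M / m ^+ 2 / N ^+ 2))); last by ring.
apply: ler_wpM2l => //; apply: le_trans (ler_norm _) _; rewrite normrM.
exact: ler_pM.
Qed.

Variables (K : T -> T -> R) (q : T -> R) (lambda : R) (rho h : T -> R).
Hypothesis K0 : forall x y, 0 <= K x y.
Hypothesis q0 : forall x, 0 <= q x.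
Hypothesis Kq : forall x, \sum_y K x y + q x = 1.
Hypothesis Kirr : irreducible_kernel K.
Hypothesis rho0 : forall x, 0 < rho x.
Hypothesis rho1 : \sum_x rho x = 1.
Hypothesis h0 : forall x, 0 < h x.
Hypothesis rho_h : \sum_x rho x * h x = 1.
Hypothesis Krho : forall y, \sum_x rho x * K x y = (1 - lambda) * rho y.
Hypothesis Kh : kop K h = (fun x => (1 - lambda) * h x).

Lemma rho_prob : is_prob rho.
Proof. by split => // x; exact: ltW. Qed.

(** Dividing by <eta, h>, rather than working with eta, removes the
    quadratic term of the drift, because the functions (z == x) - h_ratio z
    * h x have mean 0 under eta. *)
Definition h_ratio (eta : T -> R) (z : T) : R := eta z / pairing eta h.

(** The chi-square distance between the probabilities h_ratio * h and rho *
    h. *)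
Definition chi2 (eta : T -> R) : R :=
  \sum_z h z / rho z * (h_ratio eta z - rho z) ^+ 2.

Lemma pairing_lb m eta : is_prob eta -> (forall x, m <= h x) -> m <= pairing eta h.
Proof.
move=> [e0 e1] mh; rewrite -[m]mul1r -e1 mulr_suml; apply: ler_sum => x _.
exact: ler_wpM2l.
Qed.

(** To first order in 1 / n, the generator acts on chi2 by the chain rule. *)
Lemma fv_gen_chi2 : exists2 C : R, 0 <= C & forall n eta, (2 <= n)%N ->
  configurations n eta ->
  fv_gen K q n chi2 eta <=
    2 * \sum_z (h z / rho z * (h_ratio eta z - rho z)) *
      (drift K q n eta (fun x => (z == x)%:R - h_ratio eta z * h x) / pairing eta h)
    + C / n%:R.
Proof.
have [m m0 mh] := finite_pos_lower_bound h0; have [M M0 hM] := finite_upper_bound h.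
pose r1 := m^-1 + 1; pose M1 := 1 + m^-1 * (2 * M).
pose cz z := h z / rho z * (2 * r1 * (M1 * (2 * M) / m ^+ 2) + (M1 / m) ^+ 2).
have w0 z : 0 <= h z / rho z by rewrite divr_ge0// ltW.
have im0 : 0 <= m^-1 by rewrite invr_ge0 ltW.
have M10 : 0 <= M1 by rewrite addr_ge0// !mulr_ge0.
have r10 : 0 <= r1 by rewrite addr_ge0.
have cz0 z : 0 <= cz z.
  rewrite mulr_ge0// addr_ge0 ?sqr_ge0//; apply: mulr_ge0.
    by rewrite mulr_ge0.
  by rewrite divr_ge0 ?exprn_ge0 ?mulr_ge0// ltW.
exists (\sum_(x : T) \sum_(y : T) 3 * \sum_z cz z).
  by apply: sumr_ge0 => x _; apply: sumr_ge0 => y _; rewrite mulr_ge0// sumr_ge0.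
move=> n eta n2 ce; have ep := ce.1.
have n0 : (0 < n)%N by apply: leq_trans n2.
have nR : 0 < n%:R :> R by rewrite ltr0n.
set a := pairing eta h.
have ma : m <= a by exact: pairing_lb.
have a0 : 0 < a by apply: lt_le_trans ma.
have nu_le z : `|h_ratio eta z| <= m^-1.
  rewrite normrM normfV (gtr0_norm a0) -[leRHS]mul1r; apply: ler_pM => //.
  - by rewrite invr_ge0 ltW.
  - by rewrite ger0_norm ?ep.1// (prob_le1 _ ep).
  - by rewrite lef_pV2// posrE.
(* The linear part of the increment of chi2 under a jump from x to y. *)
pose D x y := \sum_z 2 * (h z / rho z * (h_ratio eta z - rho z)) *
   ((theta R x y z - h_ratio eta z * (h y - h x)) / n%:R / a).
have incr x y : eta x != 0 -> chi2 (jump n eta x y) - chi2 eta <= D x y + (\sum_z cz z) / n%:R ^+ 2.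
  move=> ex0; have cj := jump_configurations y n0 ce ex0.
  rewrite /chi2 -sumrB /D mulr_suml -big_split; apply: ler_sum => z _ /=.
  rewrite -mulrBr.
  rewrite [leRHS](_ : _ = 2 * (h z / rho z * (h_ratio eta z - rho z)) *
      ((theta R x y z / n%:R - eta z / a * ((h y - h x) / n%:R)) / a) + cz z / n%:R ^+ 2); last first.
    by rewrite /h_ratio -/a; ring.
  have -> : h_ratio (jump n eta x y) z - rho z = (h_ratio eta z - rho z) +
      ((eta z + theta R x y z / n%:R) / (a + (h y - h x) / n%:R) - eta z / a).
    by rewrite /h_ratio pairing_jump -/a /jump; ring.
  apply: (square_increment_bound m0 ma) => //.
  - by rewrite -pairing_jump; apply: pairing_lb => //; exact: cj.1.
  - by apply: le_trans (ler_normB _ _) _; apply: lerD => //; rewrite ger0_norm ?(prob_le1 z rho_prob)// ltW.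
  - rewrite normrM normfV normr_nat ler_pM2r ?invr_gt0//.
    by apply: le_trans (ler_normB _ _) _; have := hM x; have := hM y; lra.
  - rewrite [X in `|X|](_ : _ = (theta R x y z - h_ratio eta z * (h y - h x)) / n%:R); last first.
      by rewrite /h_ratio -/a; ring.
    rewrite normrM normfV normr_nat ler_pM2r ?invr_gt0//.
    apply: le_trans (ler_normB _ _) _; apply: lerD.
      rewrite /theta; case: (y == z); case: (x == z); rewrite ?subrr ?subr0 ?sub0r ?normrN ?normr0 ?normr1//.
    rewrite normrM; apply: ler_pM => //.
    by apply: le_trans (ler_normB _ _) _; have := hM x; have := hM y; lra.
have e0 := ep.1.
apply: le_trans (_ : \sum_x \sum_y n%:R * eta x * fv_rate K q n eta x y *
     (D x y + (\sum_z cz z) / n%:R ^+ 2) <= _).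
  apply: ler_sum => x _; apply: ler_sum => y _.
  have [->|ex0] := eqVneq (eta x) 0; first by rewrite mulr0 !mul0r.
  have /andP[r0 _] := fv_rate_bounds K0 q0 Kq x y n2 ep.
  by apply: ler_wpM2l; [rewrite !mulr_ge0|exact: incr].
under eq_bigr do under eq_bigr do rewrite mulrDr.
under eq_bigr do rewrite big_split.
rewrite big_split /=; apply: lerD.
  rewrite le_eqVlt; apply/orP; left; apply/eqP.
  rewrite /drift mulr_sumr.
  under [RHS]eq_bigr do rewrite mulr_suml !mulr_sumr.
  rewrite [RHS]exchange_big; apply: eq_bigr => x _.
  under [RHS]eq_bigr do rewrite mulr_suml !mulr_sumr.
  rewrite [RHS]exchange_big; apply: eq_bigr => y _.
  rewrite /D mulr_sumr; apply: eq_bigr => z _ /=.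
  rewrite /theta -/a (eq_sym y z) (eq_sym x z); field.
  by rewrite !lt0r_neq0.
rewrite [leRHS]mulr_suml; apply: ler_sum => x _.
rewrite [leRHS]mulr_suml; apply: ler_sum => y _.
have /andP[r0 r3] := fv_rate_bounds K0 q0 Kq x y n2 ep.
rewrite [leLHS](_ : _ = (eta x * fv_rate K q n eta x y) * ((\sum_z cz z) / n%:R)); last first.
  by field; rewrite lt0r_neq0.
rewrite -[leRHS]mulrA; apply: ler_wpM2r.
  by rewrite divr_ge0// sumr_ge0.
rewrite -[leRHS]mul1r; apply: ler_pM => //; exact: prob_le1.
Qed.

Lemma shifted_op_h x : shifted_op K lambda h x = 0.
Proof. by rewrite /shifted_op Kh subrr. Qed.

Lemma pairing_delta (eta : T -> R) z : pairing eta (fun x => (z == x)%:R) = eta z.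
Proof.
rewrite /pairing (bigD1 z)//= eqxx mulr1 big1 ?addr0// => x.
by rewrite eq_sym => /negbTE ->; rewrite mulr0.
Qed.

(** The functions g z have mean 0 under eta, so only the shifted operator
    remains in their drift, and it does not see the multiple of h. Summing
    over z reconstructs the quadratic form of the shifted operator at h u,
    where u + 1 is the density of h_ratio with respect to rho; the spectral
    gap concludes. *)
Lemma chi2_drift : exists c C : R, [/\ 0 < c, 0 <= C & forall n eta, (2 <= n)%N ->
  configurations n eta -> fv_gen K q n chi2 eta <= - c * chi2 eta + C / n%:R].
Proof.
have [C1 C10 HC1] := fv_gen_chi2; have [c c0 coer] := shifted_op_coercive K0 Kirr rho0 h0 rho_h Krho Kh.
have [m m0 mh] := finite_pos_lower_bound h0; have [M M0 hM] := finite_upper_bound h.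
pose G := 1 + m^-1 * M; pose r1 := m^-1 + 1.
have im0 : 0 <= m^-1 by rewrite invr_ge0 ltW.
have w0 z : 0 <= h z / rho z by rewrite divr_ge0// ltW.
have G0 : 0 <= G by rewrite addr_ge0 ?mulr_ge0.
have r10 : 0 <= r1 by rewrite addr_ge0.
pose C2 := 2 * \sum_z (h z / rho z * r1 * (4 * G) * m^-1).
have C20 : 0 <= C2.
  rewrite mulr_ge0// sumr_ge0// => z _; apply: mulr_ge0 => //.
  by apply: mulr_ge0; [exact: mulr_ge0|rewrite mulr_ge0].
exists (2 * c), (C2 + C1); split; [by rewrite mulr_gt0|by rewrite addr_ge0|].
move=> n eta n2 ce; apply: le_trans (HC1 n eta n2 ce) _.
have ep := ce.1; set a := pairing eta h.
have nR : 0 < n%:R :> R by rewrite ltr0n; apply: leq_trans n2.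
have ma : m <= a by exact: pairing_lb.
have a0 : 0 < a by apply: lt_le_trans ma.
have nu_le z : `|h_ratio eta z| <= m^-1.
  rewrite normrM normfV (gtr0_norm a0) -[leRHS]mul1r; apply: ler_pM => //.
  - by rewrite invr_ge0 ltW.
  - by rewrite ger0_norm ?ep.1// (prob_le1 _ ep).
  - by rewrite lef_pV2// posrE.
set g := fun z x => (z == x)%:R - h_ratio eta z * h x.
have g0 z : pairing eta (g z) = 0.
  transitivity (pairing eta (fun x => (z == x)%:R) - h_ratio eta z * a).
    by rewrite /pairing mulr_sumr -sumrB; apply: eq_bigr => x _; rewrite /g; ring.
  by rewrite pairing_delta /h_ratio divfK ?subrr// lt0r_neq0.
have gG z x : `|g z x| <= G.
  apply: le_trans (ler_normB _ _) _; apply: lerD; first by case: (z == x); rewrite ?normr1 ?normr0.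
  by rewrite normrM; apply: ler_pM.
pose u x := h_ratio eta x / rho x - 1.
have ru x : h_ratio eta x - rho x = rho x * u x.
  by rewrite /u; field; rewrite lt0r_neq0.
have hu z : h z / rho z * (h_ratio eta z - rho z) = h z * u z.
  by rewrite ru; field; rewrite lt0r_neq0.
have chi2E : chi2 eta = \sum_x rho x * h x * u x ^+ 2.
  by apply: eq_bigr => x _; rewrite expr2 mulrA hu ru; ring.
(* h_ratio * h and rho * h are probabilities, hence no correction by the
   square of the mean in the spectral gap. *)
have mean_u : \sum_x rho x * h x * u x = 0.
  transitivity (\sum_x (h_ratio eta x * h x - rho x * h x)).
    by apply: eq_bigr => x _; rewrite -mulrBl ru; ring.
  rewrite sumrB rho_h; under eq_bigr do rewrite /h_ratio mulrAC.
  by rewrite -mulr_suml -/(pairing eta h) divff ?subrr// lt0r_neq0.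
rewrite [(C2 + C1) / _]mulrDl addrA lerD2r.
have split_drift z : (h z / rho z * (h_ratio eta z - rho z)) * (drift K q n eta (g z) / a) <=
    h z * u z * pairing (h_ratio eta) (shifted_op K lambda (fun x => (z == x)%:R))
    + h z / rho z * r1 * (4 * G) * m^-1 / n%:R.
  have := drift_error lambda K0 q0 Kq n2 ep (gG z); rewrite g0 mulr0 addr0.
  have -> : shifted_op K lambda (g z) = shifted_op K lambda (fun x => (z == x)%:R).
    rewrite (_ : g z = fun x => - h_ratio eta z * h x + (z == x)%:R); last first.
      by apply/funext => x; rewrite /g; ring.
    rewrite shifted_op_linear; apply/funext => x.
    by rewrite shifted_op_h mulr0 add0r.
  set S := shifted_op _ _ _; set d := drift _ _ _ _ _ => dS.
  have -> : pairing (h_ratio eta) S = pairing eta S / a.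
    by rewrite /pairing mulr_suml; apply: eq_bigr => x _; rewrite /h_ratio mulrAC.
  rewrite hu -lerBlDl -mulrBr -mulrBl -hu -!mulrA; apply: ler_wpM2l; first exact: ltW.
  apply: ler_wpM2l; first by rewrite invr_ge0 ltW.
  apply: le_trans (ler_norm _) _; rewrite normrM; apply: ler_pM => //.
    apply: le_trans (ler_normB _ _) _; apply: lerD => //.
    by rewrite gtr0_norm// (prob_le1 _ rho_prob).
  rewrite normrM normfV (gtr0_norm a0).
  rewrite [leRHS](_ : _ = 4 * G / n%:R * m^-1); last by ring.
  apply: ler_pM => //; first by rewrite invr_ge0 ltW.
  by rewrite lef_pV2// posrE.
apply: le_trans (_ : 2 * \sum_z (h z * u z * pairing (h_ratio eta) (shifted_op K lambda (fun x => (z == x)%:R))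
    + h z / rho z * r1 * (4 * G) * m^-1 / n%:R) <= _).
  by apply: ler_wpM2l => //; apply: ler_sum => z _; exact: split_drift.
rewrite big_split /= mulrDr -[X in _ + 2 * X]mulr_suml [2 * (_ / _)]mulrA -/C2 lerD2r.
have -> : \sum_z h z * u z * pairing (h_ratio eta) (shifted_op K lambda (fun x => (z == x)%:R)) =
   pairing (h_ratio eta) (shifted_op K lambda (fun y => h y * u y)).
  rewrite /pairing; under eq_bigr do rewrite mulr_sumr.
  rewrite exchange_big; apply: eq_bigr => x _ /=.
  rewrite /shifted_op /kop mulrBr mulr_sumr.
  have -> : (1 - lambda) * (h x * u x) = \sum_y (h y * u y) * ((1 - lambda) * (y == x)%:R).
    rewrite (bigD1 x)//= eqxx mulr1 big1 ?addr0 1?mulrC// => y /negbTE ->.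
    by rewrite !mulr0.
  rewrite mulr_sumr -sumrB; apply: eq_bigr => y _.
  rewrite (bigD1 y)//= eqxx mulr1 big1 ?addr0; last first.
    by move=> t; rewrite eq_sym => /negbTE ->; rewrite mulr0.
  by ring.
have -> : pairing (h_ratio eta) (shifted_op K lambda (fun y => h y * u y)) =
   \sum_x rho x * u x * shifted_op K lambda (fun y => h y * u y) x.
  apply/eqP; rewrite -subr_eq0 -sumrB -[eqbRHS](pairing_shifted_op Krho (fun y => h y * u y)); apply/eqP.
  by apply: eq_bigr => x _; rewrite -mulrBl -ru; ring.
have := coer u; rewrite mean_u expr0n subr0 -chi2E; lra.
Qed.

Definition deviation (eta : T -> R) : R := \sum_x `|eta x - rho x|.

Lemma deviation_ge0 eta : 0 <= deviation eta.
Proof. exact: sumr_ge0. Qed.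

(** The total mass of rho being 1, <eta, h> is recovered from h_ratio, and
    eta - rho is a Lipschitz function of h_ratio - rho. *)
Lemma deviation_chi2 : exists2 C : R, 0 <= C & forall eta, is_prob eta ->
  deviation eta ^+ 2 <= C * chi2 eta.
Proof.
have [m m0 mh] := finite_pos_lower_bound h0; have [M M0 hM] := finite_upper_bound h.
have w0 z : 0 < h z / rho z by rewrite divr_gt0.
pose W := \sum_z (Num.sqrt (h z / rho z))^-1.
have W0 : 0 <= W by apply: sumr_ge0 => z _; rewrite invr_ge0 sqrtr_ge0.
exists ((2 * M * W) ^+ 2); first exact: sqr_ge0.
move=> eta ep; set a := pairing eta h.
have ma : m <= a by exact: pairing_lb.
have a0 : 0 < a by apply: lt_le_trans ma.
have aM : a <= M by apply: le_trans (ler_norm _) _; exact: pairing_bound.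
pose r z := h_ratio eta z - rho z.
have chi0 : 0 <= chi2 eta.
  by apply: sumr_ge0 => z _; rewrite mulr_ge0 ?sqr_ge0// ltW.
have r_le z : `|r z| <= Num.sqrt (chi2 eta) * (Num.sqrt (h z / rho z))^-1.
  rewrite -sqrtr_sqr -sqrtrV; last exact: ltW.
  rewrite -sqrtrM//.
  apply: ler_wsqrtr.
  rewrite ler_pdivlMr// mulrC.
  rewrite /chi2 (bigD1 z)//= lerDl; apply: sumr_ge0 => y _.
  by rewrite mulr_ge0 ?sqr_ge0// ltW.
have S_le : \sum_z `|r z| <= Num.sqrt (chi2 eta) * W.
  by rewrite mulr_sumr; apply: ler_sum => z _.
have S0 : 0 <= \sum_z `|r z| by exact: sumr_ge0.
have one : a * (\sum_z r z + 1) = 1.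
  rewrite -[X in _ + X]rho1 -big_split /= mulr_sumr -[RHS]ep.2; apply: eq_bigr => z _.
  by rewrite subrK /h_ratio -/a mulrC divfK// lt0r_neq0.
have dE z : eta z - rho z = a * r z - a * (\sum_z r z) * rho z.
  have -> : a * (\sum_z r z) = 1 - a by move: one; rewrite mulrDr mulr1 => <-; rewrite addrK.
  by rewrite /r /h_ratio -/a; field; rewrite lt0r_neq0.
have D_le : deviation eta <= 2 * M * W * Num.sqrt (chi2 eta).
  apply: le_trans (_ : \sum_z (M * `|r z| + M * (\sum_z `|r z|) * rho z) <= _).
    apply: ler_sum => z _; rewrite dE; apply: le_trans (ler_normB _ _) _.
    apply: lerD; rewrite !normrM (gtr0_norm a0); first exact: ler_wpM2r.
    rewrite (gtr0_norm (rho0 z)); apply: ler_wpM2r; first exact: ltW.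
    by apply: ler_pM => //; [exact: ltW|exact: ler_norm_sum].
  rewrite big_split -!mulr_sumr rho1 mulr1 /=.
  have := ler_wpM2l M0 S_le; lra.
apply: le_trans (_ : (2 * M * W * Num.sqrt (chi2 eta)) ^+ 2 <= _).
  by rewrite ler_sqr ?nnegrE ?deviation_ge0// mulr_ge0 ?sqrtr_ge0// !mulr_ge0.
by rewrite exprMn sqr_sqrtr.
Qed.

(** Under a stationary law the generator has mean 0, which turns the
    Lyapunov inequality into a bound on the mean of chi2. *)
Lemma deviation_moment : exists2 C : R, 0 <= C & forall n s mu, (2 <= n)%N ->
  stationary_mean K q n s mu -> mean s mu (fun e => deviation e ^+ 2) <= C / n%:R.
Proof.
have [C1 C10 H1] := deviation_chi2; have [c [C [c0 C0 H]]] := chi2_drift.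
exists (C1 * (C / c)); first by rewrite mulr_ge0// divr_ge0// ltW.
move=> n s mu n2 st; have [_ _ inv] := st.
have le0 : mean s mu (fv_gen K q n chi2) <= - c * mean s mu chi2 + C / n%:R.
  rewrite -[X in _ + X](mean_cst (C / n%:R) st) -mean_linear.
  by apply: mean_le st _ => e ce; exact: H.
rewrite inv in le0.
have chi_le : mean s mu chi2 <= (C / n%:R) / c by rewrite ler_pdivlMr//; lra.
apply: le_trans (_ : C1 * mean s mu chi2 <= _).
  by rewrite -meanZ; apply: mean_le st _ => e ce; apply: H1; exact: ce.1.
by rewrite -[leRHS]mulrA; apply: ler_wpM2l => //; rewrite mulrAC.
Qed.

End Lyapunov.

(** * The generator on cosines of linear functionals *)

Section TaylorTrig.
Variable R : realType.
Implicit Types x a d : R.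

Lemma has_derivative_sin x : has_derivative sin x (cos x).
Proof. exact: is_derive_sin. Qed.

Lemma has_derivative_cos x : has_derivative cos x (- sin x).
Proof. exact: is_derive_cos. Qed.

Lemma has_derivative_sqr_half x : has_derivative (fun x : R => 2^-1 * (x * x)) x x.
Proof.
apply: has_derivative_eq (has_derivativeZ _ (has_derivativeM (has_derivative_id x) (has_derivative_id x))) _.
by rewrite mul1r mulr1; field.
Qed.

Let sin_le x : 0 <= x -> `|sin x| <= x.
Proof.
move=> x0; have [c _] := has_derivative_mvt has_derivative_sin x0.
by rewrite sin0 subr0 => ->; rewrite normrM (ger0_norm x0) ler_piMl// cos_max.
Qed.

Let cos_sub1 x : 0 <= x -> exists2 c : R, 0 <= c <= x & cos x - 1 = - sin c * x.
Proof.
move=> x0; have [c cx] := has_derivative_mvt has_derivative_cos x0.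
by rewrite cos0 => E; exists c.
Qed.

Let cos_sub1_le x : 0 <= x -> `|cos x - 1| <= x /\ `|cos x - 1| <= x ^+ 2.
Proof.
move=> x0; have [c /andP[c0 cx] ->] := cos_sub1 x0.
rewrite normrM normrN (ger0_norm x0); split.
  by rewrite ler_piMl// sin_max.
by rewrite expr2; apply: ler_pM => //; apply: le_trans cx; exact: sin_le.
Qed.

Let sin_sub x : 0 <= x -> `|sin x - x| <= x ^+ 2 /\ `|sin x - x| <= x ^+ 3.
Proof.
move=> x0; have d y : has_derivative (fun z : R => sin z + - z) y (cos y + - 1).
  exact: has_derivativeD (has_derivative_sin y) (has_derivativeN (has_derivative_id y)).
have [c /andP[c0 cx] ] := has_derivative_mvt d x0.
rewrite sin0 oppr0 addr0 subr0 => ->; rewrite normrM (ger0_norm x0).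
have [H1 H2] := cos_sub1_le c0; split.
  by rewrite expr2; apply: ler_pM => //; apply: le_trans cx.
rewrite exprSr; apply: ler_pM => //; apply: le_trans H2 _.
by rewrite ler_sqr ?nnegrE.
Qed.

Let cos_sub x : 0 <= x -> `|cos x - 1 + 2^-1 * (x * x)| <= x ^+ 3.
Proof.
move=> x0; have d y : has_derivative (fun z : R => cos z + 2^-1 * (z * z)) y (- sin y + y).
  exact: has_derivativeD (has_derivative_cos y) (has_derivative_sqr_half y).
have [c /andP[c0 cx] ] := has_derivative_mvt d x0.
rewrite cos0 !mulr0 addr0 addrAC => ->; rewrite normrM (ger0_norm x0).
rewrite -normrN opprD opprK exprSr; apply: ler_pM => //.
by apply: le_trans (sin_sub c0).1 _; rewrite ler_sqr ?nnegrE.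
Qed.

Lemma sin_taylor x : `|sin x - x| <= `|x| ^+ 3.
Proof.
have [x0|x0] := leP 0 x; first by rewrite (ger0_norm x0); exact: (sin_sub x0).2.
have nx0 : 0 <= - x by rewrite oppr_ge0 ltW.
by rewrite (ltr0_norm x0); have := (sin_sub nx0).2; rewrite sinN -opprD normrN.
Qed.

Lemma cos_taylor x : `|cos x - 1 + x ^+ 2 / 2| <= `|x| ^+ 3.
Proof.
rewrite [_ / 2]mulrC expr2.
have [x0|x0] := leP 0 x; first by rewrite (ger0_norm x0); exact: cos_sub.
have nx0 : 0 <= - x by rewrite oppr_ge0 ltW.
by rewrite (ltr0_norm x0); have := cos_sub nx0; rewrite cosN mulrNN.
Qed.

(** Only the terms of order at most 2 survive when the n particles jump
    with increments of order 1 / sqrt n. *)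
Lemma cos_increment a d :
  `|cos (a + d) - cos a + d * sin a + d ^+ 2 / 2 * cos a| <= 2 * `|d| ^+ 3.
Proof.
rewrite cosD.
have -> : cos a * cos d - sin a * sin d - cos a + d * sin a + d ^+ 2 / 2 * cos a =
  cos a * (cos d - 1 + d ^+ 2 / 2) - sin a * (sin d - d) by ring.
apply: le_trans (ler_normB _ _) _; rewrite !normrM mulr_natl mulr2n; apply: lerD.
  rewrite -[leRHS]mul1r; apply: ler_pM => //; [exact: cos_max|exact: cos_taylor].
rewrite -[leRHS]mul1r; apply: ler_pM => //; [exact: sin_max|exact: sin_taylor].
Qed.

Lemma cos_lipschitz a b : `|cos a - cos b| <= `|a - b|.
Proof.
wlog ab : a b / b <= a => [W|].
  have [/W//|/ltW/W] := leP b a; by rewrite distrC [in X in _ <= X]distrC.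
have d y : has_derivative (fun z : R => cos (b + z)) y (- sin (b + y) * 1).
  apply: has_derivative_comp; first exact: has_derivative_cos.
  by apply: has_derivative_eq (has_derivativeD (has_derivative_cst b y) (has_derivative_id y)) _; rewrite add0r.
have ab0 : 0 <= a - b by rewrite subr_ge0.
have [c _] := has_derivative_mvt d ab0; rewrite addr0 [b + _]addrC subrK => ->.
rewrite mulr1 normrM normrN ler_piMl// sin_max//.
Qed.

End TaylorTrig.

Section FluctuationGenerator.
Variables (R : realType) (T : finType).
Variables (K : T -> T -> R) (q : T -> R) (lambda : R) (rho : T -> R).
Hypothesis K0 : forall x y, 0 <= K x y.
Hypothesis q0 : forall x, 0 <= q x.
Hypothesis Kq : forall x, \sum_y K x y + q x = 1.
Hypothesis rho0 : forall x, 0 < rho x.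
Hypothesis rho1 : \sum_x rho x = 1.
Hypothesis Krho : forall y, \sum_x rho x * K x y = (1 - lambda) * rho y.

(** The rate of the squared jumps of <n eta, f>, divided by n, when eta =
    rho. *)
Definition jump_variance (f : T -> R) : R :=
  \sum_x \sum_y rho x * (K x y + q x * rho y) * (f y - f x) ^+ 2.

Lemma pairing_q : pairing rho q = lambda.
Proof.
have : \sum_y \sum_x rho x * K x y = 1 - lambda.
  by under eq_bigr do rewrite Krho; rewrite -mulr_sumr rho1 mulr1.
rewrite exchange_big; under eq_bigr do rewrite -mulr_sumr.
have -> : \sum_x rho x * \sum_y K x y = 1 - pairing rho q.
  rewrite -[X in X - _]rho1 /pairing -sumrB; apply: eq_bigr => x _.
  by have -> : \sum_y K x y = 1 - q x; [rewrite -(Kq x) addrK|ring].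
by move=> E; lra.
Qed.

(** The measure rho is invariant for the kernel K x y + q x * rho y. *)
Lemma jump_varianceE (f : T -> R) : pairing rho f = 0 ->
  jump_variance f = 2 * (pairing rho (fun x => f x ^+ 2) - pairing rho (fun x => f x * kop K f x)).
Proof.
move=> f0; rewrite /jump_variance.
have row x : \sum_y rho x * (K x y + q x * rho y) * (f y - f x) ^+ 2 =
   \sum_y (rho x * K x y) * f y ^+ 2 + rho x * q x * pairing rho (fun x => f x ^+ 2)
   + rho x * f x ^+ 2 - 2 * (rho x * (f x * kop K f x)).
  transitivity (\sum_y ((rho x * K x y) * f y ^+ 2 + rho x * q x * (rho y * f y ^+ 2)
     + rho x * f x ^+ 2 * K x y + rho x * f x ^+ 2 * q x * rho y
     - 2 * (rho x * f x) * (K x y * f y) - 2 * rho x * q x * f x * (rho y * f y))).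
    by apply: eq_bigr => y _; ring.
  rewrite !sumrB !big_split /= -!mulr_sumr rho1 -!/(pairing rho _) -/(kop K f x) f0.
  have -> : \sum_y K x y = 1 - q x by rewrite -(Kq x) addrK.
  by ring.
rewrite (eq_bigr _ (fun x _ => row x)) sumrB !big_split /= -mulr_sumr -mulr_suml -!/(pairing rho _).
rewrite pairing_q.
have -> : \sum_x \sum_y rho x * K x y * f y ^+ 2 = (1 - lambda) * pairing rho (fun x => f x ^+ 2).
  rewrite exchange_big /pairing mulr_sumr; apply: eq_bigr => y _ /=.
  by rewrite -mulr_suml Krho; ring.
by ring.
Qed.

Local Notation D := (deviation rho).

Lemma coord_deviation eta x : `|eta x - rho x| <= D eta.
Proof. by rewrite /deviation (bigD1 x)//= lerDl sumr_ge0. Qed.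

Lemma pairing_deviation eta f F : (forall x, `|f x| <= F) ->
  `|pairing eta f - pairing rho f| <= F * D eta.
Proof.
move=> fF; rewrite /pairing -sumrB mulr_sumr; apply: le_trans (ler_norm_sum _ _ _) _.
by apply: ler_sum => x _; rewrite -mulrBl normrM mulrC; apply: ler_wpM2r.
Qed.

Lemma sqrtn_gt0 n : (2 <= n)%N -> 0 < Num.sqrt n%:R :> R.
Proof. by move=> n2; rewrite sqrtr_gt0 ltr0n; apply: leq_trans n2. Qed.

Lemma sqrtn_sqr n : Num.sqrt n%:R * Num.sqrt n%:R = n%:R :> R.
Proof. by rewrite -expr2 sqr_sqrtr. Qed.

Lemma sqrtn_inv_le n : (2 <= n)%N -> n%:R^-1 <= (Num.sqrt n%:R)^-1 :> R.
Proof.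
move=> n2; have s0 := sqrtn_gt0 n2; have ss := sqrtn_sqr n.
have s1 : 1 <= Num.sqrt n%:R :> R.
  by rewrite -[leLHS]sqrtr1; apply: ler_wsqrtr; rewrite (ler_nat _ 1); apply: leq_trans n2.
rewrite lef_pV2 ?posrE// ?ltr0n; last by apply: leq_trans n2.
by rewrite -[leRHS]ss ler_peMr// ltW.
Qed.

Lemma rate_deviation n eta x y : (2 <= n)%N -> is_prob eta ->
  `|eta x * fv_rate K q n eta x y - rho x * (K x y + q x * rho y)|
   <= 3 * D eta + 2 / n%:R.
Proof.
move=> n2 ep; have [m1 m2] := natr_pred R n2.
have n0 : 0 < n%:R :> R by rewrite ltr0n; apply: leq_trans n2.
have m0 : 0 < n%:R - 1 :> R by apply: lt_le_trans m1.
have -> : eta x * fv_rate K q n eta x y - rho x * (K x y + q x * rho y) =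
  K x y * (eta x - rho x) + q x * ((n%:R - 1)^-1 * (eta x * eta y) +
    (eta x * (eta y - rho y) + (eta x - rho x) * rho y)).
  by rewrite /fv_rate; field; exact: lt0r_neq0.
have d0 : 0 <= D eta by exact: sumr_ge0.
have dx := coord_deviation eta x; have dy := coord_deviation eta y.
have ex := ep.1 x; have ey := ep.1 y; have ex1 := prob_le1 x ep; have ey1 := prob_le1 y ep.
have rp : is_prob rho by split => // z; exact: ltW.
have ry1 := prob_le1 y rp.
have b1 : `|K x y * (eta x - rho x)| <= D eta.
  rewrite normrM ger0_norm// -[leRHS]mul1r; apply: ler_pM => //.
  exact: K_le1 q0 Kq _ _.
have b2 : `|(n%:R - 1)^-1 * (eta x * eta y)| <= 2 / n%:R.
  rewrite ger0_norm ?mulr_ge0 ?invr_ge0 ?(ltW m0)//.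
  apply: le_trans (_ : (n%:R - 1)^-1 * 1 <= _).
    by apply: ler_wpM2l; [rewrite invr_ge0 ltW|rewrite -[leRHS]mul1r; apply: ler_pM].
  by rewrite mulr1 ler_pdivlMr// ler_pdivrMl// mulrC.
have b3 : `|eta x * (eta y - rho y)| <= D eta.
  by rewrite normrM ger0_norm// -[leRHS]mul1r; apply: ler_pM.
have b4 : `|(eta x - rho x) * rho y| <= D eta.
  by rewrite normrM (gtr0_norm (rho0 y)) -[leRHS]mulr1; apply: ler_pM => //; exact: ltW.
apply: le_trans (ler_normD _ _) _.
have -> : 3 * D eta + 2 / n%:R = D eta + (2 / n%:R + (D eta + D eta)) by ring.
apply: lerD => //; rewrite normrM ger0_norm// -[leRHS]mul1r; apply: ler_pM => //.
  exact: q_le1 K0 Kq _.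
apply: le_trans (ler_normD _ _) _; apply: lerD => //.
by apply: le_trans (ler_normD _ _) _; apply: lerD.
Qed.

Definition wave n (f : T -> R) (c : R) (eta : T -> R) : R :=
  Num.sqrt n%:R * pairing eta f + c.

(** Taylor expansion at order 2. The first-order term is the drift, whose
    nonlinear part is a product of two deviations; the rates in the
    second-order term are replaced by their values at rho. *)
Lemma fv_gen_cos (F : R) : 0 <= F -> exists2 C : R, 0 <= C &
  forall n eta f c, (2 <= n)%N -> configurations n eta -> pairing rho f = 0 ->
  (forall x, `|f x| <= F) ->
  `|fv_gen K q n (fun e => cos (wave n f c e)) eta
     + Num.sqrt n%:R * pairing eta (shifted_op K lambda f) * sin (wave n f c eta)
     + 2^-1 * jump_variance f * cos (wave n f c eta)|
  <= C * (Num.sqrt n%:R * D eta ^+ 2 + D eta + (Num.sqrt n%:R)^-1).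
Proof.
move=> F0; pose N : R := \sum_(x : T) \sum_(y : T) 1.
have N0 : 0 <= N by apply: sumr_ge0 => x _; apply: sumr_ge0.
(* 48 = 3 * 2 * 2^3: rates at most 3, a Taylor remainder 2 |d|^3, and
   increments of f at most 2 F. The other constants collect e2 and e3
   below. *)
exists (48 * N * F ^+ 3 + 5 * F + 10 * N * F ^+ 2).
  by rewrite !addr_ge0// ?mulr_ge0 ?exprn_ge0.
move=> n eta f c n2 ce f0 fF; have ep := ce.1.
set s := Num.sqrt n%:R; set A := wave n f c eta.
have s0 : 0 < s by exact: sqrtn_gt0.
have ss : s * s = n%:R by exact: sqrtn_sqr.
have d0 : 0 <= D eta by exact: sumr_ge0.
pose dl x y := (f y - f x) / s.
have df x y : `|f y - f x| <= 2 * F.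
  by apply: le_trans (ler_normB _ _) _; have := fF x; have := fF y; lra.
have jumpE x y : wave n f c (jump n eta x y) = A + dl x y.
  rewrite /wave pairing_jump -/s /A /wave -/s /dl -ss; field; exact: lt0r_neq0.
pose S := \sum_x \sum_y eta x * fv_rate K q n eta x y * (f y - f x) ^+ 2.
pose E1 := fv_gen K q n (fun e => cos (wave n f c e)) eta
   + s * drift K q n eta f * sin A + 2^-1 * S * cos A.
have rate x y : 0 <= eta x * fv_rate K q n eta x y <= 3.
  have /andP[r0 r3] := fv_rate_bounds K0 q0 Kq x y n2 ep.
  have ex := ep.1 x; have ex1 := prob_le1 x ep.
  rewrite mulr_ge0//= -[leRHS]mul1r; exact: ler_pM.
have e1 : `|E1| <= 48 * N * F ^+ 3 / s.
  have -> : E1 = \sum_x \sum_y n%:R * (eta x * fv_rate K q n eta x y) *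
     (cos (A + dl x y) - cos A + dl x y * sin A + dl x y ^+ 2 / 2 * cos A).
    rewrite /E1 /fv_gen /drift /S !(mulr_sumr, mulr_suml) -!big_split; apply: eq_bigr => x _ /=.
    rewrite !(mulr_sumr, mulr_suml) -!big_split; apply: eq_bigr => y _ /=.
    rewrite jumpE -/A -ss /dl; field; exact: lt0r_neq0.
  apply: le_trans (ler_norm_sum _ _ _) _.
  rewrite [leRHS](_ : _ = N * (48 * F ^+ 3 / s)); last by ring.
  rewrite /N mulr_suml; apply: ler_sum => x _; apply: le_trans (ler_norm_sum _ _ _) _.
  rewrite mulr_suml; apply: ler_sum => y _; rewrite mul1r.
  have /andP[r0 r3] := rate x y.
  rewrite normrM normrM normr_nat (ger0_norm r0).
  apply: le_trans (_ : n%:R * 3 * (2 * (2 * F / s) ^+ 3) <= _); last first.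
    rewrite -ss le_eqVlt; apply/orP; left; apply/eqP; field; exact: lt0r_neq0.
  apply: ler_pM; [exact: mulr_ge0|exact: normr_ge0|exact: ler_wpM2l|].
  apply: le_trans (cos_increment _ _) _; apply: ler_wpM2l => //.
  rewrite lerXn2r ?nnegrE ?divr_ge0 ?mulr_ge0 ?(ltW s0)//.
  by rewrite normrM normfV (gtr0_norm s0) ler_pM2r ?invr_gt0.
have q1 x : `|q x| <= 1 by rewrite ger0_norm// (q_le1 K0 Kq).
have e2 : `|s * (drift K q n eta f - pairing eta (shifted_op K lambda f))| <=
    F * (s * D eta ^+ 2) + 4 * F / s.
  have := drift_error lambda K0 q0 Kq n2 ep fF.
  set d := drift _ _ _ _ _; set g := pairing _ _; set b := (_ - lambda) * _ => err.
  have bb : `|b| <= F * D eta ^+ 2.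
    rewrite normrM expr2 mulrCA; apply: ler_pM => //.
      by have := pairing_deviation eta q1; rewrite pairing_q mul1r.
    by have := pairing_deviation eta fF; rewrite f0 subr0.
  rewrite normrM (gtr0_norm s0) [leRHS](_ : _ = s * (F * D eta ^+ 2 + 4 * F / n%:R)); last first.
    by rewrite -ss; field; exact: lt0r_neq0.
  rewrite ler_pM2l//; have -> : d - g = b + (d - (g + b)) by ring.
  by apply: le_trans (ler_normD _ _) _; apply: lerD.
have e3 : `|S - jump_variance f| <= 4 * N * F ^+ 2 * (3 * D eta + 2 / s).
  have -> : S - jump_variance f = \sum_x \sum_y
     (eta x * fv_rate K q n eta x y - rho x * (K x y + q x * rho y)) * (f y - f x) ^+ 2.
    rewrite /S /jump_variance -sumrB; apply: eq_bigr => x _.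
    by rewrite -sumrB; apply: eq_bigr => y _; ring.
  apply: le_trans (ler_norm_sum _ _ _) _.
  rewrite [leRHS](_ : _ = N * ((3 * D eta + 2 / s) * (2 * F) ^+ 2)); last by ring.
  rewrite /N mulr_suml; apply: ler_sum => x _; apply: le_trans (ler_norm_sum _ _ _) _.
  rewrite mulr_suml; apply: ler_sum => y _; rewrite mul1r normrM; apply: ler_pM => //.
    apply: le_trans (rate_deviation _ _ n2 ep) _; rewrite lerD2l ler_pM2l//.
    exact: sqrtn_inv_le.
  by rewrite normrX lerXn2r ?nnegrE// mulr_ge0.
have -> : fv_gen K q n (fun e => cos (wave n f c e)) eta
     + s * pairing eta (shifted_op K lambda f) * sin A + 2^-1 * jump_variance f * cos A
   = E1 - s * (drift K q n eta f - pairing eta (shifted_op K lambda f)) * sin A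
     - 2^-1 * (S - jump_variance f) * cos A by rewrite /E1; ring.
apply: le_trans (ler_normB _ _) _.
apply: le_trans (_ : (48 * N * F ^+ 3 / s + (F * (s * D eta ^+ 2) + 4 * F / s))
   + 2^-1 * (4 * N * F ^+ 2 * (3 * D eta + 2 / s)) <= _).
  apply: lerD.
    apply: le_trans (ler_normB _ _) _; apply: lerD => //.
    rewrite normrM -[leRHS]mulr1; apply: ler_pM => //; exact: sin_max.
  rewrite normrM -[leRHS]mulr1; apply: ler_pM => //; last exact: cos_max.
  by rewrite normrM ger0_norm// ler_pM2l.
set a := s * D eta ^+ 2; set b := D eta in d0 *; set i := s^-1.
have a0 : 0 <= a by rewrite mulr_ge0 ?sqr_ge0// ltW.
have i0 : 0 <= i by rewrite invr_ge0 ltW.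
set u := N * F ^+ 2; set v := N * F ^+ 3.
have u0 : 0 <= u by rewrite mulr_ge0 ?exprn_ge0.
have v0 : 0 <= v by rewrite mulr_ge0 ?exprn_ge0.
rewrite [leLHS](_ : _ = 48 * (v * i) + F * a + 4 * (F * i) + u * (6 * b + 4 * i)); last first.
  by rewrite /u /v /a /i; field; exact: lt0r_neq0.
rewrite [leRHS](_ : _ = (48 * v + 5 * F + 10 * u) * (a + b + i)); last by rewrite /u /v; ring.
have := mulr_ge0 u0 a0; have := mulr_ge0 u0 d0; have := mulr_ge0 u0 i0.
have := mulr_ge0 v0 a0; have := mulr_ge0 v0 d0; have := mulr_ge0 v0 i0.
have := mulr_ge0 F0 a0; have := mulr_ge0 F0 d0; have := mulr_ge0 F0 i0.
lra.
Qed.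

End FluctuationGenerator.

(** * The limiting covariance *)

Section LyapunovEquation.
Variable R : realType.

Lemma kop_injective_surjective (I : finType) (M : I -> I -> R) :
  (forall f, kop M f = (fun=> 0) -> f = fun=> 0) ->
  forall b, exists f, kop M f = b.
Proof.
move=> inj b; pose A := kernel_mx M.
have Aunit : A \in unitmx.
  rewrite unitmxE unitfE; apply/negP; rewrite -det_tr => /det0P[u u0 uA].
  have : (fun x => u 0 (enum_rank x)) = fun=> 0.
    apply: inj; apply/funext => x; move/rowP: uA => /(_ (enum_rank x)).
    rewrite !mxE => E; rewrite -[RHS]E /kop.
    rewrite -(sum_enum_val (fun y => M x y * u 0 (enum_rank y))).
    by apply: eq_bigr => j _; rewrite !mxE enum_valK enum_rankK mulrC.
  move=> z; move/eqP: u0; apply; apply/rowP => i; rewrite mxE.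
  by have := congr1 (fun f => f (enum_val i)) z; rewrite enum_valK.
exists (fun x => (invmx A *m (\col_i b (enum_val i))) (enum_rank x) 0).
apply/funext => x; rewrite /kop.
have := mulKVmx Aunit (\col_i b (enum_val i)); move/colP => /(_ (enum_rank x)).
rewrite [in RHS]mxE enum_rankK => <-.
rewrite [RHS]mxE -(sum_enum_val (fun y => M x y * (invmx A *m (\col_i b (enum_val i))) (enum_rank y) 0)).
by apply: eq_bigr => j _; rewrite enum_valK [A _ _]mxE enum_rankK.
Qed.

Variable T : finType.

Definition bilinear_form (S : T -> T -> R) (f g : T -> R) : R :=
  \sum_x \sum_y S x y * f x * g y.

Lemma has_derivative_bilinear_form S (f g df dg : R -> T -> R) (t : R) :
  (forall x, has_derivative (f ^~ x) t (df t x)) ->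
  (forall x, has_derivative (g ^~ x) t (dg t x)) ->
  has_derivative (fun s => bilinear_form S (f s) (g s)) t
    (bilinear_form S (df t) (g t) + bilinear_form S (f t) (dg t)).
Proof.
move=> fd gd; rewrite /bilinear_form -big_split; apply: has_derivative_sum => x /=.
rewrite -big_split; apply: has_derivative_sum => y /=.
apply: has_derivative_eq (has_derivativeM (has_derivativeZ (S x y) (fd x)) (gd y)) _.
by [].
Qed.

Lemma bilinear_form_linearl S a f f' g :
  bilinear_form S (fun x => a * f x + f' x) g = a * bilinear_form S f g + bilinear_form S f' g.
Proof.
rewrite /bilinear_form mulr_sumr -big_split; apply: eq_bigr => x _ /=.
by rewrite mulr_sumr -big_split; apply: eq_bigr => y _ /=; ring.
Qed.

Lemma bilinear_form_linearr S a f g g' :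
  bilinear_form S f (fun x => a * g x + g' x) = a * bilinear_form S f g + bilinear_form S f g'.
Proof.
rewrite /bilinear_form mulr_sumr -big_split; apply: eq_bigr => x _ /=.
by rewrite mulr_sumr -big_split; apply: eq_bigr => y _ /=; ring.
Qed.

Lemma bilinear_form_bound S f g F G : (forall x, `|f x| <= F) -> (forall x, `|g x| <= G) ->
  `|bilinear_form S f g| <= (\sum_x \sum_y `|S x y|) * (F * G).
Proof.
move=> fF gG; apply: le_trans (ler_norm_sum _ _ _) _.
rewrite mulr_suml; apply: ler_sum => x _; apply: le_trans (ler_norm_sum _ _ _) _.
rewrite mulr_suml; apply: ler_sum => y _; rewrite !normrM -mulrA.
by apply: ler_wpM2l => //; apply: ler_pM.
Qed.

Lemma bilinear_form_delta S x y :
  bilinear_form S (fun z => (z == x)%:R) (fun z => (z == y)%:R) = S x y.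
Proof.
rewrite /bilinear_form (bigD1 x)//= (bigD1 y)//= !eqxx !mulr1 !big1 ?addr0//.
  by move=> z zx; apply: big1 => t _; rewrite (negbTE zx) mulr0 mul0r.
by move=> z zy; rewrite (negbTE zy) mulr0.
Qed.

(** Stability of the flow of A makes the Lyapunov operator injective: a
    form S in its kernel is constant along a flow that vanishes at
    infinity. In finite dimension the operator is then onto. *)
Lemma lyapunov_equation (A : T -> T -> R) (fl : R -> (T -> R) -> T -> R) :
  (forall f, fl 0 f = f) ->
  (forall f x t, has_derivative (fun s => fl s f x) t (kop A (fl t f) x)) ->
  (forall f (e : R), 0 < e -> exists2 t : R, 0 <= t & forall (s : R) x, t <= s -> `|fl s f x| <= e) ->
  forall B : T -> T -> R, exists S : T -> T -> R, forall f g,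
    bilinear_form S (kop A f) g + bilinear_form S f (kop A g) = bilinear_form B f g.
Proof.
move=> fl0 dfl decay B.
(* The Lyapunov operator is itself a kernel operator, on pairs. *)
pose M (p r : T * T) : R := A r.1 p.1 * (r.2 == p.2)%:R + (r.1 == p.1)%:R * A r.2 p.2.
have ME (S : T * T -> R) f g : bilinear_form (fun x y => S (x, y)) (kop A f) g +
    bilinear_form (fun x y => S (x, y)) f (kop A g) =
    bilinear_form (fun x y => kop M S (x, y)) f g.
  have kME x y : kop M S (x, y) = \sum_z A z x * S (z, y) + \sum_z A z y * S (x, z).
    transitivity (\sum_z \sum_t M (x, y) (z, t) * S (z, t)).
      by rewrite pair_bigA; apply: eq_bigr => -[].
    rewrite /M /=.
    under eq_bigr do under eq_bigr do rewrite mulrDl.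
    under eq_bigr do rewrite big_split.
    rewrite big_split /=; congr (_ + _).
      apply: eq_bigr => z _; rewrite (bigD1 y)//= eqxx mulr1 big1 ?addr0//.
      by move=> t ty; rewrite (negbTE ty) mulr0 mul0r.
    rewrite exchange_big; apply: eq_bigr => t _ /=; rewrite (bigD1 x)//= eqxx mul1r big1 ?addr0//.
    by move=> z zx; rewrite (negbTE zx) !mul0r.
  rewrite /bilinear_form; under [RHS]eq_bigr do under eq_bigr do rewrite kME !mulrDl.
  under [RHS]eq_bigr do rewrite big_split.
  rewrite [RHS]big_split /=; congr (_ + _).
    rewrite exchange_big [RHS]exchange_big; apply: eq_bigr => y _ /=.
    under [RHS]eq_bigr do rewrite !mulr_suml.
    rewrite [RHS]exchange_big; apply: eq_bigr => x _ /=.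
    by rewrite /kop mulr_sumr mulr_suml; apply: eq_bigr => z _; ring.
  apply: eq_bigr => x _; under [RHS]eq_bigr do rewrite !mulr_suml.
  rewrite [RHS]exchange_big; apply: eq_bigr => y _ /=.
  by rewrite /kop mulr_sumr; apply: eq_bigr => z _; ring.
have [|S SB] := @kop_injective_surjective _ M _ (fun p => B p.1 p.2); last first.
  by exists (fun x y => S (x, y)) => f g; rewrite ME SB.
move=> S S0; pose Sk x y := S (x, y).
suff Z f g : bilinear_form Sk f g = 0.
  by apply/funext => -[x y]; rewrite -[LHS](bilinear_form_delta Sk).
pose c t := bilinear_form Sk (fl t f) (fl t g).
have dc t : has_derivative c t 0.
  have := @has_derivative_bilinear_form Sk (fun s => fl s f) (fun s => fl s g)
    (fun s => kop A (fl s f)) (fun s => kop A (fl s g)) t (fun x => dfl f x t) (fun x => dfl g x t).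
  rewrite ME S0 [X in has_derivative _ _ X](_ : _ = 0)//.
  by rewrite /bilinear_form big1// => x _; rewrite big1// => y _; rewrite !mul0r.
have c0 t : 0 <= t -> c t = bilinear_form Sk f g.
  move=> t0; have [s _] := has_derivative_mvt dc t0; rewrite mul0r => /eqP.
  by rewrite subr_eq0 => /eqP ->; rewrite /c !fl0.
set N := \sum_x \sum_y `|Sk x y|.
have N0 : 0 <= N by apply: sumr_ge0 => x _; apply: sumr_ge0.
apply/eqP; rewrite -normr_le0; apply/ler_addgt0Pr => e e0; rewrite add0r.
pose d := Num.min 1 (e / (N + 1)).
have N10 : 0 < N + 1 by rewrite ltr_wpDl.
have d0 : 0 < d by rewrite lt_min ltr01 divr_gt0.
have [t1 t10 H1] := decay f d d0; have [t2 t20 H2] := decay g d d0.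
rewrite -(c0 (t1 + t2)) ?addr_ge0//.
apply: le_trans (bilinear_form_bound Sk (fun x => H1 _ x _) (fun x => H2 _ x _)) _.
- by rewrite lerDl.
- by rewrite lerDr.
apply: le_trans (_ : (N + 1) * (d * 1) <= _).
  apply: ler_pM => //; first by rewrite mulr_ge0 ?ltW.
    by rewrite lerDl.
  by apply: ler_wpM2l; [exact: ltW|rewrite ge_min lexx].
by rewrite mulr1 mulrC -ler_pdivlMr// ge_min lexx orbT.
Qed.

End LyapunovEquation.

Section LimitCovariance.
Variables (R : realType) (T : finType).
Variables (K : T -> T -> R) (lambda : R) (rho h : T -> R).
Hypothesis K0 : forall x y, 0 <= K x y.
Hypothesis Kirr : irreducible_kernel K.
Hypothesis rho0 : forall x, 0 < rho x.
Hypothesis rho1 : \sum_x rho x = 1.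
Hypothesis h0 : forall x, 0 < h x.
Hypothesis rho_h : \sum_x rho x * h x = 1.
Hypothesis Krho : forall y, \sum_x rho x * K x y = (1 - lambda) * rho y.
Hypothesis Kh : kop K h = (fun x => (1 - lambda) * h x).

Local Notation fl := (flow K lambda).
Local Notation G := (shifted_op K lambda).

Lemma exp_decay_small (c M e : R) : 0 < c -> 0 <= M -> 0 < e ->
  exists2 t : R, 0 <= t & forall s : R, t <= s -> M * expR (- c * s) <= e.
Proof.
move=> c0 M0 e0; exists (M / (c * e)); first by rewrite divr_ge0// mulr_ge0// ltW.
move=> s ts; rewrite mulNr expRN ler_pdivrMr ?expR_gt0//.
apply: le_trans (_ : e * (1 + c * s) <= _); last first.
  by apply: ler_wpM2l; [exact: ltW|exact: expR_ge1Dx].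
have : M <= s * (c * e) by rewrite -ler_pdivrMr ?mulr_gt0.
by nra.
Qed.

Lemma flow_small f (e : R) : pairing rho f = 0 -> 0 < e ->
  exists2 t : R, 0 <= t & forall (s : R) x, t <= s -> `|fl s f x| <= e.
Proof.
move=> f0 e0; have [c c0 H] := flow_decay K0 Kirr rho0 h0 rho_h Krho Kh.
have [M M0 HM] := H f f0.
have e20 : 0 < e ^+ 2 by rewrite exprn_gt0.
have [t t0 Ht] := exp_decay_small c0 M0 e20; exists t => // s x ts.
rewrite -(ger0_norm (ltW e0)) -ler_sqr ?nnegrE//.
rewrite !real_normK ?num_real//; apply: le_trans (HM s x _) _; last exact: Ht.
exact: le_trans ts.
Qed.

Lemma pairing_linear (r : T -> R) a f g :
  pairing r (fun x => a * f x + g x) = a * pairing r f + pairing r g.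
Proof.
by rewrite /pairing mulr_sumr -big_split; apply: eq_bigr => x _ /=; ring.
Qed.

(** The flow of the shifted operator G fixes h. Subtracting the rank one
    kernel h x * rho y leaves G unchanged on functions of mean 0 and makes
    the flow decay, so the Lyapunov equation can be solved for A. *)
Lemma exists_lyapunov_form : exists S : T -> T -> R, forall f g,
  pairing rho f = 0 -> pairing rho g = 0 ->
  bilinear_form S (G f) g + bilinear_form S f (G g) = - pairing rho (fun x => f x * g x).
Proof.
pose A x y : R := K x y - (1 - lambda) * (x == y)%:R - h x * rho y.
have AE f x : kop A f x = G f x - pairing rho f * h x.
  rewrite /shifted_op /kop /A; move: (1 - lambda) => k.
  under eq_bigr do rewrite !mulrBl.
  rewrite !sumrB; congr (_ - _ - _).
    rewrite (bigD1 x)//= eqxx mulr1 big1 ?addr0// => y.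
    by rewrite eq_sym => /negbTE ->; rewrite mulr0 mul0r.
  by rewrite mulr_suml; apply: eq_bigr => y _; ring.
(* The flow of A: the mean-zero part follows the flow of G, and the
   component along h decays like exp (- t). *)
pose fl' (t : R) f x := fl t (fun y => - pairing rho f * h y + f y) x
  + expR (- 1 * t) * (pairing rho f * h x).
have c0 f : pairing rho (fun y => - pairing rho f * h y + f y) = 0.
  by rewrite pairing_linear [X in _ * X]rho_h mulr1 addNr.
have fl'_mean t f : pairing rho (fl' t f) = expR (- 1 * t) * pairing rho f.
  rewrite /fl' [LHS](_ : _ = pairing rho (fun x => (expR (- 1 * t) * pairing rho f) * h x
     + fl t (fun y => - pairing rho f * h y + f y) x)); last first.
    by apply: eq_bigr => x _; congr (_ * _); ring.
  by rewrite pairing_linear (pairing_flow Krho) c0 addr0 [X in _ * X]rho_h mulr1.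
have [|f x t|f e e0|S HS] := @lyapunov_equation R T A fl' _ _ _ (fun x y => - rho x * (x == y)%:R).
- move=> f; apply/funext => x; rewrite /fl' flow0 mulr0 expR0; ring.
- rewrite AE fl'_mean.
  have d1 : has_derivative (fun s => expR (- 1 * s) * (pairing rho f * h x)) t
     (expR (- 1 * t) * (- 1 * 1) * (pairing rho f * h x) + expR (- 1 * t) * 0).
    apply: has_derivativeM (has_derivative_cst _ _); apply: has_derivative_comp.
      exact: is_derive_expR.
    exact: has_derivativeZ (has_derivative_id t).
  apply: has_derivative_eq (has_derivativeD (has_derivative_flow K lambda _ x t) d1) _.
  have -> : fl' t f = fun x => (expR (- 1 * t) * pairing rho f) * h x
     + fl t (fun y => - pairing rho f * h y + f y) x.
    by apply/funext => y; rewrite /fl'; ring.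
  by rewrite shifted_op_linear (shifted_op_h Kh); ring.
- have e20 : 0 < e / 2 by rewrite divr_gt0.
  have [t1 t10 H1] := flow_small (c0 f) e20.
  have [M M0 HM] := finite_upper_bound (fun x => pairing rho f * h x).
  have [t2 t20 H2] := exp_decay_small ltr01 M0 e20.
  exists (t1 + t2); first by rewrite addr_ge0.
  move=> s x ts; apply: le_trans (ler_normD _ _) _.
  rewrite [leRHS](_ : e = e / 2 + e / 2); last by field.
  apply: lerD; first by apply: H1; lra.
  rewrite normrM ger0_norm ?expR_ge0// mulrC; apply: le_trans (H2 s _); last by lra.
  by apply: ler_wpM2r; rewrite ?expR_ge0.
exists S => f g f0 g0; have := HS f g.
have E f1 : pairing rho f1 = 0 -> kop A f1 = G f1.
  by move=> f10; apply/funext => x; rewrite AE f10 mul0r subr0.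
rewrite !E// => ->; rewrite /bilinear_form /pairing -sumrN; apply: eq_bigr => x _.
rewrite (bigD1 x)//= eqxx mulr1 big1 ?addr0; first by ring.
by move=> y; rewrite eq_sym => /negbTE ->; rewrite mulr0 !mul0r.
Qed.

Definition center (f : T -> R) : T -> R := fun x => f x - pairing rho f.

Lemma center0 f : pairing rho f = 0 -> center f = f.
Proof. by move=> f0; apply/funext => x; rewrite /center f0 subr0. Qed.

Lemma pairing_center f : pairing rho (center f) = 0.
Proof.
rewrite /pairing /center; under eq_bigr do rewrite mulrBr.
by rewrite sumrB -mulr_suml rho1 mul1r subrr.
Qed.

Lemma center_linear a f g :
  center (fun x => a * f x + g x) = fun x => a * center f x + center g x.
Proof. by apply/funext => x; rewrite /center pairing_linear; ring. Qed.

Variable S : T -> T -> R.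
Hypothesis HS : forall f g, pairing rho f = 0 -> pairing rho g = 0 ->
  bilinear_form S (G f) g + bilinear_form S f (G g) = - pairing rho (fun x => f x * g x).

(** On functions of mean 0, the integral over s >= 0 of <rho, f_s g_s>; see
    [limit_form_integral]. *)
Definition sym_form f g : R := 2^-1 * (bilinear_form S f g + bilinear_form S g f).

(** The bilinear form <K f, g>, extended to all functions by centering. *)
Definition limit_form (f g : T -> R) : R :=
  pairing rho (fun x => center f x * center g x)
  + 2 * lambda * sym_form (center f) (center g).

Lemma sym_form_sym f g : sym_form f g = sym_form g f.
Proof. by rewrite /sym_form addrC. Qed.

Lemma limit_form_sym f g : limit_form f g = limit_form g f.
Proof.
rewrite /limit_form sym_form_sym; congr (pairing _ _ + _).
by apply/funext => x; rewrite mulrC.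
Qed.

Lemma limit_form_linear a f f' g :
  limit_form (fun x => a * f x + f' x) g = a * limit_form f g + limit_form f' g.
Proof.
rewrite /limit_form center_linear /sym_form bilinear_form_linearl bilinear_form_linearr.
rewrite [X in X + _](_ : _ = pairing rho (fun x => a * (center f x * center g x) + center f' x * center g x)).
  by rewrite pairing_linear; ring.
by apply: eq_bigr => x _; ring.
Qed.

Lemma limit_form_cst1 g : limit_form (fun=> 1) g = 0.
Proof.
have -> : limit_form (fun=> 1) g = 0 * limit_form (fun=> 0) g + limit_form (fun=> 0) g.
  have c0 (a : R) : center (fun=> a) = fun=> 0.
    by apply/funext => x; rewrite /center /pairing -mulr_suml rho1 mul1r subrr.
  by rewrite /limit_form !c0; ring.
have := limit_form_linear (-1) (fun=> 0) (fun=> 0) g.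
rewrite (_ : (fun x : T => -1 * 0 + 0) = fun=> 0); last by apply/funext => x; ring.
by move=> ->; ring.
Qed.

(** The point masses of the measure K f. *)
Definition limit_operator (f : T -> R) (x : T) : R :=
  limit_form f (fun z => (z == x)%:R).

Lemma pairing_limit_operator f g : pairing (limit_operator f) g = limit_form f g.
Proof.
have gE : g = fun z => \sum_x g x * (z == x)%:R.
  apply/funext => z; rewrite (bigD1 z)//= eqxx mulr1 big1 ?addr0// => y.
  by rewrite eq_sym => /negbTE ->; rewrite mulr0.
have lin0 : limit_form f (fun=> 0) = 0.
  have := limit_form_linear (-1) (fun=> 0) (fun=> 0) f.
  rewrite (_ : (fun x : T => -1 * 0 + 0) = fun=> 0); last by apply/funext => x; ring.
  by rewrite limit_form_sym => ->; ring.
rewrite {2}gE /pairing; elim: (index_enum T) => [|x s IH].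
  by rewrite big_nil -[LHS]lin0; congr limit_form; apply/funext => z; rewrite big_nil.
rewrite big_cons IH /limit_operator mulrC; under [X in _ = limit_form f X]eq_fun do rewrite big_cons.
by rewrite ![limit_form f _]limit_form_sym limit_form_linear.
Qed.

Variable q : T -> R.
Hypothesis Kq : forall x, \sum_y K x y + q x = 1.
Hypothesis q0 : forall x, 0 <= q x.

Lemma jump_variance_ge0 f : 0 <= jump_variance K q rho f.
Proof.
apply: sumr_ge0 => x _; apply: sumr_ge0 => y _; apply: mulr_ge0; last exact: sqr_ge0.
by rewrite mulr_ge0 ?(ltW (rho0 x))// addr_ge0// mulr_ge0// ltW.
Qed.

Lemma pairing_flow0 f t : pairing rho f = 0 -> pairing rho (fl t f) = 0.
Proof. by rewrite (pairing_flow Krho). Qed.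

Lemma has_derivative_sym_form f t : pairing rho f = 0 ->
  has_derivative (fun s => sym_form (fl s f) (fl s f)) t
    (- pairing rho (fun x => fl t f x ^+ 2)).
Proof.
move=> f0; pose d s := bilinear_form S (fl s f) (fl s f).
have -> : (fun s => sym_form (fl s f) (fl s f)) = d.
  by apply/funext => s; rewrite /d /sym_form; field.
have := @has_derivative_bilinear_form R T S (fun s => fl s f) (fun s => fl s f)
  (fun s => G (fl s f)) (fun s => G (fl s f)) t (fun x => has_derivative_flow K lambda f x t)
  (fun x => has_derivative_flow K lambda f x t).
by rewrite HS ?pairing_flow0.
Qed.

(** The Lyapunov equation for the second term and [jump_varianceE] combine. *)
Lemma has_derivative_limit_form f t : pairing rho f = 0 ->
  has_derivative (fun s => limit_form (fl s f) (fl s f)) t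
    (- jump_variance K q rho (fl t f)).
Proof.
move=> f0; have E s : limit_form (fl s f) (fl s f) =
    \sum_x rho x * (fl s f x * fl s f x) + 2 * lambda * sym_form (fl s f) (fl s f).
  by rewrite /limit_form center0 ?pairing_flow0.
rewrite (funext E); apply: has_derivative_eq.
  apply: has_derivativeD; last exact: has_derivativeZ (has_derivative_sym_form t f0).
  apply: has_derivative_sum => x; apply: has_derivativeZ.
  exact: has_derivativeM (has_derivative_flow K lambda f x t) (has_derivative_flow K lambda f x t).
rewrite (jump_varianceE Kq rho1 Krho) ?pairing_flow0// /pairing !mulrBr !mulr_sumr -!sumrN !mulr_sumr -!big_split.
rewrite -[RHS]sumrN; apply: eq_bigr => x _ /=; rewrite /shifted_op; ring.
Qed.

(** Applied to forms bounded by the square of the sup norm, since f_t tends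
    to 0 uniformly. *)
Lemma quadratic_flow_small (b : (T -> R) -> (T -> R) -> R) (N : R) f (e : R) :
  (forall g (F : R), (forall x, `|g x| <= F) -> `|b g g| <= N * (F * F)) ->
  pairing rho f = 0 -> 0 < e ->
  exists2 t : R, 0 <= t & forall s : R, t <= s -> `|b (fl s f) (fl s f)| <= e.
Proof.
move=> bN f0 e0; have N10 : 0 < `|N| + 1 by rewrite ltr_wpDl.
pose d := Num.min 1 (e / (`|N| + 1)).
have d0 : 0 < d by rewrite lt_min ltr01 divr_gt0.
have [t t0 H] := flow_small f0 d0; exists t => // s ts.
apply: le_trans (bN _ d (fun x => H s x ts)) _.
apply: le_trans (_ : (`|N| + 1) * (d * 1) <= _).
  apply: le_trans (_ : `|N| * (d * d) <= _).
    by apply: ler_wpM2r; [rewrite mulr_ge0 ?ltW|exact: ler_norm].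
  apply: ler_pM => //; first by rewrite mulr_ge0 ?ltW.
    by rewrite lerDl.
  by apply: ler_wpM2l; [exact: ltW|rewrite ge_min lexx].
by rewrite mulr1 mulrC -ler_pdivlMr// ge_min lexx orbT.
Qed.

Lemma sym_form_bound g F : (forall x, `|g x| <= F) ->
  `|sym_form g g| <= (\sum_x \sum_y `|S x y|) * (F * F).
Proof.
move=> gF; have -> : sym_form g g = bilinear_form S g g by rewrite /sym_form; field.
exact: bilinear_form_bound.
Qed.

Lemma sym_form_small f (e : R) : pairing rho f = 0 -> 0 < e ->
  exists2 t : R, 0 <= t & forall s : R, t <= s -> `|sym_form (fl s f) (fl s f)| <= e.
Proof. exact: quadratic_flow_small sym_form_bound. Qed.

Lemma limit_form_small f (e : R) : pairing rho f = 0 -> 0 < e ->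
  exists2 t : R, 0 <= t & forall s : R, t <= s -> `|limit_form (fl s f) (fl s f)| <= e.
Proof.
move=> f0 e0.
pose b g g' := pairing rho (fun x => g x * g' x) + 2 * lambda * sym_form g g'.
have bE s : limit_form (fl s f) (fl s f) = b (fl s f) (fl s f).
  by rewrite /limit_form center0 ?pairing_flow0.
have [|t t0 H] := @quadratic_flow_small b (1 + `|2 * lambda| * \sum_x \sum_y `|S x y|) f e _ f0 e0.
  move=> g F gF; rewrite /b [leRHS]mulrDl; apply: le_trans (ler_normD _ _) _; apply: lerD.
    rewrite mul1r; apply: pairing_bound => [|x].
      by split => // x; exact: ltW.
    by rewrite normrM; apply: ler_pM.
  by rewrite normrM -mulrA; apply: ler_wpM2l => //; exact: sym_form_bound.
by exists t => // s ts; rewrite bE H.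
Qed.

Lemma limit_form_flow_le f t : pairing rho f = 0 -> 0 <= t ->
  limit_form (fl t f) (fl t f) <= limit_form f f.
Proof.
move=> f0 t0; have [c _] := has_derivative_mvt (fun s => has_derivative_limit_form s f0) t0.
rewrite (funext (fun x => flow0 K lambda f x) : fl 0 f = f) => E.
rewrite -subr_le0 E mulr_le0_ge0// oppr_le0; exact: jump_variance_ge0.
Qed.

(** Along the flow the form is nonincreasing and tends to 0. *)
Lemma limit_form_ge0 f : 0 <= limit_form f f.
Proof.
have -> : limit_form f f = limit_form (center f) (center f).
  by rewrite /limit_form [center (center f)]center0// pairing_center.
apply/ler_addgt0Pr => e e0.
have [t t0 H] := limit_form_small (pairing_center f) e0.
have := limit_form_flow_le (pairing_center f) t0; have := H t (lexx _).
by rewrite ler_norml => /andP[]; lra.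
Qed.

(** The integrand is <rho, f_s^2>, minus the derivative of S (f_s, f_s),
    which vanishes at infinity. *)
Lemma limit_form_integral f : pairing rho f = 0 ->
  (\int[lebesgue_measure]_(s in `[0%R, +oo[)
     (expR (2 * lambda * s)
      * variance_wrt rho (op_exp (kop (killed_generator K)) s f))%:E
   = (sym_form f f)%:E)%E.
Proof.
move=> f0.
pose g s := pairing rho (fun x => fl s f x ^+ 2).
have gE s : expR (2 * lambda * s) * variance_wrt rho (op_exp (kop (killed_generator K)) s f) = g s.
  have Q0 : pairing rho (op_exp (kop (killed_generator K)) s f) = 0.
    have : expR (lambda * s) * pairing rho (op_exp (kop (killed_generator K)) s f) = 0.
      rewrite -[RHS](pairing_flow0 s f0) /pairing mulr_sumr; apply: eq_bigr => x _.
      by rewrite /flow mulrCA.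
    by move/eqP; rewrite mulf_eq0 gt_eqF ?expR_gt0//= => /eqP.
  rewrite /variance_wrt Q0 /g /pairing mulr_sumr; apply: eq_bigr => x _.
  have -> : expR (2 * lambda * s) = expR (lambda * s) ^+ 2.
    by rewrite expr2 -expRD; congr expR; ring.
  by rewrite subr0 /flow; ring.
under eq_integral do rewrite gE.
pose F s := - sym_form (fl s f) (fl s f).
have dF s : has_derivative F s (g s).
  by apply: has_derivative_eq (has_derivativeN (has_derivative_sym_form s f0)) _; rewrite opprK.
have dg s : has_derivative g s (\sum_x rho x * (G (fl s f) x * fl s f x + fl s f x * G (fl s f) x)).
  rewrite (_ : g = fun s => \sum_x rho x * (fl s f x * fl s f x)); last first.
    by apply/funext => t; apply: eq_bigr => x _; rewrite expr2.
  apply: has_derivative_sum => x; apply: has_derivativeZ.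
  exact: has_derivativeM (has_derivative_flow K lambda f x s) (has_derivative_flow K lambda f x s).
have -> : sym_form f f = 0 - F 0.
  by rewrite /F sub0r opprK (funext (fun x => flow0 K lambda f x) : fl 0 f = f).
rewrite EFinB; apply: ge0_continuous_FTC2y.
- by move=> s _; apply: sumr_ge0 => x _; rewrite mulr_ge0 ?sqr_ge0// ltW.
- by apply: continuous_subspaceT => s; exact: has_derivative_continuous (dg s).
- apply/cvgr0Pnorm_le => e e0; have [t t0 H] := sym_form_small f0 e0.
  near=> s; rewrite /F normrN; apply: H; near: s.
  by apply: nbhs_pinfty_ge; rewrite num_real.
- by move=> s _; case: (dF s).
- apply: cvg_at_right_filter; exact: has_derivative_continuous (dF 0).
- by move=> s _; rewrite derive1E; case: (dF s).
Unshelve. all: by end_near. Qed.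

(** * Convergence of the characteristic functional *)

(** The mean of the deviation D is obtained from that of D^2 through 2 D <=
    sqrt n D^2 + 1 / sqrt n. *)
Lemma mean_error : exists2 C : R, 0 <= C & forall n s mu, (2 <= n)%N ->
  stationary_mean K q n s mu ->
  mean s mu (fun e => Num.sqrt n%:R * deviation rho e ^+ 2 + deviation rho e
                      + (Num.sqrt n%:R)^-1) <= C / Num.sqrt n%:R
  /\ mean s mu (deviation rho) <= C / Num.sqrt n%:R.
Proof.
have [C C0 H] := deviation_moment K0 q0 Kq Kirr rho0 rho1 h0 rho_h Krho Kh.
exists (2 * C + 2); first by rewrite addr_ge0// mulr_ge0.
move=> n s mu n2 st; have := H n s mu n2 st.
have s0 := sqrtn_gt0 R n2; have ss := sqrtn_sqr R n.
set r := Num.sqrt n%:R in s0 ss *; rewrite -ss => {}H.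
have m2 : r * mean s mu (fun e => deviation rho e ^+ 2) <= C / r.
  rewrite -ler_pdivlMl//; apply: le_trans H _; rewrite le_eqVlt; apply/orP; left; apply/eqP.
  by field; exact: lt0r_neq0.
have m1 : mean s mu (deviation rho) <= 2^-1 * (r * mean s mu (fun e => deviation rho e ^+ 2) + r^-1).
  rewrite -[X in _ + X](mean_cst r^-1 st) -mean_linear -meanZ; apply: mean_le st _ => e _.
  set d := deviation rho e.
  have -> : r * d ^+ 2 + r^-1 = r * (d - r^-1) ^+ 2 + 2 * d by field; exact: lt0r_neq0.
  have := mulr_ge0 (ltW s0) (sqr_ge0 (d - r^-1)); lra.
have r0 : 0 <= r^-1 by rewrite invr_ge0 ltW.
have C0r : 0 <= C / r by rewrite mulr_ge0.
have CE : (2 * C + 2) / r = 2 * (C / r) + 2 * r^-1 by ring.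
rewrite CE; split; last by lra.
rewrite [X in X <= _](_ : _ = r * mean s mu (fun e => deviation rho e ^+ 2) +
   mean s mu (deviation rho) + r^-1); first by lra.
by rewrite -[X in _ + X](mean_cst r^-1 st) -mean_linear -meanD.
Qed.

(** The mean of L^n cos (wave) is 0. *)
Lemma mean_wave (F : R) : 0 <= F -> exists2 C : R, 0 <= C & forall n s mu f c, (2 <= n)%N ->
  stationary_mean K q n s mu -> pairing rho f = 0 -> (forall x, `|f x| <= F) ->
  `|mean s mu (fun e => Num.sqrt n%:R * pairing e (G f) * sin (wave n f c e))
    + 2^-1 * jump_variance K q rho f * mean s mu (fun e => cos (wave n f c e))|
   <= C / Num.sqrt n%:R.
Proof.
move=> F0; have [C1 C10 H1] := fv_gen_cos K0 q0 Kq rho0 rho1 Krho F0.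
have [C2 C20 H2] := mean_error; exists (C1 * C2); first exact: mulr_ge0.
move=> n s mu f c n2 st f0 fF; have [_ _ inv] := st.
have -> : mean s mu (fun e => Num.sqrt n%:R * pairing e (G f) * sin (wave n f c e))
    + 2^-1 * jump_variance K q rho f * mean s mu (fun e => cos (wave n f c e)) =
  mean s mu (fun e => fv_gen K q n (fun e => cos (wave n f c e)) e
     + Num.sqrt n%:R * pairing e (G f) * sin (wave n f c e)
     + 2^-1 * jump_variance K q rho f * cos (wave n f c e)).
  by rewrite !meanD inv add0r meanZ.
apply: le_trans (mean_norm _ st) _.
rewrite -mulrA; apply: le_trans (_ : C1 * mean s mu (fun e => Num.sqrt n%:R * deviation rho e ^+ 2
   + deviation rho e + (Num.sqrt n%:R)^-1) <= _).
  by rewrite -meanZ; apply: mean_le st _ => e ce; exact: H1.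
by apply: ler_wpM2l => //; exact: (H2 n s mu n2 st).1.
Qed.

Lemma flow_bounded f : pairing rho f = 0 ->
  exists2 F : R, 0 <= F & forall t x, 0 <= t -> `|fl t f x| <= F.
Proof.
move=> f0; have [c c0 H] := flow_decay K0 Kirr rho0 h0 rho_h Krho Kh.
have [M M0 HM] := H f f0; exists (Num.sqrt M); first exact: sqrtr_ge0.
move=> t x t0; rewrite -sqrtr_sqr; apply: ler_wsqrtr.
apply: le_trans (HM t x t0) _; rewrite ler_piMr// -expR0 ler_expR mulNr oppr_le0.
by rewrite mulr_ge0// ltW.
Qed.

Lemma has_derivative_mean_cos n s mu f c t :
  has_derivative (fun r => mean s mu (fun e => cos (wave n (fl r f) c e))) t
   (- mean s mu (fun e => Num.sqrt n%:R * pairing e (G (fl t f)) * sin (wave n (fl t f) c e))).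
Proof.
rewrite /mean -sumrN; apply: has_derivative_sum => e; rewrite -mulrN; apply: has_derivativeZ.
have d : has_derivative (fun r => wave n (fl r f) c e) t (Num.sqrt n%:R * pairing e (G (fl t f)) + 0).
  apply: has_derivativeD (has_derivative_cst _ _); apply: has_derivativeZ.
  by apply: has_derivative_sum => x; apply: has_derivativeZ; exact: has_derivative_flow.
apply: has_derivative_eq (has_derivative_comp (has_derivative_cos _) d) _.
by ring.
Qed.

Lemma expR_sub1_le (w : R) : 0 <= w -> w <= 2^-1 -> expR w - 1 <= 2 * w.
Proof.
move=> w0 w2; have e0 := expR_gt0 w.
have : 1 - w <= expR (- w) by exact: expR_ge1Dx.
rewrite expRN -(ler_pM2r e0) mulVf ?lt0r_neq0//; nra.
Qed.

(** Along the flow f_t, the derivative of exp (W / 2) times the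
    characteristic functional, where W is the limit form at f_t, is of
    order 1 / sqrt n. The time t is chosen first, so large that f_t and W
    are small; then n. *)
Lemma characteristic_limit f c (e : R) : pairing rho f = 0 -> 0 < e ->
  exists N, forall n s mu, (N <= n)%N -> (2 <= n)%N -> stationary_mean K q n s mu ->
  `|mean s mu (fun eta => cos (wave n f c eta)) - cos c * expR (- (limit_form f f / 2))| <= e.
Proof.
move=> f0 e0; have [F F0 fF] := flow_bounded f0.
have [C C0 HC] := mean_wave F0; have [C3 C30 H3] := mean_error.
(* The mean of sqrt n * deviation is at most C3, so this size of f_t makes
   the wave at time t within e / 4 of c. *)
have d10 : 0 < e / 4 / (C3 + 1) by rewrite !divr_gt0// ltr_wpDl.
have [t1 t10 H1] := flow_small f0 d10.
have d20 : 0 < Num.min 1 (e / 4) by rewrite lt_min ltr01 divr_gt0.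
have [t2 t20 H2] := limit_form_small f0 d20.
pose t := t1 + t2; have t0 : 0 <= t by exact: addr_ge0.
set W0 := limit_form f f; pose W s := limit_form (fl s f) (fl s f).
have W0E : W 0 = W0 by rewrite /W (funext (fun x => flow0 K lambda f x) : fl 0 f = f).
have W00 : 0 <= W0 by exact: limit_form_ge0.
pose B := expR (W0 / 2) * C * t.
have B0 : 0 <= B by rewrite !mulr_ge0// expR_ge0.
(* Large enough for B / sqrt n <= e / 4. *)
exists (Num.truncn ((4 * B / e) ^+ 2)).+1 => n s mu Nn n2 st.
have s0 := sqrtn_gt0 R n2; set r := Num.sqrt n%:R in s0.
have Br : B / r <= e / 4.
  have rB : 4 * B / e <= r.
    rewrite -[leLHS]ger0_norm ?divr_ge0 ?mulr_ge0// ?(ltW e0)// -sqrtr_sqr; apply: ler_wsqrtr.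
    apply: ltW; apply: lt_le_trans (truncnS_gt _) _; by rewrite ler_nat.
  rewrite ler_pdivrMr// ler_pdivrMr// in rB *; lra.
pose Psi u := mean s mu (fun eta => cos (wave n (fl u f) c eta)).
pose Phi u := expR (2^-1 * W u) * Psi u.
have dPhi u : has_derivative Phi u (- (expR (2^-1 * W u) *
   (mean s mu (fun e => r * pairing e (G (fl u f)) * sin (wave n (fl u f) c e))
    + 2^-1 * jump_variance K q rho (fl u f) * Psi u))).
  have d1 : has_derivative (fun u => expR (2^-1 * W u)) u
      (expR (2^-1 * W u) * (2^-1 * - jump_variance K q rho (fl u f))).
    apply: has_derivative_comp; first exact: is_derive_expR.
    exact: has_derivativeZ (has_derivative_limit_form u f0).
  apply: has_derivative_eq (has_derivativeM d1 (has_derivative_mean_cos n s mu f c u)) _.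
  by rewrite /Psi; ring.
have PhiB : `|Phi t - Phi 0| <= B / r.
  have [u /andP[u0 ut] ->] := has_derivative_mvt dPhi t0.
  rewrite normrM (ger0_norm t0) normrN normrM ger0_norm ?expR_ge0//.
  rewrite [leRHS](_ : _ = expR (W0 / 2) * (C / r) * t); last by rewrite /B; ring.
  apply: ler_wpM2r => //; apply: ler_pM; rewrite ?expR_ge0//.
    by rewrite ler_expR mulrC ler_pM2r// limit_form_flow_le.
  by apply: HC => //; [exact: pairing_flow0|move=> x; exact: fF].
have Psi1 : `|Psi t| <= 1.
  rewrite -(mean_cst 1 st); apply: le_trans (mean_norm _ st) _.
  by apply: mean_le st _ => eta _; exact: cos_max.
have Psit : `|Psi t - cos c| <= e / 4.
  have -> : Psi t - cos c = mean s mu (fun eta => cos (wave n (fl t f) c eta) + - cos c).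
    by rewrite meanD (mean_cst _ st).
  apply: le_trans (mean_norm _ st) _.
  set d := e / 4 / (C3 + 1) in H1 d10.
  apply: le_trans (_ : r * d * mean s mu (deviation rho) <= _).
    rewrite -meanZ; apply: mean_le st _ => eta ce.
    apply: le_trans (cos_lipschitz _ _) _; rewrite /wave addrK normrM (gtr0_norm s0) -mulrA.
    apply: ler_wpM2l; first exact: ltW.
    have := @pairing_deviation R T rho eta (fl t f) d.
    by rewrite pairing_flow0// subr0; apply => x; apply: H1; rewrite lerDl.
  apply: le_trans (_ : r * d * (C3 / r) <= _).
    by apply: ler_wpM2l; [rewrite mulr_ge0 ?ltW|exact: (H3 n s mu n2 st).2].
  rewrite [leLHS](_ : _ = e / 4 * (C3 / (C3 + 1))).
    rewrite ler_piMr ?divr_ge0 ?(ltW e0)// ler_pdivrMr ?ltr_wpDl// mul1r lerDl//.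
  by rewrite /d; field; rewrite !lt0r_neq0// ltr_wpDl.
have Wt : 0 <= W t /\ W t <= Num.min 1 (e / 4).
  split; first exact: limit_form_ge0.
  apply: le_trans (ler_norm _) _; apply: H2; by rewrite lerDr.
have eW : 0 <= expR (2^-1 * W t) - 1 <= e / 4.
  have [W1 W2] := Wt; rewrite le_min in W2; have /andP[W2a W2b] := W2.
  rewrite subr_ge0 -[X in X <= _]expR0 ler_expR mulr_ge0//=.
  apply: le_trans (expR_sub1_le _ _) _; [by rewrite mulr_ge0|lra|lra].
have Phit : `|Phi t - cos c| <= e / 4 + e / 4.
  have -> : Phi t - cos c = (expR (2^-1 * W t) - 1) * Psi t + (Psi t - cos c) by rewrite /Phi; ring.
  apply: le_trans (ler_normD _ _) _; apply: lerD => //.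
  have /andP[a b] := eW.
  by rewrite normrM (ger0_norm a) -[leRHS]mulr1; apply: ler_pM.
have E : mean s mu (fun eta => cos (wave n f c eta)) - cos c * expR (- (W0 / 2)) =
   expR (- (W0 / 2)) * (Phi 0 - cos c).
  rewrite /Phi /Psi W0E (funext (fun x => flow0 K lambda f x) : fl 0 f = f).
  by rewrite mulrBr mulrA -expRD mulrC (_ : - (W0 / 2) + 2^-1 * W0 = 0) ?expR0; ring.
rewrite E normrM ger0_norm ?expR_ge0//.
apply: le_trans (_ : 1 * `|Phi 0 - cos c| <= _).
  apply: ler_wpM2r => //; rewrite -expR0 ler_expR oppr_le0 divr_ge0//.
rewrite mul1r; have -> : Phi 0 - cos c = (Phi t - cos c) - (Phi t - Phi 0) by ring.
apply: le_trans (ler_normB _ _) _.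
have := le_trans PhiB Br; lra.
Qed.

End LimitCovariance.

(** * Approximation by trigonometric polynomials *)

Section PointwiseTopology.
Variables (R : realType) (T : finType).

Lemma cvg_ptws (F : set_system {ptws T -> R}) (f : {ptws T -> R}) : Filter F ->
  (forall i, (fun g : {ptws T -> R} => g i) @ F --> f i) -> F --> f.
Proof.
move=> FF H; apply/cvg_sup => i U.
have /= -> := @nbhsE (initial_topology (fun g : (forall i : T, R) => g i)) f.
case=> B [[C oC <- ?]] /filterS; apply; apply: (H i); rewrite /= nbhsE.
by exists C.
Qed.

Lemma nbhs_ptws_box (f : {ptws T -> R}) (r : R) : 0 < r ->
  nbhs f [set g : {ptws T -> R} | forall i, `|f i - g i| < r].
Proof.
move=> r0.
have H (i : T) : nbhs f (fun g : {ptws T -> R} => `|f i - g i| < r).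
  have c : nbhs (f i) [set y : R | `|f i - y| < r] ->
      nbhs f (fun g : {ptws T -> R} => `|f i - g i| < r).
    exact: (@proj_continuous T (fun=> R) i f).
  by apply: c; exact: (nbhsx_ballx (f i) r r0).
have FF : Filter (nbhs f) := nbhs_filter f.
exact: (@filter_forall {ptws T -> R} T (fun i g => `|f i - g i| < r) (nbhs f) FF H).
Qed.

Lemma continuous_ptws_box (h : {ptws T -> R} -> R) (f : {ptws T -> R}) (e : R) : 
  {for f, continuous h} -> 0 < e ->
  exists2 r : R, 0 < r & forall g : {ptws T -> R}, (forall i, `|f i - g i| < r) -> `|h f - h g| < e.
Proof.
move=> ch e0.
pose F := filter_from [set r : R | 0 < r] (fun r => [set g : {ptws T -> R} | forall i, `|f i - g i| < r]).
have FF : Filter F.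
  apply: filter_from_filter; first by exists 1 => /=.
  move=> r1 r2 /= r10 r20; exists (Num.min r1 r2); first by rewrite /= lt_min r10.
  move=> g /= H; split => i; have := H i; rewrite lt_min => /andP[]//.
have Ff : F --> f.
  by apply: cvg_ptws => i; apply/cvgrPdist_lt => r r0; exists r => // g; exact.
have : nbhs f (fun g => ball (h f) e (h g)) by apply: ch; exact: nbhsx_ballx.
by move/Ff => [r r0 H]; exists r.
Qed.

(** Compactness of the cube, used with open neighborhoods in the whole
    space so that w may leave the cube. *)
Lemma cube_uniform_continuity (H : {ptws T -> R} -> R) (a b e : R) :
  continuous H -> 0 < e -> exists2 d : R, 0 < d & forall u w : T -> R,
    (forall i, a <= u i <= b) -> (forall i, `|u i - w i| < d) -> `|H u - H w| < e.
Proof.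
move=> cH e0.
have cK : compact [set f : {ptws T -> R} | forall i : T, `[a, b]%classic (f i)].
  by apply: (@tychonoff T (fun=> R) (fun=> `[a, b]%classic)) => i; exact: segment_compact.
move/compact_near_coveringP : cK.
move=> /(_ R (0^'+) (fun d u => forall w : {ptws T -> R}, (forall i, `|u i - w i| < d) -> `|H u - H w| < e)).
have e20 : 0 < e / 2 by rewrite divr_gt0.
case.
- move=> u0 _; have [r r0 Hr] := continuous_ptws_box (cH u0) e20.
  have r20 : 0 < r / 2 by rewrite divr_gt0.
  exists ([set g : {ptws T -> R} | forall i, `|u0 i - g i| < r / 2], [set d : R | d < r / 2]).
    split => /=; first exact: nbhs_ptws_box.
    exact: nbhs_right_lt.
  move=> [u d] /= [Hu dr] w Hw.
  have h1 : `|H u0 - H u| < e / 2 by apply: Hr => i; apply: lt_le_trans (Hu i) _; lra.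
  have h2 : `|H u0 - H w| < e / 2.
    apply: Hr => i; have -> : u0 i - w i = (u0 i - u i) + (u i - w i) by ring.
    by apply: le_lt_trans (ler_normD _ _) _; have := Hu i; have := Hw i; lra.
  have -> : H u - H w = (H u0 - H w) - (H u0 - H u) by ring.
  by apply: le_lt_trans (ler_normB _ _) _; lra.
- move=> d0 /= d00 Hb; exists (d0 / 2); first by rewrite divr_gt0.
  move=> u w Hu Hw; apply: (Hb (d0 / 2)) Hw => //=.
  - by rewrite sub0r normrN gtr0_norm ?divr_gt0//; lra.
  - by rewrite divr_gt0.
Qed.
End PointwiseTopology.

Section BernsteinWeights.
Variable R : realType.

(** The binomial weights 'C(m, j) u^j (1 - u)^(m - j), through Pascal's
    rule. *)
Fixpoint bernstein (m : nat) (u : R) (j : nat) : R :=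
  if m is m'.+1 then
    u * (if j is j'.+1 then bernstein m' u j' else 0) + (1 - u) * bernstein m' u j
  else (j == 0%N)%:R.

Lemma bernstein_gt m u j : (m < j)%N -> bernstein m u j = 0.
Proof.
elim: m j => [|m IH] [|j]//= mj.
by rewrite !IH ?mulr0 ?addr0//; exact: ltnW.
Qed.

Lemma bernstein_ge0 m u j : 0 <= u <= 1 -> 0 <= bernstein m u j.
Proof.
move=> /andP[u0 u1]; elim: m j => [|m IH] j /=; first exact: ler0n.
by rewrite addr_ge0 ?mulr_ge0 ?subr_ge0//; case: j.
Qed.

Lemma bernstein_sumS m u (g : nat -> R) :
  \sum_(j < m.+2) bernstein m.+1 u j * g j =
  u * \sum_(j < m.+1) bernstein m u j * g j.+1
  + (1 - u) * \sum_(j < m.+1) bernstein m u j * g j.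
Proof.
transitivity (u * \sum_(j < m.+2) (if val j is j'.+1 then bernstein m u j' else 0) * g j
   + (1 - u) * \sum_(j < m.+2) bernstein m u j * g j).
  by rewrite !mulr_sumr -big_split; apply: eq_bigr => j _ /=; ring.
congr (_ * _ + _ * _).
  by rewrite big_ord_recl /= mul0r add0r; apply: eq_bigr => j _.
by rewrite big_ord_recr /= (@bernstein_gt m u m.+1)// mul0r addr0.
Qed.

Lemma bernstein_sum1 m u : \sum_(j < m.+1) bernstein m u j = 1.
Proof.
transitivity (\sum_(j < m.+1) bernstein m u j * 1).
  by apply: eq_bigr => j _; rewrite mulr1.
elim: m => [|m IH]; first by rewrite big_ord1 /= mulr1.
by rewrite (bernstein_sumS m u (fun=> 1)) IH; ring.
Qed.

Lemma bernstein_mean m u : \sum_(j < m.+1) bernstein m u j * (j%:R - m%:R * u) = 0.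
Proof.
elim: m => [|m IH]; first by rewrite big_ord1 /=; ring.
rewrite (bernstein_sumS m u (fun j => j%:R - m.+1%:R * u)).
have shift a : \sum_(j < m.+1) bernstein m u j * (j%:R - m%:R * u + a) = a.
  under eq_bigr do rewrite mulrDr.
  by rewrite big_split /= IH add0r -mulr_suml bernstein_sum1 mul1r.
have -> : \sum_(j < m.+1) bernstein m u j * (j.+1%:R - m.+1%:R * u) = 1 - u.
  by rewrite -[RHS]shift; apply: eq_bigr => j _; rewrite -!natr1; ring.
have -> : \sum_(j < m.+1) bernstein m u j * (j%:R - m.+1%:R * u) = - u.
  by rewrite -[RHS]shift; apply: eq_bigr => j _; rewrite -!natr1; ring.
by ring.
Qed.

Lemma bernstein_variance m u :
  \sum_(j < m.+1) bernstein m u j * (j%:R - m%:R * u) ^+ 2 = m%:R * (u * (1 - u)).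
Proof.
elim: m => [|m IH]; first by rewrite big_ord1 /=; ring.
rewrite (bernstein_sumS m u (fun j => (j%:R - m.+1%:R * u) ^+ 2)).
have expand a : \sum_(j < m.+1) bernstein m u j * (j%:R - m%:R * u + a) ^+ 2 =
    m%:R * (u * (1 - u)) + a ^+ 2.
  transitivity (\sum_(j < m.+1) bernstein m u j * (j%:R - m%:R * u) ^+ 2
     + 2 * a * \sum_(j < m.+1) bernstein m u j * (j%:R - m%:R * u)
     + a ^+ 2 * \sum_(j < m.+1) bernstein m u j).
    rewrite !mulr_sumr -!big_split; apply: eq_bigr => j _ /=; ring.
  by rewrite IH bernstein_mean bernstein_sum1; ring.
have -> : \sum_(j < m.+1) bernstein m u j * (j.+1%:R - m.+1%:R * u) ^+ 2 =
   m%:R * (u * (1 - u)) + (1 - u) ^+ 2.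
  by rewrite -expand; apply: eq_bigr => j _; rewrite -!natr1; ring.
have -> : \sum_(j < m.+1) bernstein m u j * (j%:R - m.+1%:R * u) ^+ 2 =
   m%:R * (u * (1 - u)) + (- u) ^+ 2.
  by rewrite -expand; apply: eq_bigr => j _; rewrite -!natr1; ring.
by rewrite -natr1; ring.
Qed.

End BernsteinWeights.

Section MultivariateBernstein.
Variables (R : realType) (T : finType).

Definition grid (m : nat) (k : {ffun T -> 'I_m.+1}) : T -> R := fun x => (k x)%:R / m%:R.

Definition multi_bernstein (m : nat) (H : (T -> R) -> R) (u : T -> R) : R :=
  \sum_(k : {ffun T -> 'I_m.+1}) H (grid k) * \prod_x bernstein m (u x) (k x).

Lemma multi_bernstein_sum1 m u :
  \sum_(k : {ffun T -> 'I_m.+1}) \prod_x bernstein m (u x) (k x) = 1 :> R.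
Proof.
rewrite -(bigA_distr_bigA (fun x (j : 'I_m.+1) => bernstein m (u x) j)).
by rewrite big1// => x _; exact: bernstein_sum1.
Qed.

(** The product of the weights is a product law, so only the coordinate y
    contributes. *)
Lemma multi_bernstein_variance m u y : (0 < m)%N -> (forall x, 0 <= u x <= 1) ->
  \sum_(k : {ffun T -> 'I_m.+1}) (u y - grid k y) ^+ 2 * \prod_x bernstein m (u x) (k x)
   <= m%:R^-1.
Proof.
move=> m0 u01; have mR : 0 < m%:R :> R by rewrite ltr0n.
pose F x (j : 'I_m.+1) := bernstein m (u x) j * (if x == y then (u y - j%:R / m%:R) ^+ 2 else 1).
have -> : \sum_(k : {ffun T -> 'I_m.+1}) (u y - grid k y) ^+ 2 * \prod_x bernstein m (u x) (k x) =
   \sum_(k : {ffun T -> 'I_m.+1}) \prod_x F x (k x).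
  apply: eq_bigr => k _; rewrite /F big_split /= mulrC; congr (_ * _).
  rewrite (bigD1 y)//= eqxx big1 ?mulr1// => x /negbTE -> //.
rewrite -bigA_distr_bigA (bigD1 y)//= [X in _ * X]big1 ?mulr1; last first.
  move=> x /negbTE xy; rewrite /F -[RHS](bernstein_sum1 m (u x)).
  by apply: eq_bigr => j _; rewrite xy mulr1.
rewrite /F eqxx; have -> : \sum_(j < m.+1) bernstein m (u y) j * (u y - j%:R / m%:R) ^+ 2 =
   (m%:R ^+ 2)^-1 * (m%:R * (u y * (1 - u y))).
  rewrite -bernstein_variance mulr_sumr; apply: eq_bigr => j _.
  by field; exact: lt0r_neq0.
have /andP[u0 u1] := u01 y.
rewrite [leLHS](_ : _ = m%:R^-1 * (u y * (1 - u y))); last by field; exact: lt0r_neq0.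
rewrite ler_piMr ?invr_ge0 ?(ltW mR)//; nra.
Qed.

(** The Bernstein polynomial averages H over a law with mean u and variance
    at most 1 / m in each coordinate, to which the quadratic modulus of
    continuity is applied. *)
Lemma multi_bernstein_approx (H : (T -> R) -> R) (e C : R) : 0 < e -> 0 <= C ->
  (forall u w : T -> R, (forall x, 0 <= u x <= 1) ->
     `|H u - H w| <= e + C * \sum_x (u x - w x) ^+ 2) ->
  exists m, (0 < m)%N /\ forall u : T -> R, (forall x, 0 <= u x <= 1) ->
    `|H u - multi_bernstein m H u| <= 2 * e.
Proof.
move=> e0 C0 HC; pose N : R := \sum_(x : T) 1.
have N0 : 0 <= N by apply: sumr_ge0.
have [m m1 mC] : exists2 m, (0 < m)%N & C * N / m%:R <= e.
  exists (Num.truncn (C * N / e)).+1 => //.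
  rewrite ler_pdivrMr ?ltr0n// [e * _]mulrC -ler_pdivrMr//; apply: ltW; exact: truncnS_gt.
exists m; split => // u u01; have m0 : 0 < m%:R :> R by rewrite ltr0n.
have P0 (k : {ffun T -> 'I_m.+1}) : 0 <= \prod_x bernstein m (u x) (k x).
  by apply: prodr_ge0 => x _; exact: bernstein_ge0.
have {1}-> : H u = \sum_(k : {ffun T -> 'I_m.+1}) H u * \prod_x bernstein m (u x) (k x).
  by rewrite -mulr_sumr multi_bernstein_sum1 mulr1.
rewrite /multi_bernstein -sumrB.
apply: le_trans (ler_norm_sum _ _ _) _.
apply: le_trans (_ : \sum_(k : {ffun T -> 'I_m.+1}) (e + C * \sum_x (u x - grid k x) ^+ 2)
   * \prod_x bernstein m (u x) (k x) <= _).
  apply: ler_sum => k _; rewrite -mulrBl normrM (ger0_norm (P0 k)).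
  by apply: ler_wpM2r => //; exact: HC.
under eq_bigr do rewrite mulrDl; rewrite big_split /= -mulr_sumr multi_bernstein_sum1 mulr1.
have -> : 2 * e = e + e by ring.
rewrite lerD2l; apply: le_trans mC.
have -> : \sum_(k : {ffun T -> 'I_m.+1}) C * (\sum_x (u x - grid k x) ^+ 2)
     * \prod_x bernstein m (u x) (k x) =
   C * \sum_x \sum_(k : {ffun T -> 'I_m.+1}) (u x - grid k x) ^+ 2
     * \prod_x bernstein m (u x) (k x).
  rewrite exchange_big mulr_sumr; apply: eq_bigr => k _ /=.
  by rewrite -mulrA mulr_suml.
rewrite -[leRHS]mulrA; apply: ler_wpM2l => //; rewrite mulr_suml.
apply: ler_sum => x _; rewrite mul1r.
exact: multi_bernstein_variance.
Qed.

End MultivariateBernstein.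

Section TrigPolynomials.
Variables (R : realType) (T : finType).
Implicit Types F G : (T -> R) -> R.

(** The phases make products stay in the class. *)
Definition trig_poly F := exists s : seq (R * (T -> R) * R),
  F = fun v => \sum_(p <- s) p.1.1 * cos (pairing v p.1.2 + p.2).

Lemma trig_polyD F G : trig_poly F -> trig_poly G -> trig_poly (fun v => F v + G v).
Proof. by move=> [s ->] [t ->]; exists (s ++ t); apply/funext => v; rewrite big_cat. Qed.

Lemma trig_polyZ a F : trig_poly F -> trig_poly (fun v => a * F v).
Proof.
move=> [s ->]; exists [seq (a * p.1.1, p.1.2, p.2) | p <- s]; apply/funext => v.
by rewrite big_map mulr_sumr; apply: eq_bigr => p _; rewrite mulrA.
Qed.

Lemma trig_poly_wave f c : trig_poly (fun v => cos (pairing v f + c)).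
Proof. by exists [:: (1, f, c)]; apply/funext => v; rewrite big_seq1 mul1r. Qed.

Lemma trig_poly_cst a : trig_poly (fun=> a).
Proof.
have := trig_polyZ a (trig_poly_wave (fun=> 0) 0).
congr trig_poly; apply/funext => v.
by rewrite /pairing big1 ?addr0 ?cos0 ?mulr1// => x _; rewrite mulr0.
Qed.

Lemma trig_poly_sum (I : Type) (s : seq I) (F : I -> (T -> R) -> R) :
  (forall i, trig_poly (F i)) -> trig_poly (fun v => \sum_(i <- s) F i v).
Proof.
move=> H; elim: s => [|i s IH].
  by rewrite [X in trig_poly X](_ : _ = fun=> 0); [exact: trig_poly_cst|apply/funext => v; rewrite big_nil].
rewrite [X in trig_poly X](_ : _ = fun v => F i v + \sum_(j <- s) F j v).
  exact: trig_polyD.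
by apply/funext => v; rewrite big_cons.
Qed.

Lemma trig_polyM F G : trig_poly F -> trig_poly G -> trig_poly (fun v => F v * G v).
Proof.
move=> [s ->] [t ->].
rewrite [X in trig_poly X](_ : _ = fun v => \sum_(p <- s) \sum_(r <- t)
   (p.1.1 * r.1.1 / 2) * (cos (pairing v (fun x => p.1.2 x + r.1.2 x) + (p.2 + r.2))
     + cos (pairing v (fun x => p.1.2 x - r.1.2 x) + (p.2 - r.2)))).
  apply: trig_poly_sum => p; apply: trig_poly_sum => r.
  by apply: trig_polyZ; apply: trig_polyD; exact: trig_poly_wave.
apply/funext => v; rewrite mulr_suml; apply: eq_bigr => p _.
rewrite mulr_sumr; apply: eq_bigr => r _.
have -> : pairing v (fun x => p.1.2 x + r.1.2 x) + (p.2 + r.2) =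
    (pairing v p.1.2 + p.2) + (pairing v r.1.2 + r.2).
  by rewrite /pairing; under eq_bigr do rewrite mulrDr; rewrite big_split /=; ring.
have -> : pairing v (fun x => p.1.2 x - r.1.2 x) + (p.2 - r.2) =
    (pairing v p.1.2 + p.2) - (pairing v r.1.2 + r.2).
  by rewrite /pairing; under eq_bigr do rewrite mulrBr; rewrite sumrB; ring.
by move: (pairing v p.1.2 + p.2) (pairing v r.1.2 + r.2) => A A'; rewrite cosD cosB; field.
Qed.

Lemma trig_poly_prod (I : Type) (s : seq I) (F : I -> (T -> R) -> R) :
  (forall i, trig_poly (F i)) -> trig_poly (fun v => \prod_(i <- s) F i v).
Proof.
move=> H; elim: s => [|i s IH].
  by rewrite [X in trig_poly X](_ : _ = fun=> 1); [exact: trig_poly_cst|apply/funext => v; rewrite big_nil].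
rewrite [X in trig_poly X](_ : _ = fun v => F i v * \prod_(j <- s) F j v).
  exact: trig_polyM.
by apply/funext => v; rewrite big_cons.
Qed.

Lemma trig_poly_bernstein m j F : trig_poly F -> trig_poly (fun v => bernstein m (F v) j).
Proof.
move=> HF; elim: m j => [|m IH] j /=; first exact: trig_poly_cst.
apply: trig_polyD; apply: trig_polyM => //.
  by case: j => [|j]; [exact: trig_poly_cst|exact: IH].
by apply: trig_polyD; [exact: trig_poly_cst|]; have := trig_polyZ (-1) HF; congr trig_poly; apply/funext => v; rewrite mulN1r.
Qed.

Lemma trig_poly_sin x (L : R) : trig_poly (fun v => 2^-1 * (1 + sin (v x / L))).
Proof.
apply: trig_polyZ; apply: trig_polyD; first exact: trig_poly_cst.
have := trig_poly_wave (fun y => (y == x)%:R / L) (- (pi / 2)).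
congr trig_poly; apply/funext => v.
have -> : pairing v (fun y => (y == x)%:R / L) = v x / L.
  rewrite /pairing (bigD1 x)//= eqxx mul1r big1 ?addr0// => y /negbTE ->.
  by rewrite mul0r mulr0.
by rewrite -cosN opprD opprK addrC cosB cos_pihalf sin_pihalf; ring.
Qed.

Lemma trig_poly_bounded F : trig_poly F -> exists C : R, forall v, `|F v| <= C.
Proof.
move=> [s ->]; exists (\sum_(p <- s) `|p.1.1|) => v.
apply: le_trans (ler_norm_sum _ _ _) _; apply: ler_sum => p _.
by rewrite normrM ler_piMr// cos_max.
Qed.

Lemma multi_bernstein_bounded m (H : (T -> R) -> R) (B : R) u : (forall v, `|H v| <= B) ->
  (forall x, 0 <= u x <= 1) -> `|multi_bernstein m H u| <= B.
Proof.
move=> HB u01; apply: le_trans (ler_norm_sum _ _ _) _.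
have -> : B = \sum_(k : {ffun T -> 'I_m.+1}) B * \prod_x bernstein m (u x) (k x).
  by rewrite -mulr_sumr multi_bernstein_sum1 mulr1.
apply: ler_sum => k _.
have P0 : 0 <= \prod_x bernstein m (u x) (k x).
  by apply: prodr_ge0 => x _; exact: bernstein_ge0.
by rewrite normrM (ger0_norm P0); apply: ler_wpM2r.
Qed.

(** On a box, v is close to L sin (v / L) for large L, and a continuous
    function of L sin (v / L) is close to a Bernstein polynomial in sin (v
    / L), which is bounded everywhere; outside the box the quadratic term
    dominates. *)
Lemma trig_poly_approx (h : {ptws T -> R} -> R) (B e : R) : continuous h ->
  (forall v, `|h v| <= B) -> 0 < e -> exists2 F, trig_poly F &
  forall v : T -> R, `|h v - F v| <= e * (1 + \sum_x v x ^+ 2).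
Proof.
move=> ch hB e0; have B0 : 0 <= B by apply: le_trans (hB (fun=> 0)).
have e30 : 0 < e / 4 by rewrite divr_gt0.
(* Outside the box of size M, the bound 2 B is absorbed by e v^2. *)
pose M := 1 + 2 * B / e.
have BM : 2 * B / e <= M by rewrite lerDr.
have M1 : 1 <= M by rewrite lerDl divr_ge0 ?mulr_ge0// ltW.
have M0 : 0 < M by apply: lt_le_trans M1.
have [d d0 Hd] := cube_uniform_continuity (- M) M ch e30.
(* On that box |v - L sin (v / L)| <= M^3 / L^2 < d. *)
pose L := 1 + M ^+ 3 / d.
have L1 : 1 <= L by rewrite lerDl divr_ge0 ?exprn_ge0// ltW.
have L0 : 0 < L by apply: lt_le_trans L1.
have [d2 d20 Hd2] := cube_uniform_continuity (- L) L ch e30.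
(* For u x = (1 + sin (v x / L)) / 2 the argument of h is L sin (v x / L). *)
pose H (u : T -> R) := h (fun x => L * (2 * u x - 1)).
(* Uniform continuity and boundedness give a modulus that is quadratic on
   the whole space, as the approximation theorem requires. *)
pose C := 2 * B * (2 * L / d2) ^+ 2.
have C0 : 0 <= C by apply: mulr_ge0; [rewrite mulr_ge0|exact: sqr_ge0].
have HC (u w : T -> R) : (forall x, 0 <= u x <= 1) ->
    `|H u - H w| <= e / 4 + C * \sum_x (u x - w x) ^+ 2.
  move=> u01.
  have S0 : 0 <= \sum_x (u x - w x) ^+ 2 by apply: sumr_ge0 => x _; exact: sqr_ge0.
  have [near|] := pselect (forall x, `|u x - w x| < d2 / (2 * L)).
    apply: ler_wpDr; first exact: mulr_ge0.
    apply: ltW; apply: Hd2 => x; first by have /andP[] := u01 x; nra.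
    have -> : L * (2 * u x - 1) - L * (2 * w x - 1) = (u x - w x) * (2 * L) by ring.
    by rewrite normrM [X in _ * X]gtr0_norm ?mulr_gt0// -ltr_pdivlMr ?mulr_gt0.
  move=> /existsNP[x /negP]; rewrite -leNgt => far.
  apply: ler_wpDl; first exact: ltW.
  apply: le_trans (_ : C * (u x - w x) ^+ 2 <= _); last first.
    by apply: ler_wpM2l => //; rewrite (bigD1 x)//= lerDl; apply: sumr_ge0 => y _; exact: sqr_ge0.
  have one : 1 <= (2 * L / d2) ^+ 2 * (u x - w x) ^+ 2.
    rewrite -exprMn -[X in _ <= X](real_normK (num_real _)) -[leLHS](expr1n R 2) lerXn2r ?nnegrE//.
    rewrite normrM gtr0_norm ?divr_gt0 ?mulr_gt0// mulrAC ler_pdivlMr// mul1r mulrC -ler_pdivrMr ?mulr_gt0//.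
  apply: le_trans (ler_normB _ _) _; apply: le_trans (lerD (hB _) (hB _)) _.
  by rewrite /C -mulrA; nra.
have [m [m0 Hm]] := multi_bernstein_approx e30 C0 HC.
pose U (v : T -> R) x := 2^-1 * (1 + sin (v x / L)).
have U01 v x : 0 <= U v x <= 1.
  by rewrite /U; have := sin_geN1 (v x / L); have := sin_le1 (v x / L) => ? ?; apply/andP; split; lra.
exists (fun v => multi_bernstein m H (U v)).
  apply: trig_poly_sum => k; apply: trig_polyZ; apply: trig_poly_prod => x.
  by apply: trig_poly_bernstein; exact: trig_poly_sin.
move=> v.
have V0 : 0 <= \sum_x v x ^+ 2 by apply: sumr_ge0 => x _; exact: sqr_ge0.
have [box|] := pselect (forall x, `|v x| <= M).
  apply: le_trans (_ : e <= _); last by rewrite ler_peMr ?lerDl// ltW.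
  have -> : h v - multi_bernstein m H (U v) = (h v - H (U v)) + (H (U v) - multi_bernstein m H (U v)) by ring.
  apply: le_trans (ler_normD _ _) _; have := Hm (U v) (U01 v).
  suff : `|h v - H (U v)| < e / 4 by lra.
  apply: Hd => x; first by have := box x; rewrite ler_norml.
  have -> : v x - L * (2 * U v x - 1) = - L * (sin (v x / L) - v x / L).
    by rewrite /U; field; exact: lt0r_neq0.
  rewrite normrM normrN (gtr0_norm L0).
  apply: le_lt_trans (_ : L * `|v x / L| ^+ 3 < _).
    by apply: ler_wpM2l; [exact: ltW|exact: sin_taylor].
  have vL : `|v x / L| <= M / L.
    by rewrite normrM normfV (gtr0_norm L0) ler_pM2r ?invr_gt0.
  apply: le_lt_trans (_ : L * (M / L) ^+ 3 < _).
    by apply: ler_wpM2l; [exact: ltW|rewrite lerXn2r ?nnegrE ?divr_ge0// ltW].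
  have -> : L * (M / L) ^+ 3 = M ^+ 3 / L ^+ 2 by field; exact: lt0r_neq0.
  rewrite ltr_pdivrMr ?exprn_gt0// mulrC -ltr_pdivrMr//.
  by apply: lt_le_trans (_ : L <= _); [rewrite /L ltrDr|rewrite expr2 ler_peMr// ltW].
move=> /existsNP[x /negP]; rewrite -ltNge => far.
have := multi_bernstein_bounded m (fun u => hB (fun x => L * (2 * u x - 1))) (U01 v).
rewrite -/(H _) => b1; have b2 := hB v.
apply: le_trans (ler_normB _ _) _; apply: le_trans (lerD b2 b1) _.
have : M <= v x ^+ 2.
  rewrite -[leRHS](real_normK (num_real _)) expr2.
  by apply: le_trans (ltW far) _; rewrite ler_peMl//; apply: le_trans M1 (ltW far).
have : v x ^+ 2 <= \sum_x v x ^+ 2.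
  by rewrite (bigD1 x)//= lerDl; apply: sumr_ge0 => y _; exact: sqr_ge0.
move=> s1 s2; have : 2 * B / e <= \sum_x v x ^+ 2 by lra.
rewrite ler_pdivrMr//; nra.
Qed.

End TrigPolynomials.

(** * Normal densities *)

Section NormalIntegral.
Variable R : realType.
Notation mu := (@lebesgue_measure R).

Lemma ge0_integral_normal_prob (m s : R) (f : R -> \bar R) :
  (forall x, 0 <= f x)%E -> measurable_fun [set: R] f ->
  (\int[normal_prob m s]_x f x = \int[mu]_x (f x * (normal_pdf m s x)%:E))%E.
Proof.
move=> f0 mf; have dom := normal_prob_dominates m s.
rewrite -(Radon_Nikodym_SigmaFinite.change_of_variables dom)//.
apply: ae_eq_integral => //.
- apply: emeasurable_funM => //; apply: (measurable_int mu).
  exact: Radon_Nikodym_SigmaFinite.f_integrable.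
- apply: emeasurable_funM => //; apply/measurable_EFinP; exact: measurable_normal_pdf.
- apply: ae_eqe_mul2l; apply: integral_ae_eq => //.
  + exact: Radon_Nikodym_SigmaFinite.f_integrable.
  + apply/measurable_EFinP; exact: measurable_normal_pdf.
  + by move=> E _ mE; rewrite -Radon_Nikodym_SigmaFinite.f_integral.
Qed.

End NormalIntegral.

Section GaussianMoments.
Variable R : realType.
Notation mu := (@lebesgue_measure R).
Implicit Types (f F : R -> R) (x s u c : R).

Lemma has_derivative_FTC F f (a b : R) : a < b -> (forall x, has_derivative F x (f x)) ->
  continuous f -> (\int[mu]_(x in `[a, b]) (f x)%:E = (F b)%:E - (F a)%:E)%E.
Proof.
move=> ab dF cf; apply: continuous_FTC2 => //.
- exact: continuous_subspaceT.
- split.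
  + by move=> x _; case: (dF x).
  + apply: cvg_at_right_filter; exact: has_derivative_continuous (dF a).
  + apply: cvg_at_left_filter; exact: has_derivative_continuous (dF b).
- by move=> x _; rewrite derive1E; case: (dF x).
Qed.

(** The integrals over [-n, n] are F n - F (- n), of order 1 / n; dominated
    convergence passes to the limit. *)
Lemma integral_derivative0 F f (C : R) : (forall x, has_derivative F x (f x)) ->
  continuous f -> mu.-integrable [set: R] (EFin \o f) -> (forall x, `|x * F x| <= C) ->
  (\int[mu]_x (f x)%:E = 0)%E.
Proof.
move=> dF cf intf FC; have mf : measurable_fun [set: R] f by exact: continuous_measurable_fun.
have C0 : 0 <= C by apply: le_trans (FC 0).
pose D n := `[- (n.+1%:R : R), n.+1%:R]%classic.
pose fn n x := (f x * \1_(D n) x)%:E.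
have intfn n : (\int[mu]_x fn n x = (F n.+1%:R)%:E - (F (- n.+1%:R))%:E)%E.
  rewrite -(@has_derivative_FTC F f)//; last by apply: gtrN; rewrite ltr0n.
  rewrite [RHS]integral_mkcond; apply: eq_integral => x _.
  rewrite /fn patchE indicE; case: ifPn => xD; first by rewrite mulr1.
  by rewrite mulr0.
have mfn n : measurable_fun [set: R] (fn n).
  by apply/measurable_EFinP; apply: measurable_funM => //; apply: measurable_indic; exact: measurable_itv.
have cvfn : {ae mu, forall x, [set: R] x -> fn n x @[n --> \oo] --> (EFin \o f) x}.
  apply: aeW => x _; apply: cvg_near_cst; near=> n.
  suff xD : D n x by rewrite /fn indicE mem_set// mulr1.
  rewrite /D /= in_itv /= -ler_norml.
  apply: le_trans (_ : n%:R <= _); last by rewrite ler_nat.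
  by near: n; exact: nbhs_infty_ger.
have dom : {ae mu, forall x n, [set: R] x -> (`|fn n x| <= (abse \o (EFin \o f)) x)%E}.
  apply: aeW => x n _ /=; rewrite lee_fin normrM ler_piMr// indicE.
  by case: (_ \in _); rewrite ?normr1 ?normr0.
have mEf : measurable_fun [set: R] (EFin \o f) by exact/measurable_EFinP.
have [_ _ cv] := @dominated_convergence _ _ R mu setT measurableT fn (EFin \o f)
  (abse \o (EFin \o f)) mfn mEf cvfn (integrable_abse intf) dom.
have c0 : (fun n => \int[mu]_x fn n x)%E @ \oo --> (0 : \bar R)%E.
  under eq_fun do rewrite intfn -EFinB.
  apply: cvg_EFin; first by apply: nearW => n.
  apply/cvgr0Pnorm_le => e e0; near=> n; rewrite /=.
  have N0 : 0 < n.+1%:R :> R by rewrite ltr0n.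
  have b x : `|x| = n.+1%:R -> `|F x| <= C / n.+1%:R.
    by move=> xn; rewrite ler_pdivlMr// -xn mulrC -normrM.
  have b1 := b n.+1%:R (ger0_norm (ltW N0)).
  have b2 : `|F (- n.+1%:R)| <= C / n.+1%:R by apply: b; rewrite normrN ger0_norm.
  apply: le_trans (ler_normB _ _) _; apply: le_trans (lerD b1 b2) _.
  rewrite -mulrDl ler_pdivrMr// mulrC -ler_pdivrMr//.
  apply: le_trans (_ : n%:R <= _); last by rewrite ler_nat.
  by near: n; exact: nbhs_infty_ger.
exact: cvg_unique cv c0.
Unshelve. all: by end_near. Qed.

Variable s : R.
Hypothesis s0 : 0 < s.
Local Notation g := (normal_pdf 0 s).

Let sN0 : s != 0. Proof. exact: lt0r_neq0. Qed.

Lemma normal_pdf_centeredE x : g x = normal_peak s * expR (- (s ^+ 2 * 2)^-1 * (x * x)).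
Proof.
rewrite normal_pdfE// /normal_fun subr0; congr (_ * expR _).
by rewrite -(mulr_natr (s ^+ 2)); field; exact: lt0r_neq0.
Qed.

Lemma has_derivative_normal_pdf x : has_derivative g x (- (s ^+ 2)^-1 * (x * g x)).
Proof.
rewrite (funext normal_pdf_centeredE); apply: has_derivative_eq.
  apply: has_derivativeZ; apply: has_derivative_comp; first exact: is_derive_expR.
  apply: has_derivativeZ; exact: has_derivativeM (has_derivative_id x) (has_derivative_id x).
rewrite /=; field; exact: lt0r_neq0.
Qed.

(** A polynomial factor is absorbed by doubling the standard deviation;
    this yields integrability before any moment is computed. *)
Lemma normal_pdf_sqr_bound : exists2 C : R, 0 <= C & forall x, x ^+ 2 * g x <= C * normal_pdf 0 (2 * s) x.
Proof.
have s20 : 2 * s != 0 by rewrite mulf_neq0// pnatr_eq0.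
have p0 := normal_peak_gt0 s20; have q0 := normal_peak_gt0 sN0.
have ss0 : 0 < s ^+ 2 by rewrite exprn_gt0.
(* With y = x^2 / (2 s^2), this is y <= 4 / 3 exp (3 y / 4). *)
exists (s ^+ 2 * (8 / 3) * normal_peak s / normal_peak (2 * s)).
  by rewrite divr_ge0 ?mulr_ge0 ?sqr_ge0// ltW.
move=> x; rewrite normal_pdf_centeredE (normal_pdfE 0 s20) /normal_fun subr0.
set a := expR (- x ^+ 2 / _).
have -> : s ^+ 2 * (8 / 3) * normal_peak s / normal_peak (2 * s) * (normal_peak (2 * s) * a) =
   normal_peak s * (s ^+ 2 * (8 / 3) * a) by field; exact: lt0r_neq0.
rewrite mulrCA ler_pM2l//.
pose y := x ^+ 2 / (s ^+ 2 * 2).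
have xE : x ^+ 2 = s ^+ 2 * 2 * y by rewrite /y; field; exact: lt0r_neq0.
have aE : a = expR (- (y / 4)).
  rewrite /a /y -(mulr_natr _ 2) exprMn; congr expR; field; exact: lt0r_neq0.
have -> : expR (- (s ^+ 2 * 2)^-1 * (x * x)) = expR (- (y / 4)) * expR (- (3 / 4 * y)).
  by rewrite -expRD; congr expR; rewrite /y; field; exact: lt0r_neq0.
rewrite xE aE mulrCA [leRHS]mulrC; apply: ler_wpM2l; first exact: expR_ge0.
have : 1 + 3 / 4 * y <= expR (3 / 4 * y) by exact: expR_ge1Dx.
rewrite expRN ler_pdivrMr ?expR_gt0// => H.
apply: le_trans (_ : s ^+ 2 * (8 / 3) * (1 + 3 / 4 * y) <= _); first by have := ss0; nra.
by apply: ler_wpM2l => //; rewrite mulr_ge0 ?sqr_ge0.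
Qed.

Lemma normal_pdf_dominated F (M : R) : measurable_fun [set: R] F ->
  (forall x, `|F x| <= M * (1 + x ^+ 2) * g x) -> mu.-integrable [set: R] (EFin \o F).
Proof.
move=> mF FM; have [C C0 HC] := normal_pdf_sqr_bound.
have i1 := integrable_normal_pdf 0 s; have i2 := integrable_normal_pdf 0 (2 * s).
apply: (@le_integrable _ _ _ mu _ measurableT _
  (fun x => (`|M|)%:E * (normal_pdf 0 s x)%:E + (`|M| * C)%:E * (normal_pdf 0 (2 * s) x)%:E)%E).
- exact/measurable_EFinP.
- move=> x _; rewrite /= lee_fin; apply: le_trans (FM x) _.
  apply: le_trans (ler_norm _); rewrite -!mulrA -mulrDr.
  apply: le_trans (_ : `|M| * ((1 + x ^+ 2) * g x) <= _).
    by apply: ler_wpM2r (ler_norm _); rewrite mulr_ge0 ?addr_ge0 ?sqr_ge0 ?normal_pdf_ge0.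
  by apply: ler_wpM2l => //; rewrite mulrDl mul1r lerD2l.
- by apply: integrableD => //; exact: integrableZl.
Qed.

Lemma normal_pdf_weighted_bounded : exists C : R, forall x, (1 + x ^+ 2) * g x <= C.
Proof.
have [C C0 HC] := normal_pdf_sqr_bound.
have s20 : 2 * s != 0 by rewrite mulf_neq0// pnatr_eq0.
exists (normal_peak s + C * normal_peak (2 * s)) => x; rewrite mulrDl mul1r.
apply: lerD; first exact: normal_pdf_ub.
by apply: le_trans (HC x) _; apply: ler_wpM2l => //; exact: normal_pdf_ub.
Qed.

Lemma continuous_normal_pdf_centered : continuous g.
Proof. by move=> x; exact: has_derivative_continuous (has_derivative_normal_pdf x). Qed.

(** The derivative of x g x has integral 0. *)
Lemma normal_second_moment : (\int[mu]_x (x ^+ 2 * g x)%:E = (s ^+ 2)%:E)%E.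
Proof.
have [C HC] := normal_pdf_weighted_bounded.
have g2 x : 0 <= x ^+ 2 * g x by rewrite (mulr_ge0 (sqr_ge0 x))// normal_pdf_ge0.
have cg := continuous_normal_pdf_centered.
have mg : measurable_fun [set: R] g by exact: continuous_measurable_fun.
have mx2 : measurable_fun [set: R] (fun x : R => x ^+ 2 * g x).
  by apply: measurable_funM => //; exact: exprn_measurable.
have ss0 : 0 < s ^+ 2 by rewrite exprn_gt0.
have ig : mu.-integrable [set: R] (EFin \o g) by exact: integrable_normal_pdf.
have ix2 : mu.-integrable [set: R] (EFin \o (fun x : R => x ^+ 2 * g x)).
  apply: (@normal_pdf_dominated _ 1) => // x; rewrite ger0_norm//.
  by rewrite mul1r mulrDl mul1r lerDr normal_pdf_ge0.
pose f x := g x - (s ^+ 2)^-1 * (x ^+ 2 * g x).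
have dF x : has_derivative (fun x => x * g x) x (f x).
  apply: has_derivative_eq (has_derivativeM (has_derivative_id x) (has_derivative_normal_pdf x)) _.
  by rewrite /f; ring.
have cf : continuous f.
  move=> x; apply: cvgB; first exact: cg.
  apply: cvgMr; apply: cvgM; last exact: cg.
  exact: exprn_continuous.
have := @integral_derivative0 _ _ C dF cf.
have fE : EFin \o f = (fun x => (g x)%:E - ((s ^+ 2)^-1)%:E * (x ^+ 2 * g x)%:E)%E.
  by apply/funext => x; rewrite /f /= EFinB EFinM.
rewrite fE => H.
have i3 : mu.-integrable [set: R] (fun x => ((s ^+ 2)^-1)%:E * (x ^+ 2 * g x)%:E)%E.
  exact: integrableZl.
have : (\int[mu]_x (f x)%:E = 0)%E.
  apply: H; first exact: integrableB.
  move=> x; rewrite mulrA -expr2 ger0_norm//.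
  by apply: le_trans (HC x); rewrite mulrDl mul1r lerDr normal_pdf_ge0.
rewrite -[X in integral mu setT X]/(EFin \o f) fE integralB//= integralZl// integral_normal_pdf.
have : (\int[mu]_x (x ^+ 2 * g x)%:E)%E \is a fin_num by exact: integrable_fin_num.
move: (integral _ _ _) => [r| |]//= _.
rewrite -EFinD => -[] /eqP; rewrite subr_eq0 => /eqP E; congr EFin.
by rewrite -[LHS]mul1r -{1}(mulfV (lt0r_neq0 ss0)) -mulrA -E mulr1.
Qed.

(** Integrating the derivative of sin (v x + c) g x gives the equation Phi
    v = - s^2 v Phi for the derivative of the characteristic function. *)
Lemma normal_characteristic u c :
  (\int[mu]_x (cos (u * x + c) * g x)%:E = (cos c * expR (- (s ^+ 2 * u ^+ 2 / 2)))%:E)%E.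
Proof.
have [C HC] := normal_pdf_weighted_bounded.
have cg := continuous_normal_pdf_centered.
have mg : measurable_fun [set: R] g by exact: continuous_measurable_fun.
have ss0 : 0 < s ^+ 2 by rewrite exprn_gt0.
have g0 x : 0 <= g x by exact: normal_pdf_ge0.
have dlin v x : has_derivative (fun x => v * x + c) x v.
  apply: has_derivative_eq (has_derivativeD (has_derivativeZ v (has_derivative_id x)) (has_derivative_cst c x)) _.
  by ring.
have x1 x : `|x| <= 1 + x ^+ 2.
  by rewrite -(real_normK (num_real x)); have := sqr_ge0 (`|x| - 1); have := normr_ge0 x; nra.
pose f v x := cos (v * x + c) * g x.
pose k v x := x * (sin (v * x + c) * g x).
have dcos v x : has_derivative (fun x => cos (v * x + c)) x (- sin (v * x + c) * v).
  exact: has_derivative_comp (has_derivative_cos _) (dlin v x).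
have dsin v x : has_derivative (fun x => sin (v * x + c)) x (cos (v * x + c) * v).
  exact: has_derivative_comp (has_derivative_sin _) (dlin v x).
have mcos v : measurable_fun [set: R] (fun x : R => cos (v * x + c)).
  apply: continuous_measurable_fun => x; exact: has_derivative_continuous (dcos v x).
have msin v : measurable_fun [set: R] (fun x : R => sin (v * x + c)).
  apply: continuous_measurable_fun => x; exact: has_derivative_continuous (dsin v x).
have fi v : mu.-integrable [set: R] (EFin \o f v).
  apply: (@normal_pdf_dominated _ 1); first exact: measurable_funM.
  move=> x; rewrite normrM (ger0_norm (g0 x)) mul1r; apply: ler_wpM2r => //.
  by apply: le_trans (cos_max _) _; rewrite lerDl sqr_ge0.
have kb v x : `|k v x| <= 1 * (1 + x ^+ 2) * g x.
  rewrite !normrM (ger0_norm (g0 x)) mul1r mulrA; apply: ler_wpM2r => //.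
  by rewrite -[leRHS]mulr1; apply: ler_pM => //; exact: sin_max.
have ki v : mu.-integrable [set: R] (EFin \o k v).
  apply: (@normal_pdf_dominated _ 1) => //.
  by apply: measurable_funM => //; exact: measurable_funM.
have stein v : (\int[mu]_x k v x = s ^+ 2 * v * \int[mu]_x f v x)%R.
  pose F x := sin (v * x + c) * g x.
  pose F' x := v * f v x - (s ^+ 2)^-1 * k v x.
  have dF x : has_derivative F x (F' x).
    apply: has_derivative_eq (has_derivativeM (dsin v x) (has_derivative_normal_pdf x)) _.
    by rewrite /F' /f /k; ring.
  have cF' : continuous F'.
    move=> x; apply: cvgB; apply: cvgMr.
      apply: cvgM; last exact: cg.
      exact: has_derivative_continuous (dcos v x).
    apply: cvgM; first exact: cvg_id.
    apply: cvgM; last exact: cg.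
    exact: has_derivative_continuous (dsin v x).
  have F'E : EFin \o F' = (fun x => v%:E * (f v x)%:E - ((s ^+ 2)^-1)%:E * (k v x)%:E)%E.
    by apply/funext => x; rewrite /F' /= EFinB !EFinM.
  have i1 : mu.-integrable [set: R] (fun x => v%:E * (f v x)%:E)%E by apply: integrableZl => //; exact: fi.
  have i2 : mu.-integrable [set: R] (fun x => ((s ^+ 2)^-1)%:E * (k v x)%:E)%E by apply: integrableZl => //; exact: ki.
  have := @integral_derivative0 _ _ C dF cF'; rewrite F'E => /(_ (integrableB measurableT i1 i2)).
  have FC x : `|x * F x| <= C.
    by apply: le_trans (HC x); apply: le_trans (kb v x) _; rewrite mul1r.
  move=> /(_ FC); rewrite -[X in integral mu setT X]/(EFin \o F') F'E integralB//= !integralZl//; last exact: fi.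
  2: exact: ki.
  rewrite /Rintegral.
  have : (\int[mu]_x (k v x)%:E)%E \is a fin_num by exact: (integrable_fin_num measurableT (ki v)).
  have : (\int[mu]_x (f v x)%:E)%E \is a fin_num by exact: (integrable_fin_num measurableT (fi v)).
  move: (\int[mu]_x (f v x)%:E)%E (\int[mu]_x (k v x)%:E)%E => [a| |]//= [b| |]//= _ _.
  rewrite -EFinD => -[] /eqP; rewrite subr_eq0 => /eqP E.
  by rewrite -mulrA E mulVKf ?lt0r_neq0.
pose Phi v : R := \int[mu]_x f v x.
have df v x : has_derivative (f ^~ x) v (- k v x).
  have d1 : has_derivative (fun v => v * x + c) v x.
    apply: has_derivative_eq (has_derivativeD (has_derivativeM (has_derivative_id v) (has_derivative_cst x v)) (has_derivative_cst c v)) _.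
    by ring.
  apply: has_derivative_eq (has_derivativeM (has_derivative_comp (has_derivative_cos _) d1) (has_derivative_cst (g x) v)) _.
  by rewrite /k; ring.
have dPhi v : has_derivative Phi v (- (s ^+ 2 * v) * Phi v).
  pose G x := (1 + x ^+ 2) * g x.
  have mG : measurable_fun [set: R] G.
    apply: measurable_funM => //; apply: measurable_funD => //; exact: exprn_measurable.
  have GG x : 0 <= G x by rewrite mulr_ge0 ?addr_ge0 ?sqr_ge0.
  have iG : mu.-integrable [set: R] (EFin \o G).
    by apply: (@normal_pdf_dominated _ 1) => // x; rewrite ger0_norm// mul1r.
  have Iv : `]v - 1, v + 1[%classic v by rewrite /= in_itv /=; lra.
  have der w y : `]v - 1, v + 1[%classic w -> [set: R] y -> derivable (f ^~ y) w 1.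
    by move=> _ _; case: (df w y).
  have d1E w y : partial1of2 f w y = - k w y.
    by rewrite partial1of2E; case: (df w y).
  have Gub w y : `]v - 1, v + 1[%classic w -> [set: R] y -> `|partial1of2 f w y| <= G y.
    by move=> _ _; rewrite d1E normrN; apply: le_trans (kb w y) _; rewrite mul1r.
  have dd := @derivable_under_integral R _ _ mu f setT measurableT v (v - 1) (v + 1) Iv
    (fun w _ => fi w) der G GG iG Gub.
  have de := @differentiation_under_integral R _ _ mu f setT measurableT v (v - 1) (v + 1) Iv
    (fun w _ => fi w) der G GG iG Gub.
  split; first exact: dd.
  rewrite -derive1E; rewrite [LHS]de.
  under eq_Rintegral do rewrite d1E.
  transitivity (\int[mu]_x (-1 * k v x))%R.
    by apply: eq_Rintegral => x _; rewrite mulN1r.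
  by rewrite (RintegralZl _ measurableT (ki v)) stein mulN1r mulNr.
(* The integrating factor of the equation for Phi. *)
pose Psi v := expR (s ^+ 2 / 2 * (v * v)) * Phi v.
have dPsi v : has_derivative Psi v 0.
  have d1 : has_derivative (fun v => expR (s ^+ 2 / 2 * (v * v))) v
     (expR (s ^+ 2 / 2 * (v * v)) * (s ^+ 2 / 2 * (1 * v + v * 1))).
    apply: has_derivative_comp; first exact: is_derive_expR.
    apply: has_derivativeZ; exact: has_derivativeM (has_derivative_id v) (has_derivative_id v).
  by apply: has_derivative_eq (has_derivativeM d1 (dPhi v)) _; field.
have Phi0 : Phi 0 = cos c.
  rewrite /Phi /f; under eq_Rintegral do rewrite mul0r add0r.
  rewrite /Rintegral; under eq_integral do rewrite EFinM.
  rewrite integralZl//=; last exact: integrable_normal_pdf.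
  by rewrite integral_normal_pdf mule1.
have := has_derivative0_constant dPsi u; rewrite /Psi !mulr0 expR0 mul1r Phi0 => E.
have : (\int[mu]_x (f u x)%:E)%E \is a fin_num by exact: (integrable_fin_num measurableT (fi u)).
move=> fn; rewrite -[LHS](fineK fn); congr EFin; rewrite -[LHS]/(Phi u) -E mulrC.
have -> : s ^+ 2 * u ^+ 2 / 2 = s ^+ 2 / 2 * (u * u) by field.
by rewrite [RHS]mulrA -expRD addNr expR0 mul1r.
Qed.

End GaussianMoments.

(** * Expectations and characteristic functions *)

Section BoundedExpectation.
Context (R : realType) (d : measure_display) (Omega : measurableType d) (P : probability Omega R).
Implicit Types (f : Omega -> R) (B : R).

Lemma bounded_integrable f B : measurable_fun [set: Omega] f -> (forall w, `|f w| <= B) ->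
  P.-integrable [set: Omega] (EFin \o f).
Proof.
move=> mf fB; apply: measurable_bounded_integrable => //.
  exact: le_lt_trans (probability_le1 P measurableT) (ltry _).
exists B; split; first exact: num_real.
by move=> x Bx w _; apply: le_trans (ltW Bx).
Qed.

Lemma bounded_expectation f B : measurable_fun [set: Omega] f -> (forall w, `|f w| <= B) ->
  (\int[P]_w (f w)%:E = (\int[P]_w f w)%R%:E)%E.
Proof.
move=> mf fB; rewrite /Rintegral fineK//.
exact: integrable_fin_num (bounded_integrable mf fB).
Qed.

Variables (T : finType) (X : Omega -> T -> R).
Hypothesis mX : forall x, measurable_fun [set: Omega] (X ^~ x).

Lemma measurable_pairing (g : T -> R) : measurable_fun [set: Omega] (fun w => pairing (X w) g).
Proof. by apply: measurable_sum => x; apply: measurable_funM. Qed.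

Lemma measurable_wave (g : T -> R) (c : R) :
  measurable_fun [set: Omega] (fun w => cos (pairing (X w) g + c)).
Proof.
have mc : measurable_fun [set: R] (fun x : R => cos (x + c)).
  apply: continuous_measurable_fun => x.
  by apply: continuous_comp; [apply: cvgD; [exact: cvg_id|exact: cvg_cst]|exact: continuous_cos].
exact: (measurableT_comp mc (measurable_pairing g)).
Qed.

Lemma measurable_trig_poly F : trig_poly F -> measurable_fun [set: Omega] (F \o X).
Proof.
move=> [s ->]; apply: measurable_sum => p; apply: measurable_funM => //; exact: measurable_wave.
Qed.

Lemma expectation_trig_poly (s : seq (R * (T -> R) * R)) :
  (\int[P]_w \sum_(p <- s) p.1.1 * cos (pairing (X w) p.1.2 + p.2) =
   \sum_(p <- s) p.1.1 * \int[P]_w cos (pairing (X w) p.1.2 + p.2))%R.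
Proof.
have bd g c w : `|cos (pairing (X w) g + c)| <= 1 by exact: cos_max.
elim: s => [|p s IH].
  rewrite big_nil; under eq_Rintegral do rewrite big_nil.
  by rewrite Rintegral_cst// mul0r.
rewrite big_cons -IH -(@RintegralZl _ _ _ P); last 2 first.
- exact: measurableT.
- exact: bounded_integrable (measurable_wave _ _) (bd _ _).
under eq_Rintegral do rewrite big_cons.
rewrite (@RintegralD _ _ _ P)//.
- apply: (@bounded_integrable _ `|p.1.1|) => [|w]; first by apply: measurable_funM => //; exact: measurable_wave.
  by rewrite normrM ler_piMr.
- have tp : trig_poly (fun v : T -> R => \sum_(p <- s) p.1.1 * cos (pairing v p.1.2 + p.2)) by exists s.
  have [C HC] := trig_poly_bounded tp.
  exact: (@bounded_integrable _ C) (measurable_trig_poly tp) (fun w => HC (X w)).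
Qed.

Variables (h : {ptws T -> R} -> R) (B : R).
Hypothesis ch : continuous h.
Hypothesis hB : forall v, `|h v| <= B.

(** A continuous function is a pointwise limit of trigonometric
    polynomials, whose measurability only involves the coordinates. *)
Lemma measurable_continuous_ptws : measurable_fun [set: Omega] (fun w => h (X w)).
Proof.
have e0 k : 0 < k.+1%:R^-1 :> R by rewrite invr_gt0 ltr0n.
pose F k := projT1 (cid2 (trig_poly_approx ch hB (e0 k))).
have tF k : trig_poly (F k) by rewrite /F; case: cid2.
have HF k (v : T -> R) : `|h v - F k v| <= k.+1%:R^-1 * (1 + \sum_x v x ^+ 2) by rewrite /F; case: cid2.
apply: (@measurable_fun_cvg _ _ _ _ (fun k => F k \o X)); first by move=> k; exact: measurable_trig_poly.
move=> w _; apply/cvgrPdist_le => e epos; near=> k.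
apply: le_trans (HF k _) _; rewrite mulrC ler_pdivrMr ?ltr0n// mulrC -ler_pdivrMr//.
apply: le_trans (_ : k%:R <= _); last by rewrite ler_nat.
by near: k; exact: nbhs_infty_ger.
Unshelve. all: by end_near. Qed.

Lemma trig_poly_expectation_error (F : (T -> R) -> R) (e M : R) : trig_poly F ->
  (forall v : T -> R, `|h v - F v| <= e * (1 + \sum_x v x ^+ 2)) ->
  (\int[P]_w (\sum_x X w x ^+ 2)%:E <= M%:E)%E -> 0 <= e ->
  `|(\int[P]_w h (X w))%R - (\int[P]_w F (X w))%R| <= e * (1 + M).
Proof.
move=> tF HF HM e0; have [C HC] := trig_poly_bounded tF.
have mh := measurable_continuous_ptws; have mF := measurable_trig_poly tF.
have ih := bounded_integrable mh (fun w => hB (X w)).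
have iF := bounded_integrable mF (fun w => HC (X w)).
rewrite -(@RintegralB _ _ _ P)//.
have mD : measurable_fun [set: Omega] (fun w => h (X w) - F (X w)) by exact: measurable_funB.
have bD w : `|h (X w) - F (X w)| <= B + C.
  by apply: le_trans (ler_normB _ _) _; exact: lerD.
rewrite -lee_fin EFin_normr_Rintegral//; last exact: bounded_integrable mD bD.
apply: le_trans (le_abse_integral _ _ _) _ => //; first exact/measurable_EFinP.
have mS : measurable_fun [set: Omega] (fun w => \sum_x X w x ^+ 2).
  by apply: measurable_sum => x; exact: measurable_funX.
have S0 w : 0 <= \sum_x X w x ^+ 2 by apply: sumr_ge0 => x _; exact: sqr_ge0.
apply: le_trans (_ : \int[P]_w (e%:E * (1 + (\sum_x X w x ^+ 2)%:E)) <= _)%E.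
  apply: ge0_le_integral => //.
  - by apply: measurableT_comp => //; exact/measurable_EFinP.
  - by apply: emeasurable_funM => //; apply: emeasurable_funD => //; exact/measurable_EFinP.
  - by move=> w _; rewrite /= -EFinD -EFinM lee_fin; exact: HF.
rewrite ge0_integralZl_EFin//; first last.
- by apply: emeasurable_funD => //; exact/measurable_EFinP.
- by move=> w _; rewrite -EFinD lee_fin addr_ge0.
rewrite EFinM; apply: lee_wpmul2l => //.
rewrite ge0_integralD//; last exact/measurable_EFinP.
  2: by move=> w _; rewrite lee_fin.
rewrite integral_cst// mul1e EFinD.
by apply: leeD => //; exact: probability_le1.
Qed.

End BoundedExpectation.

Section CompareExpectations.
Context (R : realType) (T : finType).
Context (d1 d2 : measure_display) (O1 : measurableType d1) (O2 : measurableType d2).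
Variables (P1 : probability O1 R) (P2 : probability O2 R).
Variables (X1 : O1 -> T -> R) (X2 : O2 -> T -> R).
Hypothesis mX1 : forall x, measurable_fun [set: O1] (X1 ^~ x).
Hypothesis mX2 : forall x, measurable_fun [set: O2] (X2 ^~ x).
Variable M : R.
Hypothesis M1 : (\int[P1]_w (\sum_x X1 w x ^+ 2)%:E <= M%:E)%E.
Hypothesis M2 : (\int[P2]_w (\sum_x X2 w x ^+ 2)%:E <= M%:E)%E.
Variables (h : {ptws T -> R} -> R) (B : R).
Hypothesis ch : continuous h.
Hypothesis hB : forall v, `|h v| <= B.

(** The approximation error is integrated against the second moment, twice. *)
Lemma compare_expectations (s : seq (R * (T -> R) * R)) (e : R) : 0 <= e ->
  (forall v : T -> R, `|h v - \sum_(p <- s) p.1.1 * cos (pairing v p.1.2 + p.2)|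
     <= e * (1 + \sum_x v x ^+ 2)) ->
  `|(\int[P1]_w h (X1 w))%R - (\int[P2]_w h (X2 w))%R| <= 2 * (e * (1 + M)) +
   \sum_(p <- s) `|p.1.1| * `|(\int[P1]_w cos (pairing (X1 w) p.1.2 + p.2))%R
       - (\int[P2]_w cos (pairing (X2 w) p.1.2 + p.2))%R|.
Proof.
move=> e0 Hs; have tF : trig_poly (fun v => \sum_(p <- s) p.1.1 * cos (pairing v p.1.2 + p.2)) by exists s.
have := trig_poly_expectation_error mX1 ch hB tF Hs M1 e0.
have := trig_poly_expectation_error mX2 ch hB tF Hs M2 e0.
rewrite (expectation_trig_poly P1 mX1) (expectation_trig_poly P2 mX2).
set A1 := (\int[P1]_w h _)%R; set A2 := (\int[P2]_w h _)%R.
set S1 := \sum_(p <- s) _ * (\int[P1]_w _)%R; set S2 := \sum_(p <- s) _ * (\int[P2]_w _)%R => H2 H1.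
have HS : `|S1 - S2| <= \sum_(p <- s) `|p.1.1| * `|(\int[P1]_w cos (pairing (X1 w) p.1.2 + p.2))%R
       - (\int[P2]_w cos (pairing (X2 w) p.1.2 + p.2))%R|.
  rewrite -sumrB; apply: le_trans (ler_norm_sum _ _ _) _; apply: ler_sum => p _.
  by rewrite -mulrBr normrM.
have -> : A1 - A2 = (A1 - S1) + (S1 - S2) - (A2 - S2) by ring.
apply: le_trans (ler_normB _ _) _; apply: le_trans (lerD (ler_normD _ _) (lexx _)) _.
by move: HS H1 H2; lra.
Qed.

Lemma eq_expectations :
  (forall f c, (\int[P1]_w cos (pairing (X1 w) f + c) = \int[P2]_w cos (pairing (X2 w) f + c))%R) ->
  (\int[P1]_w h (X1 w) = \int[P2]_w h (X2 w))%R.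
Proof.
move=> E; apply/eqP; rewrite -subr_eq0 -normr_le0; apply/ler_addgt0Pr => e e0.
have M0 : 0 <= M.
  rewrite -lee_fin; apply: le_trans M1; apply: integral_ge0 => w _.
  by rewrite lee_fin; apply: sumr_ge0 => x _; exact: sqr_ge0.
have e'0 : 0 < e / (2 * (1 + M)) by rewrite divr_gt0// mulr_gt0// ltr_pwDl.
have [_ [s ->] Hs] := trig_poly_approx ch hB e'0.
apply: le_trans (compare_expectations (ltW e'0) Hs) _; rewrite add0r.
rewrite big1 ?addr0; last by move=> p _; rewrite E subrr normr0 mulr0.
have -> : 2 * (e / (2 * (1 + M)) * (1 + M)) = e; last exact: lexx.
by field; apply: lt0r_neq0; rewrite ltr_pwDl.
Qed.

End CompareExpectations.

Section CharacteristicFunction.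
Variable R : realType.
Notation RB := (measurableTypeR R).
Implicit Types P : probability RB R.

(** Continuous functions that decrease to the indicator of the half-line of
    the x >= a. *)
Definition cutoff (a : R) (n : nat) (x : R) : R := (1 + n%:R * (`|a - x| + (a - x)))^-1.

Lemma cutoff_den (a : R) n x : 1 <= 1 + n%:R * (`|a - x| + (a - x)).
Proof.
rewrite lerDl mulr_ge0// -(opprK (a - x)) subr_ge0 normrN; exact: ler_norm.
Qed.

Lemma cutoff_bound a n x : `|cutoff a n x| <= 1.
Proof.
have := cutoff_den a n x; rewrite /cutoff => H.
have H0 : 0 < 1 + n%:R * (`|a - x| + (a - x)) by apply: lt_le_trans H.
by rewrite normfV gtr0_norm// invf_le1.
Qed.

Lemma cutoff_continuous a n : continuous (cutoff a n).
Proof.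
move=> x; apply: cvgV.
  by apply: lt0r_neq0; apply: lt_le_trans (cutoff_den a n x).
have c1 : (fun y : R => a - y) @ x --> a - x by apply: cvgB; [exact: cvg_cst|exact: cvg_id].
apply: cvgD; first exact: cvg_cst.
by apply: cvgMr; apply: cvgD => //; exact: cvg_norm.
Qed.

Lemma cutoff_cvg (a x : R) : cutoff a n x @[n --> \oo] --> (\1_(`[a, +oo[%classic) x : R).
Proof.
rewrite indicE; have [ax|xa] := leP a x.
  rewrite mem_set/=; last by rewrite in_itv/= ax.
  have -> : (fun n => cutoff a n x) = fun=> 1.
    apply/funext => n; rewrite /cutoff ler0_norm ?subr_le0//.
    by rewrite addNr mulr0 addr0 invr1.
  exact: cvg_cst.
rewrite memNset/=; last by rewrite in_itv/= leNgt xa.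
have b0 : 0 < `|a - x| + (a - x) by rewrite gtr0_norm ?subr_gt0// addr_gt0// subr_gt0.
apply/cvgr0Pnorm_le => e e0; near=> n; rewrite /cutoff.
have H0 := lt_le_trans ltr01 (cutoff_den a n x).
rewrite normfV gtr0_norm// invf_ple ?posrE//.
apply: (@le_trans _ _ (n%:R * (`|a - x| + (a - x)))); last by rewrite lerDr.
rewrite -ler_pdivrMr//.
by near: n; exact: nbhs_infty_ger.
Unshelve. all: by end_near. Qed.

(** On the one-point space, trigonometric approximation shows that
    expectations of bounded continuous functions agree. Those of cutoffs
    converge to the masses of half-lines, which form a generating class
    stable under intersection. *)
Lemma characteristic_unique P1 P2 (M : R) :
  (\int[P1]_x (x ^+ 2)%:E <= M%:E)%E -> (\int[P2]_x (x ^+ 2)%:E <= M%:E)%E ->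
  (forall u c, (\int[P1]_x cos (u * x + c) = \int[P2]_x cos (u * x + c))%R) ->
  forall A, measurable A -> P1 A = P2 A.
Proof.
move=> M1 M2 E.
have pE (x : R) (f : unit -> R) : pairing (fun=> x) f = f tt * x.
  by rewrite /pairing (bigD1 tt)//= big1 ?addr0 1?mulrC// => -[].
have sE (x : R) : \sum_(i : unit) x ^+ 2 = x ^+ 2.
  by rewrite (bigD1 tt)//= big1 ?addr0// => -[].
have eqk (k : R -> R) : continuous k -> (forall x, `|k x| <= 1) ->
   (\int[P1]_x k x = \int[P2]_x k x)%R.
  move=> ck k1.
  have ch : continuous (fun v : {ptws unit -> R} => k (v tt)).
    move=> v; apply: (@continuous_comp _ _ _ (fun v : {ptws unit -> R} => v tt) k); last exact: ck.
    exact: (@proj_continuous unit (fun=> R) tt v).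
  apply: (@eq_expectations R unit _ _ RB RB P1 P2 (fun x _ => x) (fun x _ => x) _ _ M _ _ _ 1 ch).
  - by move=> x; exact: measurable_id.
  - by move=> x; exact: measurable_id.
  - by under eq_integral do rewrite sE.
  - by under eq_integral do rewrite sE.
  - by move=> v; exact: k1.
  - by move=> f c; under eq_Rintegral do rewrite pE; rewrite E; under [RHS]eq_Rintegral do rewrite pE.
have ray a : P1 `[a, +oo[%classic = P2 `[a, +oo[%classic.
  have mray : measurable (`[a, +oo[%classic : set RB) by exact: measurable_itv.
  have lim P : (\int[P]_x cutoff a n x)%R%:E @[n --> \oo] --> P `[a, +oo[%classic.
    have mc n : measurable_fun [set: RB] (cutoff a n).
      apply: continuous_measurable_fun; exact: cutoff_continuous.
    have ic n := bounded_integrable P (mc n) (cutoff_bound a n).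
    have mind : measurable_fun [set: RB] (EFin \o (\1_(`[a, +oo[%classic) : R -> R)).
      by apply/measurable_EFinP; exact: measurable_indic.
    have cv : {ae P, forall x, [set: RB] x -> (cutoff a n x)%:E @[n --> \oo] --> (EFin \o (\1_(`[a, +oo[%classic) : R -> R)) x}.
      by apply: aeW => x _; apply: cvg_EFin; [exact: nearW|exact: cutoff_cvg].
    have dom : {ae P, forall x n, [set: RB] x -> (`|(cutoff a n x)%:E| <= (EFin \o cst 1%R) x)%E}.
      by apply: aeW => x n _; rewrite /= lee_fin; exact: cutoff_bound.
    have [_ _] := @dominated_convergence _ RB R P setT measurableT (fun n => EFin \o cutoff a n)
      (EFin \o \1_(`[a, +oo[%classic)) (EFin \o cst 1%R)
      (fun n => measurable_int P (ic n)) mind cv (finite_measure_integrable_cst P 1 measurableT) dom.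
    rewrite integral_indic// setIT.
    apply: cvg_trans; apply: near_eq_cvg; apply: nearW => n.
    by rewrite -(bounded_expectation P (mc n) (cutoff_bound a n)).
  have E12 : (fun n => (\int[P1]_x cutoff a n x)%R%:E) = (fun n => (\int[P2]_x cutoff a n x)%R%:E).
    by apply/funext => n; congr EFin; apply: eqk; [exact: cutoff_continuous|exact: cutoff_bound].
  have := lim P1; rewrite E12 => L1; exact: (cvg_unique (@ereal_hausdorff R) L1 (lim P2)).
move=> A mA; apply: (@measure_unique _ R RB (@RGenCInfty.G R) (fun n => `[- n%:R, +oo[%classic)) => //.
- exact: RGenCInfty.measurableE.
- move=> _ _ [x ->] [y ->]; exists (Num.max x y).
  by apply/seteqP; split => z /=; rewrite !in_itv/= !andbT ge_max => /andP.
- by move=> i; exists (- i%:R).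
- apply/seteqP; split => // x _; exists (Num.trunc `|x|).+1 => //=.
  rewrite in_itv/= andbT lerNl; apply: le_trans (ler_norm _) _; rewrite normrN.
  by apply: ltW; exact: truncnS_gt.
- by move=> _ [x ->]; exact: ray.
- move=> k; apply: le_lt_trans (probability_le1 P1 _) (ltry _); exact: measurable_itv.
Qed.

End CharacteristicFunction.

Section CenteredNormal.
Variable R : realType.
Notation RB := (measurableTypeR R).
Implicit Types s u c : R.

Lemma measurable_cos_affine u c : measurable_fun [set: RB] (fun x : R => cos (u * x + c)).
Proof.
apply: continuous_measurable_fun => x; apply: continuous_comp; last exact: continuous_cos.
by apply: cvgD; [apply: cvgMr; exact: cvg_id|exact: cvg_cst].
Qed.

Lemma normal_prob_second_moment s : 0 < s ->
  (\int[normal_prob 0 s]_x (x ^+ 2)%:E = (s ^+ 2)%:E)%E.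
Proof.
move=> s0; rewrite ge0_integral_normal_prob.
- by rewrite -(normal_second_moment s0); apply: eq_integral => x _; rewrite EFinM.
- by move=> x; rewrite lee_fin sqr_ge0.
- apply/measurable_EFinP; exact: exprn_measurable.
Qed.

(** The change of density is available for nonnegative functions, hence the
    shift by 1. *)
Lemma normal_prob_characteristic s u c : 0 < s ->
  (\int[normal_prob 0 s]_x cos (u * x + c) = cos c * expR (- (s ^+ 2 * u ^+ 2 / 2)))%R.
Proof.
move=> s0; have mc := measurable_cos_affine u c.
have b1 x : `|cos (u * x + c)| <= 1 by exact: cos_max.
have cos1 (x : R) : (0 <= (cos (u * x + c) + 1)%:E)%E.
  rewrite lee_fin.
  by have := b1 x; rewrite ler_norml => /andP[] H _; rewrite -lerBlDr sub0r.
have mc1 : measurable_fun [set: R] (fun x : R => (cos (u * x + c) + 1)%:E).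
  by apply/measurable_EFinP; apply: measurable_funD.
have mpdf : measurable_fun [set: R] (normal_pdf 0 s) by exact: measurable_normal_pdf.
have ipdf := integrable_normal_pdf 0 s.
have icos : lebesgue_measure.-integrable [set: R] (EFin \o (fun x : R => cos (u * x + c) * normal_pdf 0 s x)).
  apply: (@normal_pdf_dominated _ _ s0 _ 1); first exact: measurable_funM.
  move=> x; rewrite normrM (ger0_norm (normal_pdf_ge0 _ _ _)) mul1r ler_wpM2r ?normal_pdf_ge0//.
  by apply: le_trans (b1 x) _; rewrite lerDl sqr_ge0.
have L : (\int[normal_prob 0 s]_x (cos (u * x + c) + 1)%:E =
    (\int[normal_prob 0 s]_x cos (u * x + c))%R%:E + 1)%E.
  under eq_integral do rewrite EFinD.
  rewrite integralD//; last 2 first.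
  - exact: (bounded_integrable (normal_prob 0 s) mc b1).
  - exact: (finite_measure_integrable_cst (normal_prob 0 s) 1 measurableT).
  rewrite (bounded_expectation (normal_prob 0 s) mc b1); congr (_ + _)%E.
  by rewrite integral_cst// mul1e; exact: (probability_setT (normal_prob 0 s)).
have := ge0_integral_normal_prob 0 s cos1 mc1; rewrite L.
under eq_integral do rewrite -EFinM mulrDl mul1r EFinD.
rewrite integralD// normal_characteristic// integral_normal_pdf -!EFinD => -[].
exact: addIr.
Qed.

(** The two laws have the same characteristic function; for s = 0 it is
    that of the Dirac mass. *)
Lemma centered_normal_law (d : measure_display) (Omega : measurableType d)
    (Pr : probability Omega R) (X : {RV Pr >-> R}) s : 0 <= s ->
  (\int[Pr]_w (X w ^+ 2)%:E < +oo)%E ->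
  (forall u c, (\int[Pr]_w cos (u * X w + c) = cos c * expR (- (s ^+ 2 * u ^+ 2 / 2)))%R) ->
  forall A, measurable A -> Pr (X @^-1` A) = centered_normal s A.
Proof.
move=> s0 X2 Xc; rewrite /centered_normal.
have mX : measurable_fun [set: Omega] (X : Omega -> RB).
  by move=> mD Y mY; exact: (@measurable_funP _ _ _ _ setT X mD Y mY).
pose X' : {mfun Omega >-> RB} := HB.pack (X : Omega -> RB) (isMeasurableFun.Build _ _ _ _ _ mX).
pose P1 : probability RB R := distribution Pr X'.
have mx2 : measurable_fun [set: RB] (fun x : R => (x ^+ 2)%:E).
  by apply/measurable_EFinP; exact: exprn_measurable.
have m1 : (\int[P1]_x (x ^+ 2)%:E = \int[Pr]_w (X w ^+ 2)%:E)%E.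
  by rewrite [LHS]ge0_integral_distribution// => y; rewrite lee_fin sqr_ge0.
have c1 u c : (\int[P1]_x cos (u * x + c) = \int[Pr]_w cos (u * X w + c))%R.
  rewrite /Rintegral [X in fine X]integral_distribution//.
    by apply/measurable_EFinP; exact: measurable_cos_affine.
  apply: (@bounded_integrable _ _ _ Pr (fun w => cos (u * X w + c)) 1) => [|w]; last exact: cos_max.
  exact: (measurableT_comp (measurable_cos_affine u c) (measurable_funP X)).
pose M := fine (\int[Pr]_w (X w ^+ 2)%:E)%E.
have ME : (\int[Pr]_w (X w ^+ 2)%:E = M%:E)%E.
  rewrite fineK// ge0_fin_numE//; apply: integral_ge0 => w _; by rewrite lee_fin sqr_ge0.
have M0 : 0 <= M by rewrite fine_ge0//; apply: integral_ge0 => w _; by rewrite lee_fin sqr_ge0.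
case: eqP => [sz|/eqP sn].
  apply: (@characteristic_unique R P1 (@dirac _ RB (0:R) R) M).
  - by rewrite m1 ME.
  - by rewrite integral_dirac// diracE mem_set// mul1e expr0n.
  - move=> u c; rewrite c1 Xc sz expr0n/= mul0r mul0r oppr0 expR0 mulr1.
    rewrite /Rintegral integral_dirac//; last by apply/measurable_EFinP; exact: measurable_cos_affine.
    by rewrite diracE mem_set// mul1e /= mulr0 add0r.
have sp : 0 < s by rewrite lt0r sn.
apply: (@characteristic_unique R P1 (normal_prob 0 s) (M + s ^+ 2)).
- by rewrite m1 ME lee_fin lerDl sqr_ge0.
- by rewrite normal_prob_second_moment// lee_fin lerDr.
- by move=> u c; rewrite c1 Xc normal_prob_characteristic.
Qed.

End CenteredNormal.

(** * Gaussian random measures *)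

Section Cholesky.
Variables (R : realType) (T : finType).
Implicit Types (S : T -> T -> R) (f : T -> R).

Lemma bilinear_form_shift S f x (t : R) : (forall y z, S y z = S z y) ->
  bilinear_form S (fun y => t * (y == x)%:R + f y) (fun y => t * (y == x)%:R + f y) =
  bilinear_form S f f + 2 * t * (\sum_y S y x * f y) + t ^+ 2 * S x x.
Proof.
move=> sym; rewrite bilinear_form_linearl !bilinear_form_linearr.
have dl g : bilinear_form S (fun y => (y == x)%:R) g = \sum_y S y x * g y.
  rewrite /bilinear_form (bigD1 x)//= [X in _ + X]big1 ?addr0; last first.
    by move=> y /negbTE ->; apply: big1 => z _; rewrite mulr0 mul0r.
  by apply: eq_bigr => y _; rewrite eqxx mulr1 sym.
have -> : bilinear_form S f (fun y => (y == x)%:R) = \sum_y S y x * f y.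
  apply: eq_bigr => y _; rewrite (bigD1 x)//= big1 ?addr0; last first.
    by move=> z /negbTE ->; rewrite mulr0.
  by rewrite eqxx mulr1.
rewrite !dl (bigD1 x (P := xpredT) (F := fun y => S y x * (y == x)%:R))//= eqxx mulr1 big1 ?addr0; last first.
  by move=> y /negbTE ->; rewrite mulr0.
by ring.
Qed.

(** Completing the square in one coordinate at a time. *)
Lemma sum_of_squares S : (forall y z, S y z = S z y) -> (forall f, 0 <= bilinear_form S f f) ->
  exists s : seq (T -> R), forall f, bilinear_form S f f = \sum_(a <- s) pairing a f ^+ 2.
Proof.
have : forall x, x \notin enum T -> forall y, S x y = 0 by move=> x; rewrite mem_enum.
elim: (enum T) S => [|x l IH] S supp sym psd.
  exists [::] => f; rewrite big_nil; apply: big1 => x _; apply: big1 => y _.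
  by rewrite supp// !mul0r.
have Sx_ge0 : 0 <= S x x.
  have := psd (fun y => 1 * (y == x)%:R + 0); rewrite (bilinear_form_shift (fun=> 0))//.
  rewrite /bilinear_form big1 => [|y _]; last by apply: big1 => z _; rewrite mulr0.
  by rewrite big1 => [|y _]; [rewrite !(mulr0, add0r) expr1n mul1r|rewrite mulr0].
have [Sx0|Sxn] := eqVneq (S x x) 0.
  (* A zero on the diagonal of a nonnegative form forces a zero row:
     otherwise the form takes the value - 1 at a suitable combination of x
     and y. *)
  have row0 y : S x y = 0.
    have dsum : \sum_z S z x * (z == y)%:R = S x y.
      rewrite (bigD1 y)//= eqxx mulr1 big1 ?addr0 1?sym// => z /negbTE ->.
      by rewrite mulr0.
    apply/eqP; apply/negPn/negP => n0.
    have := psd (fun z => (- (bilinear_form S (fun z => (z == y)%:R) (fun z => (z == y)%:R) + 1) / (2 * S x y)) * (z == x)%:R + (z == y)%:R).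
    rewrite bilinear_form_shift// dsum Sx0 mulr0 addr0.
    set b := bilinear_form _ _ _.
    have -> : b + 2 * (- (b + 1) / (2 * S x y)) * S x y = -1 by field.
    by rewrite oppr_ge0 ler10.
  apply: IH => // y yl z; have [->|yx] := eqVneq y x; first exact: row0.
  by apply: supp; rewrite inE negb_or yx.
have Sx0 : 0 < S x x by rewrite lt0r Sxn.
pose S' y z := S y z - S y x * S z x / S x x.
have sqE f : pairing (fun y => S y x / Num.sqrt (S x x)) f ^+ 2 = (\sum_y S y x * f y) ^+ 2 / S x x.
  rewrite /pairing -{2}(sqr_sqrtr Sx_ge0) -expr_div_n; congr (_ ^+ 2).
  by rewrite mulr_suml; apply: eq_bigr => y _; rewrite mulrAC.
have S'E f : bilinear_form S f f = bilinear_form S' f f + pairing (fun y => S y x / Num.sqrt (S x x)) f ^+ 2.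
  rewrite sqE expr2 [X in _ + X / _]mulr_suml [X in _ + X]mulr_suml /bilinear_form -big_split.
  apply: eq_bigr => y _ /=; rewrite mulr_sumr mulr_suml -big_split; apply: eq_bigr => z _ /=.
  by rewrite /S'; ring.
have [s Hs] : exists s : seq (T -> R), forall f, bilinear_form S' f f = \sum_(a <- s) pairing a f ^+ 2.
  apply: IH.
  - move=> y yl z; rewrite /S'; have [->|yx] := eqVneq y x.
      by rewrite (sym x z); field.
    have Sy0 w : S y w = 0 by apply: supp; rewrite inE negb_or yx.
    by rewrite !Sy0 !mul0r subr0.
  - by move=> y z; rewrite /S' sym (mulrC (S y x)).
  - move=> f; have := psd (fun y => - (\sum_y S y x * f y) / S x x * (y == x)%:R + f y).
    rewrite bilinear_form_shift// S'E sqE.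
    set L := \sum_y _; set b := bilinear_form _ _ _.
    by have -> : b + L ^+ 2 / S x x + 2 * (- L / S x x) * L + (- L / S x x) ^+ 2 * S x x = b by field.
exists ((fun y => S y x / Num.sqrt (S x x)) :: s) => f.
by rewrite big_cons S'E Hs addrC.
Qed.

End Cholesky.

Section GaussianVector.
Variables (R : realType) (T : finType).
Notation RB := (measurableTypeR R).
Local Notation N01 := (normal_prob (0 : R) 1 : probability RB R).

Lemma normal_wave (b c : R) :
  (\int[N01]_z (cos (b * z + c))%:E = (cos c * expR (- (b ^+ 2 / 2)))%:E)%E.
Proof.
rewrite (@bounded_expectation _ _ RB N01 (fun z : R => cos (b * z + c)) 1).
- by rewrite normal_prob_characteristic// expr1n mul1r.
- exact: measurable_cos_affine.
- by move=> z; exact: cos_max.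
Qed.

(** One independent standard normal variable is adjoined for each square in
    the covariance. *)
Lemma exists_gaussian_field (s : seq (T -> R)) :
  exists (d : measure_display) (Omega : measurableType d) (P : probability Omega R) (X : Omega -> T -> R),
  [/\ forall x, measurable_fun [set: Omega] (X ^~ x),
      (\int[P]_w (\sum_x X w x ^+ 2)%:E < +oo)%E &
      forall f c, (\int[P]_w (cos (pairing (X w) f + c))%:E =
        (cos c * expR (- (\sum_(a <- s) pairing a f ^+ 2 / 2)))%:E)%E].
Proof.
have NT : normal_prob (0 : R) 1 [set: RB] = 1%E := probability_setT N01.
elim: s => [|a s [d [W [P [X [mX X2 HX]]]]]].
  exists _, RB, N01, (fun _ _ => 0); split.
  - by move=> x; exact: measurable_cst.
  - rewrite (eq_integral (cst 0%:E)); first by rewrite integral_cst// mul0e ltry.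
    by move=> w _; rewrite big1// => x _; rewrite expr0n.
  - move=> f c; rewrite big_nil oppr0 expR0 mulr1 (eq_integral (cst (cos c)%:E)).
      by rewrite integral_cst//; rewrite [X in (_ * X)%E](_ : _ = 1%E) ?mule1//; exact: NT.
    by move=> w _; rewrite /pairing big1 ?add0r// => x _; rewrite mul0r.
pose Q : probability (W * RB)%type R := (P \x N01)%E.
pose Y (w : W * RB) x := X w.1 x + a x * w.2.
have mY x : measurable_fun [set: (W * RB)%type] (Y ^~ x).
  apply: measurable_funD; first exact: (measurableT_comp (mX x) measurable_fst).
  by apply: measurable_funM; [exact: measurable_cst|exact: measurable_snd].
exists _, (W * RB)%type, Q, Y; split => //.
  have mY2 : measurable_fun [set: (W * RB)%type] (fun w => (\sum_x Y w x ^+ 2)%:E).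
    by apply/measurable_EFinP; apply: measurable_sum => x; exact: measurable_funX.
  rewrite fubini_tonelli1//; last by move=> w; rewrite lee_fin; apply: sumr_ge0 => x _; exact: sqr_ge0.
  have mS : measurable_fun [set: W] (fun w => (\sum_x X w x ^+ 2)%:E).
    by apply/measurable_EFinP; apply: measurable_sum => x; exact: measurable_funX.
  have S0 w : (0 <= (\sum_x X w x ^+ 2)%:E)%E by rewrite lee_fin; apply: sumr_ge0 => x _; exact: sqr_ge0.
  pose A := \sum_x a x ^+ 2.
  have A0 : 0 <= A by apply: sumr_ge0 => x _; exact: sqr_ge0.
  apply: (@le_lt_trans _ _ (\int[P]_w (2%:E * (\sum_x X w x ^+ 2)%:E + (2 * A)%:E))%E).
    apply: ge0_le_integral => //.
    - by move=> w _; apply: integral_ge0 => z _; rewrite lee_fin; apply: sumr_ge0 => x _; exact: sqr_ge0.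
    - apply: measurable_fun_fubini_tonelli_F => //.
      by move=> w; rewrite lee_fin; apply: sumr_ge0 => x _; exact: sqr_ge0.
    - by apply: emeasurable_funD => //; exact: emeasurable_funM.
    - move=> w _; rewrite /fubini_F.
      apply: (@le_trans _ _ (\int[N01]_z ((2 * \sum_x X w x ^+ 2)%:E + (2 * A)%:E * (z ^+ 2)%:E))%E).
        apply: ge0_le_integral => //.
        + by move=> z _; rewrite lee_fin; apply: sumr_ge0 => x _; exact: sqr_ge0.
        + exact: (measurableT_comp mY2 (measurable_pair1 w)).
        + apply: emeasurable_funD => //; apply: emeasurable_funM => //.
          by apply/measurable_EFinP; exact: exprn_measurable.
        + move=> z _; rewrite -EFinM -EFinD lee_fin /A -mulrA mulr_suml -mulrDr -big_split mulr_sumr.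
          apply: ler_sum => x _; rewrite /Y /=.
          by rewrite -subr_ge0; have := sqr_ge0 (X w x - a x * z); nra.
      rewrite ge0_integralD//.
      + rewrite integral_cst// ge0_integralZl_EFin//; first last.
        * by rewrite mulr_ge0.
        * by apply/measurable_EFinP; exact: exprn_measurable.
        * by move=> z _; rewrite lee_fin sqr_ge0.
        rewrite normal_prob_second_moment// expr1n mule1 EFinM.
        apply: leeD => //; rewrite -[leRHS]mule1; apply: lee_wpmul2l; first by rewrite mule_ge0.
        exact: (probability_le1 N01 measurableT).
      + by move=> z _; rewrite lee_fin mulr_ge0// -lee_fin.
      + by move=> z _; rewrite -EFinM lee_fin mulr_ge0 ?sqr_ge0// mulr_ge0.
      + apply: emeasurable_funM => //.
        by apply/measurable_EFinP; exact: exprn_measurable.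
  rewrite ge0_integralD//; last 3 first.
  - by move=> w _; rewrite mule_ge0.
  - exact: emeasurable_funM.
  - by move=> w _; rewrite lee_fin mulr_ge0.
  rewrite ge0_integralZl_EFin// integral_cst//; apply: lte_add_pinfty.
    by apply: lte_mul_pinfty.
  by apply: lte_mul_pinfty => //; [rewrite lee_fin mulr_ge0|exact: le_lt_trans (probability_le1 P measurableT) (ltry _)].
move=> f c; have mwave := measurable_wave mY f c.
rewrite -(@integral12_prod_meas1 _ _ _ _ _ P N01); last exact: (bounded_integrable Q mwave (fun w => cos_max _)).
under eq_integral.
  move=> w _; rewrite /fubini_F.
  have E z : pairing (Y (w, z)) f + c = pairing a f * z + (pairing (X w) f + c).
    rewrite addrA; congr (_ + _); rewrite /pairing mulr_suml -big_split; apply: eq_bigr => x _ /=.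
    by rewrite /Y /=; ring.
  under eq_integral do rewrite E.
  rewrite normal_wave mulrC EFinM; over.
rewrite integralZl//; last exact: (bounded_integrable P (measurable_wave mX f c) (fun w => cos_max _)).
rewrite HX -EFinM big_cons opprD expRD; congr EFin; ring.
Qed.

End GaussianVector.

Section GaussianRandomMeasure.
Variables (R : realType) (T : finType).
Notation RB := (measurableTypeR R).

Lemma centered_normal_second_moment (d : measure_display) (Omega : measurableType d)
    (Pr : probability Omega R) (X : {RV Pr >-> R}) (s : R) : 0 <= s ->
  (forall A, measurable A -> Pr (X @^-1` A) = centered_normal s A) ->
  (\int[Pr]_w (X w ^+ 2)%:E = (s ^+ 2)%:E)%E.
Proof.
move=> s0 law.
have mX : measurable_fun [set: Omega] (X : Omega -> RB).
  by move=> mD Y mY; exact: (@measurable_funP _ _ _ _ setT X mD Y mY).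
pose X' : {mfun Omega >-> RB} := HB.pack (X : Omega -> RB) (isMeasurableFun.Build _ _ _ _ _ mX).
pose P1 : probability RB R := distribution Pr X'.
have mx2 : measurable_fun [set: RB] (fun x : R => (x ^+ 2)%:E).
  by apply/measurable_EFinP; exact: exprn_measurable.
have <- : (\int[P1]_x (x ^+ 2)%:E = \int[Pr]_w (X w ^+ 2)%:E)%E.
  by rewrite [LHS]ge0_integral_distribution// => y; rewrite lee_fin sqr_ge0.
have law1 A : measurable A -> P1 A = centered_normal s A by exact: law.
move: law1; rewrite /centered_normal; case: eqP => [->|/eqP sn] law1.
  rewrite (eq_measure_integral (@dirac _ RB (0:R) R)) => [|A mA _]; last exact: law1.
  by rewrite integral_dirac// diracE mem_set// mul1e expr0n.
have sp : 0 < s by rewrite lt0r sn.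
rewrite (eq_measure_integral (normal_prob 0 s)) => [|A mA _]; last exact: law1.
exact: normal_prob_second_moment.
Qed.

(** A form of the Cauchy-Schwarz inequality that avoids the case f = 0:
    expand the sum of the squares of (1 + C) v x - p f x. *)
Lemma pairing_sqr_le (v f : T -> R) :
  pairing v f ^+ 2 <= (1 + \sum_x f x ^+ 2) ^+ 2 * \sum_x v x ^+ 2.
Proof.
set C := \sum_x f x ^+ 2; set A := \sum_x v x ^+ 2; set p := pairing v f.
have C0 : 0 <= C by apply: sumr_ge0 => x _; exact: sqr_ge0.
have : 0 <= \sum_x ((1 + C) * v x - p * f x) ^+ 2 by apply: sumr_ge0 => x _; exact: sqr_ge0.
have -> : \sum_x ((1 + C) * v x - p * f x) ^+ 2 = (1 + C) ^+ 2 * A - 2 * (1 + C) * p * p + p ^+ 2 * C.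
  have E x : ((1 + C) * v x - p * f x) ^+ 2 =
      (1 + C) ^+ 2 * v x ^+ 2 - 2 * (1 + C) * p * (v x * f x) + p ^+ 2 * f x ^+ 2 by ring.
  by rewrite (eq_bigr _ (fun x _ => E x)) big_split sumrB/= -!mulr_sumr.
by have := sqr_ge0 p; nra.
Qed.

(** Every pairing of the field has the characteristic function of a
    centered normal law. *)
Lemma exists_gaussian (s : seq (T -> R)) :
  exists (d : measure_display) (Omega : measurableType d) (P : probability Omega R)
    (xi : T -> {RV P >-> R}),
  [/\ centered_gaussian xi,
      forall f, ('E_P[(fun w => pairing (fun x => xi x w) f ^+ 2)%R] =
        (\sum_(a <- s) pairing a f ^+ 2)%:E)%E,
      (\int[P]_w (\sum_x xi x w ^+ 2)%:E < +oo)%E &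
      forall f c, (\int[P]_w cos (pairing (fun x => xi x w) f + c) =
        cos c * expR (- (\sum_(a <- s) pairing a f ^+ 2 / 2)))%R].
Proof.
have [d [W [P [X [mX X2 HX]]]]] := exists_gaussian_field s.
pose xi x : {RV P >-> R} := HB.pack (X ^~ x) (isMeasurableFun.Build _ _ _ _ _ (mX x)).
have Hc f c : (\int[P]_w cos (pairing (X w) f + c) =
    cos c * expR (- (\sum_(a <- s) pairing a f ^+ 2 / 2)))%R by rewrite /Rintegral HX.
pose Q f : R := \sum_(a <- s) pairing a f ^+ 2.
have Q0 f : 0 <= Q f by apply: sumr_ge0 => a _; exact: sqr_ge0.
have Qhalf f : \sum_(a <- s) pairing a f ^+ 2 / 2 = Q f / 2 by rewrite mulr_suml.
have mS : measurable_fun [set: W] (fun w => (\sum_x X w x ^+ 2)%:E).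
  by apply/measurable_EFinP; apply: measurable_sum => x; exact: measurable_funX.
have S0 w : (0 <= (\sum_x X w x ^+ 2)%:E)%E by rewrite lee_fin; apply: sumr_ge0 => x _; exact: sqr_ge0.
pose Y f : {RV P >-> R} := HB.pack (fun w => pairing (X w) f) (isMeasurableFun.Build _ _ _ _ _ (measurable_pairing mX f)).
have Y2 f : (\int[P]_w (Y f w ^+ 2)%:E < +oo)%E.
  pose C := \sum_x f x ^+ 2.
  have C0 : 0 <= C by apply: sumr_ge0 => x _; exact: sqr_ge0.
  have mC : measurable_fun [set: W] (fun w => ((1 + C) ^+ 2)%:E * (\sum_x X w x ^+ 2)%:E)%E.
    by apply: emeasurable_funM.
  apply: (@le_lt_trans _ _ (\int[P]_w (((1 + C) ^+ 2)%:E * (\sum_x X w x ^+ 2)%:E))%E); last first.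
    rewrite ge0_integralZl_EFin//; last exact: sqr_ge0.
    by apply: lte_mul_pinfty => //; rewrite lee_fin sqr_ge0.
  apply: ge0_le_integral => //.
  - by move=> w _; rewrite lee_fin sqr_ge0.
  - by apply/measurable_EFinP; apply: measurable_funX; exact: measurable_pairing.
  - by move=> w _; rewrite -EFinM lee_fin; exact: pairing_sqr_le.
have law f A : measurable A -> P [set w | A (pairing (X w) f)] = centered_normal (Num.sqrt (Q f)) A.
  apply: (@centered_normal_law R d W P (Y f) _ (sqrtr_ge0 _) (Y2 f)) => u c.
  have E w : u * Y f w = pairing (X w) (fun x => u * f x).
    by rewrite /Y /= /pairing mulr_sumr; apply: eq_bigr => x _; ring.
  under eq_Rintegral do rewrite E.
  rewrite Hc; congr (_ * expR (- _)); rewrite Qhalf sqr_sqrtr//; congr (_ / 2).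
  rewrite /Q mulr_suml; apply: eq_bigr => a _.
  have -> : pairing a (fun x => u * f x) = u * pairing a f.
    by rewrite /pairing mulr_sumr; apply: eq_bigr => x _; ring.
  by ring.
exists d, W, P, xi; split => //.
- by move=> f; exists (Num.sqrt (Q f)); [exact: sqrtr_ge0|exact: law].
- move=> f; rewrite unlock.
  have := @centered_normal_second_moment _ _ P (Y f) _ (sqrtr_ge0 (Q f)) (law f).
  by rewrite sqr_sqrtr.
Qed.

End GaussianRandomMeasure.

(** * The fluctuation field of the particle system *)

Section Quasistationary.
Variables (R : realType) (T : finType) (K : T -> T -> R) (rho : T -> R).
Local Notation Q := (op_exp (kop (killed_generator K))).
Hypothesis rho1 : \sum_x rho x = 1.
Hypothesis qsd : forall (t : R), 0 <= t -> forall A : {set T},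
  pairing rho (Q t (indicator R A)) / pairing rho (Q t (fun=> 1)) = \sum_(x in A) rho x.

(** The defining identity is multiplied by its denominator, which does not
    vanish because the conditional law has mass 1, and differentiated at
    time 0. *)
Lemma quasistationary_eigenmeasure y :
  \sum_x rho x * K x y = pairing rho (kop K (fun=> 1)) * rho y.
Proof.
have dpair f : has_derivative (fun t => pairing rho (Q t f)) 0
    (pairing rho (fun x => kop K f x - f x)).
  apply: has_derivative_sum => x; apply: has_derivativeZ.
  apply: has_derivative_eq (has_derivative_kop_exp _ _ _ _) _.
  rewrite kop_killed_generator/= /kop (op_exp0 (kop (killed_generator K)) f x).
  by congr (_ - _); apply: eq_bigr => z _; rewrite op_exp0.
have v0 t : 0 <= t -> pairing rho (Q t (fun=> 1)) != 0.
  move=> t0; apply/eqP => E; have := qsd t0 [set: T]%SET.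
  rewrite E invr0 mulr0; under eq_bigl do rewrite finset.in_setT.
  by rewrite rho1 => /esym/eqP; rewrite oner_eq0.
pose F t := pairing rho (Q t (indicator R [set y])) + - rho y * pairing rho (Q t (fun=> 1)).
have Fz t : 0 <= t -> F t = 0.
  move=> t0; have := qsd t0 [set y]; rewrite big_set1 /F => <-.
  by field; exact: v0.
have := right_constant_derivative (has_derivativeD (dpair (indicator R [set y])) (has_derivativeZ (- rho y) (dpair (fun=> 1)))).
have iE x : indicator R [set y] x = (x == y)%:R by rewrite /indicator finset.in_set1.
have s1 g : pairing rho (fun x => g x - 1) = pairing rho g - 1.
  by rewrite /pairing -{2}rho1 -sumrB; apply: eq_bigr => x _; rewrite mulrBr mulr1.
have s2 : pairing rho (fun x => kop K (indicator R [set y]) x - indicator R [set y] x) =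
    \sum_x rho x * K x y - rho y.
  have -> : rho y = \sum_x rho x * (x == y)%:R.
    by rewrite (bigD1 y)//= eqxx mulr1 big1 ?addr0// => x /negbTE ->; rewrite mulr0.
  rewrite /pairing -sumrB; apply: eq_bigr => x _; rewrite iE mulrBr /kop; congr (_ * _ - _).
  rewrite (bigD1 y)//= iE eqxx mulr1 big1 ?addr0// => z zy; by rewrite iE (negbTE zy) mulr0.
rewrite s1 s2 => H.
have /H : forall t : R, 0 <= t -> F t = F 0 by move=> t t0; rewrite !Fz.
by move=> E; apply/subr0_eq; rewrite -[RHS]E; ring.
Qed.

End Quasistationary.

Section FinitelySupportedLaw.
Context (R : realType) (T : finType) (d : measure_display) (Omega : measurableType d).
Variables (P : probability Omega R) (eta : Omega -> T -> R).
Hypothesis meta : forall x, measurable_fun [set: Omega] (eta ^~ x).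
Variables (s : seq (T -> R)) (mu : (T -> R) -> R).
Hypothesis us : uniq s.
Hypothesis mass1 : mean s mu (fun=> 1) = 1.
Hypothesis law : forall e, e \in s -> P [set w | eta w = e] = (mu e)%:E.
Implicit Types phi : (T -> R) -> R.

Local Notation atom e := [set w | eta w = e].

Lemma measurable_atom e : measurable (atom e).
Proof.
have -> : atom e = \big[setI/setT]_x ((eta ^~ x) @^-1` [set e x]).
  apply/seteqP; split => w /=.
    by move=> E; elim/big_ind: _ => //= x _; rewrite -E.
  move=> H; apply/funext => x; move: H; rewrite (bigD1 x)//= => -[] //.
by apply: bigsetI_measurable => x _; rewrite -[X in measurable X]setTI; exact: meta.
Qed.

(** The listed atoms carry the whole mass; their complement is negligible. *)
Lemma ge0_integral_atoms phi : measurable_fun [set: Omega] (phi \o eta) ->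
  (forall e, 0 <= phi e) -> (\int[P]_w (phi (eta w))%:E = (mean s mu phi)%:E)%E.
Proof.
move=> mphi phi0; pose D := \big[setU/set0]_(e <- s) atom e.
have mD : measurable D by apply: bigsetU_measurable => e _; exact: measurable_atom.
have disj : trivIset [set` s] (fun e => atom e) by move=> e f _ _ [w [<- <-]].
have onD (psi : (T -> R) -> R) : measurable_fun [set: Omega] (psi \o eta) -> (forall e, 0 <= psi e) ->
    (\int[P]_(w in D) (psi (eta w))%:E = (mean s mu psi)%:E)%E.
  move=> mpsi psi0; rewrite ge0_integral_bigsetU//; first last.
  - by move=> w _; rewrite lee_fin.
  - by apply/measurable_EFinP; exact: measurable_funTS.
  - exact: measurable_atom.
  rewrite /mean -sumEFin big_seq [RHS]big_seq; apply: eq_bigr => e es.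
  rewrite (eq_integral (cst (psi e)%:E)) => [|w]; last by rewrite inE => ->.
  rewrite integral_cst; last exact: measurable_atom.
  by rewrite [X in (_ * X)%E]law// -EFinM mulrC.
have PD : P D = 1%E.
  have := onD (fun=> 1) (measurable_cst _) (fun=> ler01).
  by rewrite mass1 integral_cst// mul1e.
rewrite (@ge0_negligible_integral _ _ _ P setT (~` D))//.
- by rewrite setTD setCK; exact: onD.
- exact: measurableC.
- exact/measurable_EFinP.
- by move=> w _; rewrite lee_fin.
- transitivity (1 - P D)%E; first exact: (probability_setC P mD).
  by rewrite PD subee.
Qed.

(** The function is made nonnegative by adding C. *)
Lemma bounded_integral_atoms phi (C : R) : measurable_fun [set: Omega] (phi \o eta) ->
  (forall e, `|phi e| <= C) -> (\int[P]_w phi (eta w) = mean s mu phi)%R.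
Proof.
move=> mphi phiC; pose psi e := phi e + C.
have psi0 e : 0 <= psi e by have := phiC e; rewrite ler_norml => /andP[]; rewrite /psi; lra.
have mpsi : measurable_fun [set: Omega] (psi \o eta) by apply: measurable_funD.
have iphi := bounded_integrable P mphi (fun w => phiC (eta w)).
have := ge0_integral_atoms mpsi psi0.
under eq_integral do rewrite EFinD.
rewrite integralD//; last exact: (finite_measure_integrable_cst P C measurableT).
rewrite integral_cst// [X in (_ * X)%E](_ : _ = 1%E); last exact: (probability_setT P).
rewrite mule1 [X in (X + _)%E](bounded_expectation P mphi (fun w => phiC (eta w))) -EFinD => -[].
rewrite meanD (_ : mean s mu (fun=> C) = C); first exact: addIr.
by rewrite -[RHS]mulr1 -mass1 -meanZ; congr mean; apply/funext => ?; rewrite mulr1.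
Qed.

End FinitelySupportedLaw.

Section FluctuationLimit.
Variables (R : realType) (T : finType).
Variables (K : T -> T -> R) (lambda : R) (rho h : T -> R).
Hypothesis K0 : forall x y, 0 <= K x y.
Hypothesis Kirr : irreducible_kernel K.
Hypothesis rho0 : forall x, 0 < rho x.
Hypothesis rho1 : \sum_x rho x = 1.
Hypothesis h0 : forall x, 0 < h x.
Hypothesis rho_h : \sum_x rho x * h x = 1.
Hypothesis Krho : forall y, \sum_x rho x * K x y = (1 - lambda) * rho y.
Hypothesis Kh : kop K h = (fun x => (1 - lambda) * h x).
Variable S : T -> T -> R.
Hypothesis HS : forall f g, pairing rho f = 0 -> pairing rho g = 0 ->
  bilinear_form S (shifted_op K lambda f) g + bilinear_form S f (shifted_op K lambda g)
  = - pairing rho (fun x => f x * g x).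
Variable q : T -> R.
Hypothesis Kq : forall x, \sum_y K x y + q x = 1.
Hypothesis q0 : forall x, 0 <= q x.
Local Notation Q := (limit_form lambda rho S).
Local Notation field n e := (fun x => Num.sqrt n%:R * (e x - rho x)).

(** As e has mass 1, subtracting rho from e amounts to centering f. *)
Lemma pairing_field n (e f : T -> R) (c : R) : \sum_x e x = 1 ->
  pairing (field n e) f + c = wave n (center rho f) c e.
Proof.
move=> e1; rewrite /wave /pairing mulr_sumr /center; congr (_ + c).
transitivity (Num.sqrt n%:R * (\sum_x e x * f x - (\sum_x e x) * pairing rho f)).
  by rewrite e1 mul1r /pairing -sumrB mulr_sumr; apply: eq_bigr => x _; ring.
by rewrite mulr_suml -sumrB mulr_sumr; apply: eq_bigr => x _; ring.
Qed.

Lemma limit_form_center f : Q (center rho f) (center rho f) = Q f f.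
Proof. by rewrite /limit_form [center _ (center _ _)]center0// pairing_center. Qed.

Lemma uniform_characteristic_limit (l : seq (R * (T -> R) * R)) (e : R) : 0 < e ->
  exists N : nat, forall p, p \in l -> forall n s mu, (N <= n)%N -> (2 <= n)%N ->
  stationary_mean K q n s mu ->
  `|mean s mu (fun eta => cos (pairing (field n eta) p.1.2 + p.2))
    - cos p.2 * expR (- (Q p.1.2 p.1.2 / 2))| <= e.
Proof.
move=> e0; elim: l => [|p l [N HN]]; first by exists 0%N.
have [N' HN'] := characteristic_limit K0 Kirr rho0 rho1 h0 rho_h Krho Kh HS Kq q0
  p.2 (pairing_center rho1 p.1.2) e0.
exists (maxn N N') => p' /[!inE] /predU1P[->|p'l] n s mu; rewrite geq_max => /andP[nN nN'] n2 st.
  have := HN' n s mu nN' n2 st; rewrite limit_form_center.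
  by rewrite (mean_eq st (psi := fun eta => cos (wave n (center rho p.1.2) p.2 eta)))// => eta [[_ eta1] _]; rewrite pairing_field.
exact: HN.
Qed.

(** The rescaled form of [deviation_moment]. *)
Lemma field_second_moment : exists2 M : R, 0 <= M & forall n s mu, (2 <= n)%N ->
  stationary_mean K q n s mu ->
  mean s mu (fun e => \sum_x (field n e) x ^+ 2) <= M.
Proof.
have [C C0 HC] := deviation_moment K0 q0 Kq Kirr rho0 rho1 h0 rho_h Krho Kh.
exists C => // n s mu n2 st; have n0 : 0 < n%:R :> R by rewrite ltr0n; exact: ltn_trans n2.
have := HC n s mu n2 st; rewrite ler_pdivlMr// mulrC; apply: le_trans.
rewrite -meanZ; apply: mean_le st _ => e _.
have -> : \sum_x (field n e) x ^+ 2 = n%:R * \sum_x (e x - rho x) ^+ 2.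
  by rewrite mulr_sumr; apply: eq_bigr => x _; rewrite exprMn sqr_sqrtr// ltW.
rewrite ler_pM2l// /deviation expr2 mulr_suml; apply: ler_sum => x _.
rewrite -(real_normK (num_real _)) expr2; apply: ler_wpM2l => //.
by rewrite (bigD1 x)//= lerDl; apply: sumr_ge0.
Qed.

Variables (mu : nat -> (T -> R) -> R) (d : nat -> measure_display).
Variables (Omega : forall n, measurableType (d n)) (Pr : forall n, probability (Omega n) R).
Variable eta : forall n, T -> {RV (Pr n) >-> R}.
Hypothesis stat : forall n, (2 <= n)%N -> exists s, stationary_mean K q n s (mu n) /\ uniq s.
Hypothesis law : forall n, (2 <= n)%N -> forall e, configurations n e ->
  Pr n [set w | (fun x => eta n x w) = e] = (mu n e)%:E.
Variables (d' : measure_display) (Omega' : measurableType d') (Pr' : probability Omega' R).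
Variable xi : T -> {RV Pr' >-> R}.
Hypothesis xi2 : (\int[Pr']_w (\sum_x xi x w ^+ 2)%:E < +oo)%E.
Hypothesis xi_char : forall f c, (\int[Pr']_w cos (pairing (fun x => xi x w) f + c) =
  cos c * expR (- (Q f f / 2)))%R.

(** Only finitely many cosines enter the trigonometric approximation of a
    given test function, and the mean of each of them converges. *)
Lemma fluctuation_cvg : cvg_in_distribution Pr
  (fun n w x => Num.sqrt n%:R * (eta n x w - rho x)) Pr' (fun w x => xi x w).
Proof.
move=> g cg [B gB].
pose X n (w : Omega n) x := Num.sqrt n%:R * (eta n x w - rho x).
pose Y (w : Omega') x := xi x w.
have meta n x : measurable_fun [set: Omega n] (fun w => eta n x w) by exact: measurable_funP.
have mX n x : measurable_fun [set: Omega n] ((X n) ^~ x).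
  by apply: measurable_funM => //; exact: measurable_funB.
have mY x : measurable_fun [set: Omega'] (Y ^~ x) by exact: measurable_funP.
have mgX n := measurable_continuous_ptws (mX n) cg gB.
have mgY := measurable_continuous_ptws mY cg gB.
have eX n : 'E_(Pr n)[fun w => g (X n w)]%E = (\int[Pr n]_w g (X n w))%R%:E.
  by rewrite unlock (bounded_expectation (Pr n) (mgX n) (fun w => gB (X n w))).
have eY : 'E_Pr'[fun w => g (Y w)]%E = (\int[Pr']_w g (Y w))%R%:E.
  by rewrite unlock (bounded_expectation Pr' mgY (fun w => gB (Y w))).
rewrite -[X in _ --> X]/('E_Pr'[fun w => g (Y w)]%E) eY.
rewrite [X in X @ _](_ : _ = fun n => (\int[Pr n]_w g (X n w))%R%:E); last by apply/funext => n; rewrite -eX.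
apply: cvg_EFin; first by apply: nearW.
have [M M0 HM] := field_second_moment.
have Y2_0 : (0 <= \int[Pr']_w (\sum_x Y w x ^+ 2)%:E)%E.
  by apply: integral_ge0 => w _; rewrite lee_fin; apply: sumr_ge0 => x _; exact: sqr_ge0.
pose M' := M + fine (\int[Pr']_w (\sum_x Y w x ^+ 2)%:E)%E.
have M'0 : 0 <= M' by rewrite addr_ge0// fine_ge0.
have HY : (\int[Pr']_w (\sum_x Y w x ^+ 2)%:E <= M'%:E)%E.
  by rewrite EFinD fineK ?leeDr// ge0_fin_numE.
have HX n : (2 <= n)%N -> (\int[Pr n]_w (\sum_x X n w x ^+ 2)%:E <= M'%:E)%E.
  move=> n2; have [s [st us]] := stat n2; have [conf mass _] := st.
  rewrite (@ge0_integral_atoms _ _ _ _ (Pr n) (fun w x => eta n x w) (meta n) s (mu n) us mass _ (fun e => \sum_x (field n e) x ^+ 2)).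
  - by rewrite lee_fin; apply: le_trans (HM n s (mu n) n2 st) _; rewrite lerDl fine_ge0.
  - by move=> e es; apply: law => //; exact: (conf e es).1.
  - by apply: measurable_sum => x; apply: measurable_funX; exact: mX.
  - by move=> e; apply: sumr_ge0 => x _; exact: sqr_ge0.
apply/cvgrPdist_le => e e0; rewrite /=.
have e'0 : 0 < e / (4 * (1 + M')) by rewrite divr_gt0// mulr_gt0// ltr_pwDl.
have [_ [l ->] Hl] := trig_poly_approx cg gB e'0.
pose A := \sum_(p <- l) `|p.1.1|.
have A0 : 0 <= A by apply: sumr_ge0 => p _.
have del0 : 0 < e / (2 * (1 + A)) by rewrite divr_gt0// mulr_gt0// ltr_pwDl.
have [N HN] := uniform_characteristic_limit l del0.
near=> n.
have n2 : (2 <= n)%N by near: n; exact: nbhs_infty_ge.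
have nN : (N <= n)%N by near: n; exact: nbhs_infty_ge.
have [s [st us]] := stat n2; have [conf mass _] := st.
rewrite distrC; apply: le_trans (compare_expectations (mX n) mY (HX n n2) HY cg gB (ltW e'0) Hl) _.
have -> : 2 * (e / (4 * (1 + M')) * (1 + M')) = e / 2.
  by field; apply: lt0r_neq0; rewrite ltr_pwDl.
rewrite [leRHS](splitr e) lerD2l.
apply: le_trans (_ : \sum_(p <- l) `|p.1.1| * (e / (2 * (1 + A))) <= _).
  rewrite big_seq [leRHS]big_seq; apply: ler_sum => p pl; apply: ler_wpM2l => //.
  rewrite xi_char (@bounded_integral_atoms _ _ _ _ (Pr n) (fun w x => eta n x w) (meta n) s (mu n) us mass _ (fun e => cos (pairing (field n e) p.1.2 + p.2)) 1).
  - exact: HN.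
  - by move=> e1 es; apply: law => //; exact: (conf e1 es).1.
  - exact: (measurable_wave (mX n)).
  - by move=> e1; exact: cos_max.
rewrite -mulr_suml -/A mulrA ler_pdivrMr ?mulr_gt0 ?ltr_pwDl//.
by nra.
Unshelve. all: by end_near. Qed.

End FluctuationLimit.

Section RestrictedKernel.
Variables (R : realType) (E : finType) (p : E -> E -> R) (D : {set E}).
Local Notation K := (@restr R E p D).

Lemma killed_semigroupE t f :
  killed_semigroup p t f = op_exp (kop (killed_generator K)) t f.
Proof.
by rewrite /killed_semigroup; congr (op_exp _ t f); apply/funext => g; rewrite kop_killed_generator.
Qed.

Lemma sum_restr_exit_prob x : stochastic p -> \sum_y K x y + exit_prob p x = 1.
Proof.
move=> [_ /(_ (val x))]; rewrite (bigID (fun y => y \in D)) /= => <-; congr (_ + _).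
exact/esym/big_sub.
Qed.

End RestrictedKernel.

Theorem theorem2p4
    (R : realType) (E : finType) (p : E -> E -> R) (D : {set E})
    (pi : pts D -> R) (lambda : R)
    (mu : nat -> (pts D -> R) -> R)
    (d : nat -> measure_display) (Omega : forall n, measurableType (d n))
    (Pr : forall n, probability (Omega n) R)
    (eta : forall n, pts D -> {RV (Pr n) >-> R})
    (Hp : stochastic p)
    (HD : exists x, x \in D)
    (Hirr : irreducible_restr p D)
    (Hpi : quasistationary p pi)
    (Hlambda : spectral_radius (restr_mx p D) = 1 - lambda)
    (Hmu : forall n, (2 <= n)%N -> fv_stationary p n (mu n))
    (Heta : forall n, (2 <= n)%N ->
       forall rho, empirical_measures n rho ->
         Pr n [set w | (fun x => eta n x w) = rho] = (mu n rho)%:E) :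
  exists K : (pts D -> R) -> pts D -> R,
    fluctuation_covariance p lambda pi K /\
    exists (d' : measure_display) (Omega' : measurableType d')
        (Pr' : probability Omega' R) (xi : pts D -> {RV Pr' >-> R}),
      [/\ centered_gaussian xi,
          has_covariance xi K &
          cvg_in_distribution Pr
            (fun n w x => Num.sqrt n%:R * (eta n x w - pi x))
            Pr' (fun w x => xi x w)].
Proof.
pose P := @restr R E p D; pose q := @exit_prob R E p D.
have P0 x y : 0 <= P x y by exact: Hp.1.
have q0 x : 0 <= q x by apply: sumr_ge0 => y _; exact: Hp.1.
have Pq x : \sum_y P x y + q x = 1 by exact: sum_restr_exit_prob.
have Pirr : irreducible_kernel P by exact: Hirr.
have [[pi_ge0 pi1] qsd] := Hpi.
have pi_neq0 : exists x, pi x != 0.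
  apply/not_existsP => H; move: pi1; rewrite big1 => [/esym/eqP|x _]; first by rewrite oner_eq0.
  by apply/eqP/negPn/negP; exact: H.
have piP y : \sum_x pi x * P x y = pairing pi (kop P (fun=> 1)) * pi y.
  apply: quasistationary_eigenmeasure => // t t0 A.
  by rewrite -!killed_semigroupE; exact: qsd.
set k := pairing pi (kop P (fun=> 1)) in piP.
have k_ge0 : 0 <= k.
  by apply: sumr_ge0 => x _; apply: mulr_ge0 => //; apply: sumr_ge0 => y _; rewrite mulr1.
have [_ pi0] := eigenmeasure_gt0 P0 Pirr k_ge0 (pairing_kop piP) pi_ge0 pi_neq0.
have [h' [Ph' h'_ge0 h'_neq0]] := exists_nonneg_eigenfunction P0 k_ge0 piP pi0 pi_neq0.
have h'0 := eigenfunction_gt0 P0 Pirr Ph' h'_ge0 h'_neq0.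
have kE : k = 1 - lambda.
  by rewrite -Hlambda; apply/esym; exact: (spectral_radius_eigen P0 k_ge0 piP pi_neq0 Ph' h'0).
rewrite {}kE in piP Ph'.
(* The eigenfunction is normalized by its integral c. *)
pose c := pairing pi h'.
have c0 : 0 < c.
  have [x _] := pi_neq0; rewrite /c /pairing (bigD1 x)//= ltr_pwDl ?mulr_gt0//.
  by apply: sumr_ge0 => y _; rewrite mulr_ge0// ltW.
pose h x := c^-1 * h' x.
have h0 x : 0 < h x by rewrite mulr_gt0// invr_gt0.
have pi_h : \sum_x pi x * h x = 1.
  rewrite -[RHS](mulVf (lt0r_neq0 c0)) /c {2}/pairing mulr_sumr.
  by apply: eq_bigr => x _; rewrite mulrCA.
have Ph : kop P h = fun x => (1 - lambda) * h x.
  apply/funext => x; rewrite mulrCA -(congr1 (fun f => f x) Ph') /kop mulr_sumr.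
  by apply: eq_bigr => y _; rewrite mulrCA.
have [S HS] := exists_lyapunov_form P0 Pirr pi0 h0 pi_h piP Ph.
exists (limit_operator lambda pi S); split.
  split.
  - move=> a f g; apply/funext => x; exact: limit_form_linear.
  - by move=> f g; rewrite !pairing_limit_operator limit_form_sym.
  - by apply/funext => x; exact: limit_form_cst1.
  - move=> f f0; rewrite pairing_limit_operator.
    under eq_integral do rewrite killed_semigroupE.
    rewrite (limit_form_integral P0 Pirr pi0 h0 pi_h piP Ph HS f0) -EFinM -EFinD.
    rewrite /limit_form !center0// /variance_wrt f0; congr ((_ + _)%:E).
    by apply: eq_bigr => x _; rewrite subr0.
pose C x y := limit_form lambda pi S (fun z => (z == x)%:R) (fun z => (z == y)%:R).
have CE f : limit_form lambda pi S f f = bilinear_form C f f.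
  rewrite -pairing_limit_operator /pairing /bilinear_form exchange_big.
  apply: eq_bigr => y _; rewrite /limit_operator limit_form_sym -pairing_limit_operator.
  by rewrite /pairing mulr_suml; apply: eq_bigr => x _; rewrite /limit_operator limit_form_sym.
have C_sym x y : C x y = C y x by exact: limit_form_sym.
have C_psd f : 0 <= bilinear_form C f f.
  by rewrite -CE; exact: (limit_form_ge0 P0 Pirr pi0 pi1 h0 pi_h piP Ph HS Pq q0).
have [s Hs] := sum_of_squares C_sym C_psd.
have [d' [Om [Pr' [xi [gauss cov xi2 xi_char]]]]] := exists_gaussian s.
exists d', Om, Pr', xi; split => //.
  by move=> f; rewrite cov pairing_limit_operator CE Hs.
apply: (fluctuation_cvg P0 Pirr pi0 pi1 h0 pi_h piP Ph HS Pq q0 (mu := mu)) => //.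
- move=> n n2; have [mu0 mu1 inv] := Hmu n n2.
  by have [l [st us _]] := stationary_meanP P0 q0 Pq n2 mu0 mu1 inv; exists l.
- by move=> f u; rewrite xi_char CE Hs mulr_suml.
Qed.
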